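(* Let $\mu$ be a Borel probability measure on $\mathbb C$ whose support $K$ is a compact and infinite set, let $(q_k)_k$ be the sequence of monic orthogonal polynomials associated to $\mu$, let $\mu_k$ be the root distribution of $q_k$, and let $\Omega$ be the unbounded connected component of $\mathbb C\setminus K$. Suppose that a subsequence $(\mu_{k_j})_j$ of the root distributions converges weak* to $\nu$. Then for every $m=0,1,2,\ldots$ $$\xi_{k_j,m}-\xi_{k_j}\ \longrightarrow\ m\,\xi_{p_\nu'}\quad\text{on }\Omega\text{ as }j\to\infty,$$ where $\xi_{k,m}=\xi_{q_k^{(m)}}$, $\xi_k=\xi_{q_k}$ and $\xi_{p_\nu'}$ are the divisors on $\Omega$ of the $m$th derivative $q_k^{(m)}$, of $q_k$, and of the holomorphic function $p_\nu'$; that is, $\xi_{k_j,m}(\phi)-\xi_{k_j}(\phi)\to m\,\xi_{p_\nu'}(\phi)$ as $j\to\infty$ for every $\phi\in\mathscr C_c(\Omega)$.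
   Context: The monic orthogonal polynomial $q_k$ associated to $\mu$ is the monic polynomial of degree $k$ with $\int q_k(z)\overline{z^{l}}\,d\mu(z)=0$ for $0\le l<k$. Write $q_k(z)=\prod_{j=1}^{k}(z-z_{k,j})$, roots repeated with multiplicity; the root distribution is the probability measure $\mu_k=\frac1k\sum_{j=1}^k\delta_{z_{k,j}}$ ($k\ge1$). Weak* convergence is as probability measures on the Riemann sphere $\widehat{\mathbb C}$, i.e. tested against continuous functions on $\widehat{\mathbb C}$. The potential of a finite compactly supported Borel measure $\nu$ is $p_\nu(z)=\int\log|z-w|\,d\nu(w)$. (Any weak* limit point $\nu$ of $(\mu_k)_k$ has compact support disjoint from $\Omega$, so $p_\nu$ is harmonic on $\Omega$.) For a harmonic function $h$, put $h'=2\frac{\partial h}{\partial z}=\left(\frac{\partial}{\partial x}-i\frac{\partial}{\partial y}\right)h$ with $z=x+iy$; $h'$ is holomorphic. A divisor on an open set $U$ is a map $\xi:U\to\mathbb Z$ such that $\{z:\xi(z)\ne0\}$ has no accumulation points in $U$. $\mathscr C_c(U)$ is the space of continuous functions with compact support in $U$; a divisor acts on $\phi\in\mathscr C_c(U)$ by $\xi(\phi)=\sum_z\xi(z)\phi(z)$ (a finite sum). Convergence $\xi_k\to\xi$ of divisors on $U$ means $\xi_k(\phi)\to\xi(\phi)$ for every $\phi\in\mathscr C_c(U)$. For a holomorphic function $f$ on $U$ that is not identically zero on any component of $U$, its divisor $\xi_f$ is given by $\xi_f(z)=$ the order of the zero of $f$ at $z$ (and $0$ if $f(z)\neq0$). For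 given $m$, $\xi_{k,m}$ is considered only for $k\ge m$, so that $q_k^{(m)}\not\equiv0$. *)

(* Defs.v *)
From HB Require Import structures.
From mathcomp Require Import all_boot all_order all_algebra.
From mathcomp Require Import all_classical all_reals all_analysis.
From mathcomp Require Import complex.
Set Implicit Arguments. Unset Strict Implicit. Unset Printing Implicit Defensive.
Import Order.TTheory GRing.Theory Num.Theory.
Import numFieldNormedType.Exports.



(* The library puts its topology only on abstract numeric fields; these
   instances give the field R[i] the topology of its modulus and make it a
   normed module over itself, so that [derivable f z 1] for f : R[i] -> R[i]
   is complex differentiability at z. *)
HB.instance Definition _ (R : realType) :=
  PseudoPointedMetric.copy R[i] R[i]^o.
HB.instance Definition _ (R : realType) := GRing.ComAlgebra.copy R[i] R[i]^o.
HB.instance Definition _ (R : realType) := Vector.copy R[i] R[i]^o.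
HB.instance Definition _ (R : realType) := NormedModule.copy R[i] R[i]^o.

Local Open Scope classical_set_scope.
Local Open Scope ring_scope.

Notation borel T := (g_sigma_algebraType (@open T)).
Notation sphere R := (one_point_compactification R[i]).

Section measures.
Context {R : realType}.

Definition msupport (mu : {measure set (borel R[i]) -> \bar R}) : set R[i] :=
  [set z | forall U : set R[i], open_nbhs z U -> (0 < mu U)%E].

Definition unbounded_component (K : set R[i]) : set R[i] :=
  [set z | (~` K) z /\ ~ bounded_set (connected_component (~` K) z)].

Definition cintegral (mu : {measure set (borel R[i]) -> \bar R})
    (f : R[i] -> R[i]) : R[i] :=
  ((Rintegral mu setT (fun z => complex.Re (f z)))
    +i* (Rintegral mu setT (fun z => complex.Im (f z))))%C.

Definition monic_orthogonal (mu : {measure set (borel R[i]) -> \bar R})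
    (k : nat) (q : {poly R[i]}) : Prop :=
  [/\ q \is monic, size q = k.+1 &
      forall l : nat, (l < k)%N ->
        cintegral mu (fun z => q.[z] * (z ^+ l)^*) = 0].

(* all roots of p, each repeated according to its multiplicity *)
Definition root_seq (p : {poly R[i]}) : seq R[i] :=
  sval (closed_field_poly_normal p).

(* Viewed on the sphere, where [Some] is the embedding of the plane. It is the
   zero measure when p has no root. *)
Definition root_distribution (p : {poly R[i]}) :
    {measure set (borel (sphere R)) -> \bar R} :=
  mscale ((size (root_seq p))%:R^-1)%:nng
    (msum (fun j => \d_(Some (root_seq p)`_j : borel (sphere R)))
          (size (root_seq p))).

Definition weak_star_cvg
    (mu_ : nat -> {measure set (borel (sphere R)) -> \bar R})
    (nu : {measure set (borel (sphere R)) -> \bar R}) : Prop :=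
  forall f : sphere R -> R, continuous f ->
    (fun j => Rintegral (mu_ j) setT f) @ \oo --> Rintegral nu setT f.

(* Restriction to the plane, dropping any mass at the point [None] at infinity. *)
Definition plane_part (nu : {measure set (borel (sphere R)) -> \bar R})
    (A : set (borel R[i])) : \bar R :=
  nu (Some @` A : set (borel (sphere R))).

Lemma measurable_plane (A : set (borel R[i])) :
  measurable A -> measurable (Some @` A : set (borel (sphere R))).
Proof.
move=> mA.
pose S : set_system (borel R[i]) :=
  [set A | measurable (Some @` A : set (borel (sphere R)))].
have mS : measurable (Some @` setT : set (borel (sphere R))).
  apply: sub_sigma_algebra.
  by apply: one_point_compactification_open_some; exact: openT.
suff: <<s @open R[i] >> `<=` S by apply.
apply: smallest_sub; last first.
  move=> U oU; apply: sub_sigma_algebra.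
  exact: one_point_compactification_open_some.
split.
- by rewrite /S /= image_set0; exact: measurable0.
- move=> B SB; rewrite /S /=.
  have -> : Some @` (setT `\` B) = Some @` setT `\` Some @` B :> set (sphere R).
    apply/seteqP; split=> [_ [x [_ nB] <-]|_ [[x _ <-] nB]].
      by split; [exists x | move=> [y By [yx]]; apply: nB; rewrite -yx].
    by exists x => //; split => // Bx; apply: nB; exists x.
  exact: measurableD.
- move=> F SF; rewrite /S /= image_bigcup.
  by apply: bigcup_measurable => i _; exact: SF.
Qed.

Section plane_part_measure.
Variable nu : {measure set (borel (sphere R)) -> \bar R}.

Let plane_part0 : plane_part nu set0 = 0%E.
Proof. by rewrite /plane_part image_set0 measure0. Qed.

Let plane_part_ge0 A : (0 <= plane_part nu A)%E.
Proof. exact: measure_ge0. Qed.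

Let plane_part_sigma_additive : semi_sigma_additive (plane_part nu).
Proof.
move=> F mF tF mUF; rewrite /plane_part image_bigcup.
apply: measure_semi_sigma_additive.
- by move=> i; exact: measurable_plane.
- apply/trivIsetP => i j _ _ ij; apply/seteqP; split=> // _ [[x Fx <-]].
  move=> [y Fy [yx]]; have /trivIsetP/(_ i j I I ij) := tF.
  by rewrite -subset0; apply; split; [exact: Fx | rewrite -yx].
- by apply: bigcup_measurable => i _; exact: measurable_plane.
Qed.

HB.instance Definition _ := isMeasure.Build _ _ _ (plane_part nu)
  plane_part0 plane_part_ge0 plane_part_sigma_additive.

End plane_part_measure.

(* Extended-real valued: [lne 0 = -oo]. *)
Definition potential (nu : {measure set (borel R[i]) -> \bar R}) (z : R[i]) :
    \bar R :=
  (\int[nu]_w lne (ComplexField.Normc.normc (z - w))%:E)%E.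

(* twice the Wirtinger derivative with respect to z: h_x - i h_y *)
Definition harmonic_deriv (h : R[i] -> R) (z : R[i]) : R[i] :=
  (derive1 (fun t : R => h (z + (t +i* 0))) 0
    -i* derive1 (fun t : R => h (z + (0 +i* t))) 0)%C.

Definition potential_deriv (nu : {measure set (borel R[i]) -> \bar R}) :
    R[i] -> R[i] :=
  harmonic_deriv (fun z => fine (potential nu z)).

End measures.

Section divisors.
Context {R : realType}.
Implicit Types (U : set R[i]) (f : R[i] -> R[i]) (xi : R[i] -> int).

(* A divisor on U is represented by a function on the whole plane, whose
   values outside U are irrelevant. *)
Definition is_divisor U xi : Prop :=
  forall z, U z -> ~ limit_point [set w | U w /\ xi w != 0] z.

(* C_c(U), each function being extended by 0 outside U *)
Definition Cc U : set (R[i] -> R[i]) :=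
  [set phi | [/\ continuous phi,
     compact (closure [set z | phi z != 0]) &
     closure [set z | phi z != 0] `<=` U]].

(* The sum over an infinite support is 0 by convention; for a divisor on U
   and a function in [Cc U] the support is finite. *)
Definition divisor_action U xi (phi : R[i] -> R[i]) : R[i] :=
  \sum_(z \in U) (xi z)%:~R * phi z.

Definition divisor_cvg U (xi_ : nat -> R[i] -> int) xi : Prop :=
  [/\ \forall j \near \oo, is_divisor U (xi_ j),
      is_divisor U xi &
      forall phi, Cc U phi ->
        (fun j => divisor_action U (xi_ j) phi) @ \oo -->
          divisor_action U xi phi].

Definition has_zero_order f (z : R[i]) (n : nat) : Prop :=
  exists g : R[i] -> R[i],
    [/\ \forall w \near z, derivable g w 1,
        g z != 0 &
        \forall w \near z, f w = (w - z) ^+ n * g w].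

(* 0 by convention when f has no finite order at z *)
Definition zero_order f (z : R[i]) : nat :=
  xget 0%N [set n | has_zero_order f z n].

Definition zero_divisor f : R[i] -> int := fun z => (zero_order f z)%:Z.

End divisors.

(* Main.v *)
Require Import Defs.
From HB Require Import structures.
From mathcomp Require Import all_boot all_order all_algebra.
From mathcomp Require Import all_classical all_reals all_analysis.
From mathcomp Require Import measurable_realfun complex.
From mathcomp Require Import ring lra.
Import Order.TTheory GRing.Theory Num.Theory.
Import numFieldNormedType.Exports.
Local Open Scope classical_set_scope.
Local Open Scope ring_scope.

(** The idea is to compare zeros locally.  Near a point x of Omega write
    q_k = a b, where a carries the zeros of q_k close to x and b the others.
    The number of the former is bounded independently of k, so that
    b'/(k b), which is 1/k times the sum of 1/(z - w) over the zeros w of b,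
    tends to g = p_nu' uniformly near x ([log_derivative_cvg]).  Writing
    P'/(k b) = (P/b)'/k + (P/b) (b'/(k b)), each differentiation multiplies
    the limit of P/b by g, and q_k^(m)/(k^m b) behaves like a g^m
    ([derivn_cvg]).  If n zeros of q_k tend to x, the limit is
    (z - x)^n g^m, and by Hurwitz's theorem n + m ord_x(g) zeros of q_k^(m)
    tend to x ([local_counts]).  The number n may depend on the subsequence;
    reasoning along an ultrafilter makes it constant, and [sum_limit] adds
    the contributions of the finitely many points that matter for a given
    test function.

    Boundedness of the number of zeros comes from extremality: q_k minimises
    the norm of L^2(mu) among monic polynomials of degree k ([no_better]).  By
    pushing poles inside Omega one finds a polynomial in 1/(z - x) with constant
    term 1 that is small on K ([hull_separation]); hence a product of m factors
    z - w, with w close to x and m fixed, can be replaced by a smaller monic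
    polynomial ([smaller_factor]), and q_k has fewer than m zeros near x.  Likewise no
    zero is far from K.  Therefore nu lives on a disc and does not charge
    Omega, its potential at z near x is the limit of 1/k times the sums of
    log|z - w| over the zeros w of b, and a second order estimate of log|z - w| in z,
    uniform in w, identifies the limit of b'/(k b) with the Wirtinger
    derivative of the potential ([cluster_deriv]).  That g has isolated zeros
    follows by connectedness, as g(z) is close to 1/z far away
    ([nearby_neq0]).

    All the functions of a complex variable that occur are uniform limits of
    rational functions without poles.  The maximum modulus principle for
    N/B, with an elementary proof ([max_modulus]), yields the Cauchy
    estimate, the factorisation (z - x)^d G at a zero, and Hurwitz's theorem,
    without contour integrals. *)
Set Implicit Arguments. Unset Strict Implicit. Unset Printing Implicit Defensive.

(** * The plane and its modulus *)

Section modulus.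
Context {R : realType}.
Implicit Types (z w : R[i]) (r e : R).

(** The norm of R[i] takes its values in R[i]; estimates are made in R. *)
Definition cmod z : R := ComplexField.Normc.normc z.

Arguments cmod : simpl never.

Lemma cmodE z : `|z| = (cmod z)%:C%C.
Proof. by []. Qed.

Lemma cmod0 : cmod 0 = 0.
Proof. exact: ComplexField.Normc.normc0. Qed.

Lemma cmod1 : cmod 1 = 1.
Proof. exact: ComplexField.Normc.normc1. Qed.

Lemma cmodM : {morph cmod : z w / z * w}.
Proof. exact: ComplexField.Normc.normcM. Qed.

Lemma cmodV z : cmod z^-1 = (cmod z)^-1.
Proof. exact: ComplexField.Normc.normcV. Qed.

Lemma cmodN z : cmod (- z) = cmod z.
Proof. exact: (@normcN _ (z : Rcomplex R)). Qed.

Lemma cmodBC z w : cmod (z - w) = cmod (w - z).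
Proof. by rewrite -cmodN opprB. Qed.

Lemma cmodD z w : cmod (z + w) <= cmod z + cmod w.
Proof. exact: (@le_normcD _ (z : Rcomplex R)). Qed.

Lemma cmodB z w : cmod (z - w) <= cmod z + cmod w.
Proof. by rewrite -[cmod w]cmodN cmodD. Qed.

Lemma cmod_tri z w u : cmod (z - u) <= cmod (z - w) + cmod (w - u).
Proof. by apply: le_trans (cmodD _ _); rewrite addrA subrK. Qed.

Lemma cmod_ge0 z : 0 <= cmod z.
Proof. by case: z => a b; exact: sqrtr_ge0. Qed.

Lemma cmod_eq0 z : (cmod z == 0) = (z == 0).
Proof.
apply/eqP/eqP => [/ComplexField.Normc.eq0_normc//|->]; exact: cmod0.
Qed.

Lemma cmod_gt0 z : (0 < cmod z) = (z != 0).
Proof. by rewrite lt_def cmod_ge0 andbT cmod_eq0. Qed.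

Lemma cmodX z n : cmod (z ^+ n) = cmod z ^+ n.
Proof. by elim: n => [|n IH]; rewrite ?cmod1// !exprS cmodM IH. Qed.

Lemma cmod_real r : cmod r%:C%C = `|r|.
Proof. by rewrite /cmod /= expr0n /= addr0 sqrtr_sqr. Qed.

Lemma cmod_sqr z : cmod z ^+ 2 = complex.Re z ^+ 2 + complex.Im z ^+ 2.
Proof.
case: z => a b; rewrite /cmod /= sqr_sqrtr//.
by rewrite addr_ge0// sqr_ge0.
Qed.

Lemma Re_le_cmod z : `|complex.Re z| <= cmod z.
Proof.
rewrite -(@ler_pXn2r _ 2)// ?nnegrE ?normr_ge0 ?cmod_ge0//.
by rewrite cmod_sqr real_normK ?num_real// lerDl sqr_ge0.
Qed.

Lemma Im_le_cmod z : `|complex.Im z| <= cmod z.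
Proof.
rewrite -(@ler_pXn2r _ 2)// ?nnegrE ?normr_ge0 ?cmod_ge0//.
by rewrite cmod_sqr real_normK ?num_real// lerDr sqr_ge0.
Qed.

Lemma cmod_le_ReIm z : cmod z <= `|complex.Re z| + `|complex.Im z|.
Proof.
case: z => a b /=.
have {1}-> : Complex a b = a%:C%C + Complex 0 b.
  by apply/eqP; rewrite eq_complex /= addr0 add0r !eqxx.
apply: le_trans (cmodD _ _) _; rewrite cmod_real lerD2l.
by rewrite /cmod /= expr0n /= add0r sqrtr_sqr.
Qed.

Lemma cmodJ z : cmod (z^*)%R = cmod z.
Proof. by case: z => a b; rewrite /cmod /= sqrrN. Qed.

Lemma cmod_dist z w : `|cmod z - cmod w| <= cmod (z - w).
Proof.
rewrite ler_norml; apply/andP; split.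
  rewrite lerNl opprB lerBlDr addrC cmodBC.
  by rewrite -{1}(subrK z w) addrC cmodD.
by rewrite lerBlDr -{1}(subrK w z) cmodD.
Qed.

Lemma cmod_sum (I : Type) (s : seq I) (P : pred I) (F : I -> R[i]) :
  cmod (\sum_(i <- s | P i) F i) <= \sum_(i <- s | P i) cmod (F i).
Proof.
elim/big_rec2: _ => [|i x y _ IH]; first by rewrite cmod0.
by apply: le_trans (cmodD _ _) _; rewrite lerD2l.
Qed.

Definition cdisk z r : set R[i] := [set w | cmod (w - z) <= r].

Lemma nbhs_cmodP z (A : set R[i]) :
  nbhs z A <-> exists2 r, 0 < r & forall w, cmod (w - z) < r -> A w.
Proof.
split.
  move=> /nbhs_ballP[e e0 eA]; exists (complex.Re e).
    by move: e0; rewrite /= ltcE /= => /andP[].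
  move=> w wz; apply: eA; rewrite -ball_normE /= distrC cmodE ltcE /=.
  move: e0; rewrite /= ltcE /= => /andP[/eqP <- _]; by rewrite eqxx.
move=> [r r0 rA]; apply/nbhs_ballP; exists r%:C%C.
  by rewrite /= ltcE /= eqxx.
move=> w; rewrite -ball_normE /= distrC cmodE ltcE /= eqxx /=; exact: rA.
Qed.

Lemma nbhs_disk z r : 0 < r -> nbhs z (cdisk z r).
Proof.
by move=> r0; apply/nbhs_cmodP; exists r => // w /ltW.
Qed.

Lemma cvg_cmodP (T : Type) (F : set_system T) {FF : Filter F} (f : T -> R[i]) l :
  f @ F --> l <-> forall e, 0 < e -> \forall x \near F, cmod (f x - l) < e.
Proof.
split=> [fl e e0|H A /nbhs_cmodP[r r0 rA]].
  by apply: (fl [set w | cmod (w - l) < e]); apply/nbhs_cmodP; exists e.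
by apply: filterS (H r r0) => x; exact: rA.
Qed.

Lemma continuous_cmodP (f : R[i] -> R[i]) z :
  {for z, continuous f} <-> forall e, 0 < e ->
    exists2 d, 0 < d & forall w, cmod (w - z) < d -> cmod (f w - f z) < e.
Proof.
split=> [fz e e0|H].
  have [d d0 dH] := (nbhs_cmodP z _).1 ((@cvg_cmodP _ (nbhs z) (nbhs_filter z) f (f z)).1 fz e e0).
  by exists d.
refine ((@cvg_cmodP _ (nbhs z) (nbhs_filter z) f (f z)).2 _) => e e0; have [d d0 dH] := H e e0.
by apply/nbhs_cmodP; exists d.
Qed.

Lemma cmod_continuous : continuous (cmod : R[i] -> R).
Proof.
move=> z; apply/(@cvgrPdist_lt _ _ _ (nbhs z)) => e e0; apply/nbhs_cmodP; exists e => // w wz.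
by rewrite distrC (le_lt_trans (cmod_dist _ _)).
Qed.

Lemma cmodB_continuous (u : R[i]) : continuous (fun z => cmod (z - u)).
Proof.
move=> z; apply/(@cvgrPdist_lt _ _ _ (nbhs z)) => e e0; apply/nbhs_cmodP; exists e => // w wz.
rewrite distrC (le_lt_trans (cmod_dist _ _))//.
by rewrite opprB addrA subrK.
Qed.

Lemma Re_continuous : continuous (@complex.Re R).
Proof.
move=> z; apply/(@cvgrPdist_lt _ _ _ (nbhs z)) => e e0; apply/nbhs_cmodP; exists e => // w wz.
rewrite distrC; have <- : complex.Re (w - z) = complex.Re w - complex.Re z by case: w {wz} => ? ?; case: z => ? ?.
by rewrite (le_lt_trans (Re_le_cmod _)).
Qed.

Lemma Im_continuous : continuous (@complex.Im R).
Proof.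
move=> z; apply/(@cvgrPdist_lt _ _ _ (nbhs z)) => e e0; apply/nbhs_cmodP; exists e => // w wz.
rewrite distrC; have <- : complex.Im (w - z) = complex.Im w - complex.Im z by case: w {wz} => ? ?; case: z => ? ?.
by rewrite (le_lt_trans (Im_le_cmod _)).
Qed.

Lemma horner_continuous (p : {poly R[i]}) : continuous (horner p).
Proof.
elim/poly_ind: p => [|p c IH] z.
  have -> : horner 0 = cst 0 :> (R[i] -> R[i]) by apply/funext => x; rewrite horner0.
  exact: cst_continuous.
have -> : horner (p * 'X + c%:P) = (fun x => p.[x] * x + c).
  by apply/funext => x; rewrite hornerMXaddC.
apply: (@cvgD _ _ _ (nbhs z)); last exact: cvg_cst.
by apply: (@cvgM _ _ (nbhs z)); [exact: IH | exact: cvg_id].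
Qed.

Lemma Complex_continuous : continuous (fun p : R * R => (p.1 +i* p.2)%C).
Proof.
move=> [a b]; apply: (@cvg_cmodP _ (nbhs (a, b)) (nbhs_filter (a, b)) (fun p : R * R => (p.1 +i* p.2)%C) _).2 => e e0.
have e2 : 0 < e / 2 by rewrite divr_gt0.
exists (ball a (e / 2), ball b (e / 2)).
  by split; exact: nbhsx_ballx.
move=> [c d] [/=]; rewrite -!ball_normE /= => ac bd.
apply: le_lt_trans (cmod_le_ReIm _) _; rewrite /= distrC [X in _ + X]distrC.
by rewrite [ltRHS]splitr ltrD.
Qed.

Lemma cdisk_closed z r : closed (cdisk z r).
Proof.
have -> : cdisk z r = (fun w => cmod (w - z)) @^-1` [set x | x <= r] by [].
apply: preimage_closed; last exact: closed_le.
by move=> w _; exact: cmodB_continuous.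
Qed.

(** A closed disc is a closed part of the image of a square under the
    continuous map from R * R to the plane. *)
Lemma cdisk_compact z r : compact (cdisk z r).
Proof.
pose a := complex.Re z; pose b := complex.Im z.
have cB : compact ((fun p : R * R => (p.1 +i* p.2)%C) @`
    (`[a - r, a + r] `*` `[b - r, b + r])).
  apply: continuous_compact.
    by apply: continuous_subspaceT; exact: Complex_continuous.
  by apply: compact_setX; exact: segment_compact.
apply: subclosed_compact cB _; first exact: cdisk_closed.
move=> [c d]; rewrite /cdisk /= => zr; exists (c, d) => //=.
have := le_trans (Re_le_cmod _) zr; have := le_trans (Im_le_cmod _) zr.
rewrite /a /b; case: (z) => a' b' /=; rewrite !ler_norml => /andP[? ?] /andP[? ?].
by split; rewrite /= in_itv /=; apply/andP; split; lra.
Qed.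

Lemma compact_cmod_bounded (A : set R[i]) :
  compact A -> exists2 r, 0 < r & forall z, A z -> cmod z <= r.
Proof.
move=> cA; have [->|/set0P A0] := eqVneq A set0; first by exists 1.
have [c _ cM] := compact_EVT_max A0 cA (continuous_subspaceT cmod_continuous).
exists (cmod c + 1); first by rewrite ltr_wpDl// cmod_ge0.
by move=> z Az; rewrite (le_trans (cM z _)) ?lerDl ?ler01 ?inE.
Qed.

Lemma hausdorffC : hausdorff_space R[i].
Proof. exact: norm_hausdorff. Qed.

Lemma closed_cmodP (A : set R[i]) z : closed A -> ~ A z ->
  exists2 r, 0 < r & forall w, cmod (w - z) < r -> ~ A w.
Proof.
move=> cA Az; have := open_nbhs_nbhs (conj (closed_openC cA) Az).
by move=> /nbhs_cmodP.
Qed.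

End modulus.

(** * Maximum modulus principle for rational functions *)

Section maximum_modulus.
Context {R : realType}.
Implicit Types (N B : {poly R[i]}) (z w : R[i]) (s M : R).

Lemma ratio_continuous N B z : B.[z] != 0 ->
  {for z, continuous (fun w => N.[w] / B.[w])}.
Proof.
move=> Bz; apply: (@cvgM _ _ (nbhs z)); first exact: horner_continuous.
by apply: (@cvgV _ _ (nbhs z)) => //; exact: horner_continuous.
Qed.

Lemma Re_cmod_le z : complex.Re z <= cmod z.
Proof. exact: le_trans (ler_norm _) (Re_le_cmod z). Qed.

Lemma circle_point z s : 0 <= s -> cmod (z + s%:C%C - z) = s.
Proof. by move=> s0; rewrite addrC addKr cmod_real ger0_norm. Qed.

(** Suppose that |N/B| is maximal, and larger than M, at an interior point z1,
    with value c there.  Then N - cB vanishes at z1 to some finite order n, and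
    N/B = c (1 + t^n h) at z1 + t zeta, where h is close to 1 for small t if
    zeta^n is suitably chosen: the modulus increases in the direction zeta. *)
Lemma max_modulus N B z0 s M : 0 < s ->
  (forall z, cmod (z - z0) <= s -> B.[z] != 0) ->
  (forall z, cmod (z - z0) = s -> cmod N.[z] <= M * cmod B.[z]) ->
  forall z, cmod (z - z0) <= s -> cmod N.[z] <= M * cmod B.[z].
Proof.
move=> s0 B0 NB.
have Bgt0 z : cmod (z - z0) <= s -> 0 < cmod B.[z].
  by move=> /B0; rewrite cmod_gt0.
pose zb := z0 + s%:C%C.
have zbE : cmod (zb - z0) = s by rewrite circle_point// ltW.
have M0 : 0 <= M.
  have := NB _ zbE; move=> /(le_trans (cmod_ge0 _)).
  by rewrite pmulr_lge0// Bgt0 ?zbE.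
pose phi z : R := cmod (N.[z] / B.[z]).
have phiE z : cmod (z - z0) <= s -> cmod N.[z] = phi z * cmod B.[z].
  by move=> zs; rewrite -cmodM divfK// B0.
have cphi : {within cdisk z0 s, continuous phi}.
  apply: continuous_in_subspaceT => z; rewrite inE => zs.
  apply: (@continuous_comp _ _ _ (fun w => N.[w] / B.[w]) cmod).
    exact/ratio_continuous/B0.
  exact: cmod_continuous.
have D0 : cdisk z0 s !=set0 by exists zb; rewrite /cdisk /= zbE.
have [z1 z1D z1max] := compact_EVT_max D0 (@cdisk_compact _ z0 s) cphi.
rewrite inE /cdisk /= in z1D.
suff phi1 : phi z1 <= M.
  move=> z zs; rewrite phiE// ler_wpM2r ?cmod_ge0// (le_trans _ phi1)//.
  by apply: z1max; rewrite inE.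
rewrite leNgt; apply/negP => Mlt.
set c := N.[z1] / B.[z1].
have c0 : c != 0 by rewrite -cmod_gt0 (le_lt_trans M0 Mlt).
have z1s : cmod (z1 - z0) < s.
  rewrite lt_neqAle z1D andbT; apply/eqP => z1E.
  have := NB _ z1E; rewrite phiE ?z1E// ler_pM2r ?Bgt0 ?z1E//.
  by rewrite leNgt Mlt.
pose P := N - c *: B.
have P1 : P.[z1] = 0 by rewrite !hornerE /c divfK ?subrr// B0.
have P0 : P != 0.
  apply/eqP => PE; have := NB _ zbE.
  have -> : N = c *: B by apply/eqP; rewrite -subr_eq0 -/P PE.
  by rewrite hornerE cmodM ler_pM2r ?Bgt0 ?zbE// leNgt Mlt.
have [n [Q]] := multiplicity_XsubC P z1.
rewrite P0 /= => Q1 PE.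
have n0 : (0 < n)%N.
  rewrite lt0n; apply/eqP => n0; move: P1 Q1.
  by rewrite PE n0 expr0 mulr1 /root => ->; rewrite eqxx.
pose eta := Q.[z1] / (c * B.[z1]).
have cB1 : c * B.[z1] != 0 by rewrite mulf_neq0// B0.
have eta0 : eta != 0 by rewrite mulf_neq0// invr_eq0.
(* this direction makes the perturbation of N/B positive relative to c *)
pose zeta : R[i] := n.-root eta^-1.
have zetaE : zeta ^+ n * eta = 1 by rewrite rootCK// mulVf.
pose h z := zeta ^+ n * (Q.[z] / (c *: B).[z]).
have h1 : h z1 = 1 by rewrite /h hornerZ.
have ch : {for z1, continuous h}.
  apply: (@cvgM _ _ (nbhs z1)); first exact: cvg_cst.
  by apply: ratio_continuous; rewrite hornerZ.
have half0 : (0 : R) < 1 / 2 by rewrite divr_gt0.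
have [d d0 dh] := (continuous_cmodP _ _).1 ch _ half0.
have zc0 : 0 < cmod zeta.
  rewrite cmod_gt0; apply: contra_eq_neq zetaE => ->.
  by rewrite expr0n eqn0Ngt n0 mul0r eq_sym oner_neq0.
pose e := Num.min d (s - cmod (z1 - z0)).
have e0 : 0 < e by rewrite lt_min d0 subr_gt0.
pose t := e / 2 / cmod zeta.
have t0 : 0 < t by rewrite !divr_gt0.
pose z := z1 + t%:C%C * zeta.
have zz1 : cmod (z - z1) = e / 2.
  rewrite /z addrC addKr cmodM cmod_real gtr0_norm// /t divfK// gt_eqF//.
have e2 : e / 2 < e by rewrite ltr_pdivrMr// ltr_pMr// ltr1n.
have zs : cmod (z - z0) <= s.
  apply: le_trans (cmod_tri _ z1 _) _; rewrite zz1 -lerBrDr.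
  by rewrite (le_trans (ltW e2))// ge_min lexx orbT.
have zd : cmod (z - z1) < d by rewrite zz1 (lt_le_trans e2)// ge_min lexx.
have := dh z zd; rewrite h1 => hz.
have Reh : 1 / 2 <= complex.Re (h z).
  have := le_lt_trans (Re_le_cmod _) hz.
  case: (h z) => a b /=; rewrite ltr_norml => /andP[? ?]; lra.
have Nz : N.[z] / B.[z] = c * (1 + (t ^+ n)%:C%C * h z).
  have -> : N = P + c *: B by rewrite subrK.
  rewrite PE /h !hornerE ?horner_exp ?hornerE.
  have -> : z - z1 = t%:C%C * zeta by rewrite /z addrC addKr.
  rewrite exprMn rmorphXn /=; have := B0 z zs; move: B.[z] => b b0.
  by field; rewrite b0 c0.
have : phi z <= phi z1 by apply: z1max; rewrite inE.
rewrite /phi Nz -/c cmodM ger_pMr ?cmod_gt0// leNgt => /negP; apply.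
apply: lt_le_trans (Re_cmod_le _).
have -> : complex.Re (1 + (t ^+ n)%:C%C * h z) = 1 + t ^+ n * complex.Re (h z).
  by case: (h z) => a b /=; rewrite mul0r subr0.
by rewrite ltrDl mulr_gt0 ?exprn_gt0// (lt_le_trans half0).
Qed.

(** If c is the value of N/B at z, then (N - cB)/((X - z) B) is a rational
    function whose value at z is the derivative of N/B; the maximum principle
    bounds it by its size on the circle. *)
Lemma cauchy_estimate N B z s M : 0 < s ->
  (forall w, cmod (w - z) <= s -> B.[w] != 0) ->
  (forall w, cmod (w - z) = s -> cmod N.[w] <= M * cmod B.[w]) ->
  cmod (N^`().[z] * B.[z] - N.[z] * B^`().[z]) <= 2 * M / s * cmod B.[z] ^+ 2.
Proof.
move=> s0 B0 NB.
have zz : cmod (z - z) <= s by rewrite subrr cmod0 ltW.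
have Bz := B0 z zz.
have Bp : 0 < cmod B.[z] by rewrite cmod_gt0.
set c := N.[z] / B.[z].
have cM : cmod c <= M.
  by rewrite cmodM cmodV ler_pdivrMr// (max_modulus s0 B0 NB).
have : root (N - c *: B) z by rewrite /root !hornerE divfK// subrr.
move=> /factor_theorem[Q PE].
have Qz : Q.[z] = N^`().[z] - c * B^`().[z].
  have : (N - c *: B)^`().[z] = Q.[z].
    by rewrite PE derivM !hornerE /= derivXsubC hornerC subrr mulr0 mulr1 add0r.
  by move=> <-; rewrite derivB derivZ !hornerE.
have -> : N^`().[z] * B.[z] - N.[z] * B^`().[z] = Q.[z] * B.[z].
  by rewrite Qz mulrBl mulrAC divfK.
rewrite cmodM expr2 [leRHS]mulrA; apply: ler_wpM2r; first exact: cmod_ge0.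
apply: (@max_modulus Q B z s) => // w ws.
have := cmodM Q.[w] (w - z); rewrite ws => QE.
have -> : cmod Q.[w] = cmod (N.[w] - c * B.[w]) / s.
  apply: (mulIf (lt0r_neq0 s0)); rewrite divfK ?lt0r_neq0// -QE.
  have := congr1 (fun p => p.[w]) PE; by rewrite /= !hornerE => ->.
rewrite [leRHS]mulrAC ler_pM2r ?invr_gt0//.
apply: le_trans (cmodB _ _) _.
have -> : 2 * M * cmod B.[w] = M * cmod B.[w] + M * cmod B.[w] by ring.
rewrite lerD ?NB//.
by rewrite cmodM ler_wpM2r// cmod_ge0.
Qed.

End maximum_modulus.

(** * Uniform limits of rational functions *)

Section rational_limits.
Context {R : realType}.
Implicit Types (N B : {poly R[i]}) (z w : R[i]) (s M : R) (g h : R[i] -> R[i]).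

(** Plays the part of holomorphy on a closed disc: these functions satisfy the
    maximum principle and are stable under difference quotients. *)
Definition rat_lim z0 s g : Prop := forall e, 0 < e ->
  exists N B, (forall z, cdisk z0 s z -> B.[z] != 0) /\
    forall z, cdisk z0 s z -> cmod (N.[z] / B.[z] - g z) <= e.

(** Completeness of the plane, with a rate. *)
Lemma cauchy_limit (u : nat -> R[i]) (C : R) :
  (forall n m, (n <= m)%N -> cmod (u n - u m) <= C / n.+1%:R) ->
  exists l, forall n, cmod (u n - l) <= C / n.+1%:R.
Proof.
move=> uC.
have inD : (u @ \oo) (cdisk (u 0%N) C).
  by exists 0%N => // m _; rewrite /cdisk /= cmodBC (le_trans (uC 0%N m _))// divr1.
have [l [_ lu]] := @cdisk_compact _ (u 0%N) C _ _ inD.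
exists l => n; apply/ler_addgt0Pr => e e0.
have un : (u @ \oo) [set u m | m in [set m | (n <= m)%N]].
  by exists n => // m nm; exists m.
have lB : nbhs l [set w | cmod (w - l) < e] by apply/nbhs_cmodP; exists e.
have [_ [[m nm <-] ml]] := lu _ _ un lB.
by rewrite (le_trans (cmod_tri _ (u m) _))// lerD ?uC// ltW.
Qed.

Lemma rat_lim_max z0 s g M : 0 < s -> rat_lim z0 s g ->
  (forall z, cmod (z - z0) = s -> cmod (g z) <= M) ->
  forall z, cmod (z - z0) <= s -> cmod (g z) <= M.
Proof.
move=> s0 gL gM z zs; apply/ler_addgt0Pr => e e0.
have e2 : 0 < e / 2 by rewrite divr_gt0.
have [N [B [B0 NB]]] := gL _ e2.
have Bgt w : cdisk z0 s w -> 0 < cmod B.[w] by move=> /B0; rewrite cmod_gt0.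
have : cmod N.[z] <= (M + e / 2) * cmod B.[z].
  apply: (max_modulus s0 B0) zs => w ws.
  have wD : cdisk z0 s w by rewrite /cdisk /= ws.
  rewrite -ler_pdivrMr ?Bgt// -cmodV -cmodM -(subrK (g w) (_ / _)).
  by rewrite (le_trans (cmodD _ _))// addrC lerD ?NB ?gM.
rewrite -ler_pdivrMr ?Bgt// -cmodV -cmodM => Nz.
rewrite -(subrK (N.[z] / B.[z]) (g z)) (le_trans (cmodD _ _))//.
rewrite [e]splitr addrA addrC lerD//; by rewrite cmodBC NB.
Qed.

Lemma rat_lim_continuous z0 s g z : rat_lim z0 s g -> cmod (z - z0) < s ->
  {for z, continuous g}.
Proof.
move=> gL zs; apply/continuous_cmodP => e e0.
have e3 : 0 < e / 3 by rewrite divr_gt0.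
have [N [B [B0 NB]]] := gL _ e3.
have zD : cdisk z0 s z by exact: ltW.
have [d d0 dH] := (continuous_cmodP _ _).1 (ratio_continuous (N := N) (B0 z zD)) _ e3.
exists (Num.min d (s - cmod (z - z0))); first by rewrite lt_min d0 subr_gt0.
move=> w; rewrite lt_min => /andP[wd ws].
have wD : cdisk z0 s w.
  rewrite /cdisk /= (le_trans (cmod_tri _ z _))// -lerBrDr; exact: ltW.
have -> : g w - g z = - (N.[w] / B.[w] - g w) + (N.[w] / B.[w] - N.[z] / B.[z])
   + (N.[z] / B.[z] - g z) by ring.
have := dH w wd; have := NB w wD; have := NB z zD.
have := cmodD (- (N.[w] / B.[w] - g w) + (N.[w] / B.[w] - N.[z] / B.[z]))
   (N.[z] / B.[z] - g z).
have := cmodD (- (N.[w] / B.[w] - g w)) (N.[w] / B.[w] - N.[z] / B.[z]).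
rewrite cmodN; lra.
Qed.

Lemma rat_lim_bounded z0 s g : rat_lim z0 s g ->
  exists2 M, 0 < M & forall z, cdisk z0 s z -> cmod (g z) <= M.
Proof.
move=> gL; have [N [B [B0 NB]]] := gL 1 ltr01.
have cB : compact ((fun w => N.[w] / B.[w]) @` cdisk z0 s).
  apply: continuous_compact; last exact: cdisk_compact.
  apply: continuous_in_subspaceT => z; rewrite inE => zs.
  exact/ratio_continuous/B0.
have [r r0 rB] := compact_cmod_bounded cB.
exists (r + 1); first by rewrite addr_gt0.
move=> z zD; rewrite -(subrK (N.[z] / B.[z]) (g z)) addrC.
rewrite (le_trans (cmodD _ _))// lerD// ?rB//; first by exists z.
by rewrite cmodBC NB.
Qed.

(** The difference quotients of the approximants are rational without poles.
    On the bounding circle, at distance at least del from z1, they form a uniform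
    Cauchy sequence; by the maximum principle they do so on the disc. *)
Lemma rat_lim_quotient z0 s g z1 : 0 < s -> rat_lim z0 s g -> cmod (z1 - z0) < s ->
  exists2 h, rat_lim z0 s h &
    forall z, cdisk z0 s z -> g z = g z1 + (z - z1) * h z.
Proof.
move=> s0 gL z1s.
pose del := s - cmod (z1 - z0).
have del0 : 0 < del by rewrite subr_gt0.
have delP z : cmod (z - z0) = s -> del <= cmod (z - z1).
  by move=> zs; rewrite lerBlDr -zs cmod_tri.
have z1D : cdisk z0 s z1 by exact: ltW.
have /choice[NB NBP] (n : nat) : exists NB : {poly R[i]} * {poly R[i]},
    (forall z, cdisk z0 s z -> NB.2.[z] != 0) /\
    forall z, cdisk z0 s z -> cmod (NB.1.[z] / NB.2.[z] - g z) <= n.+1%:R^-1.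
  have [|N [B [? ?]]] := gL n.+1%:R^-1; first by rewrite invr_gt0 ltr0n.
  by exists (N, B).
pose N n := (NB n).1; pose B n := (NB n).2.
have B0 n z : cdisk z0 s z -> (B n).[z] != 0 by apply: (NBP n).1.
have NBe n z : cdisk z0 s z -> cmod ((N n).[z] / (B n).[z] - g z) <= n.+1%:R^-1.
  exact: (NBP n).2.
have /choice[Q QP] n : exists Q : {poly R[i]},
    N n - ((N n).[z1] / (B n).[z1]) *: B n = Q * ('X - z1%:P).
  by apply/factor_theorem; rewrite /root !hornerE divfK ?subrr// B0.
have QE n z : (N n).[z] - (N n).[z1] / (B n).[z1] * (B n).[z] = (Q n).[z] * (z - z1).
  by have := congr1 (fun p => p.[z]) (QP n); rewrite /= !hornerE.
pose hn n z := (Q n).[z] / (B n).[z].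
have hnE n z : cdisk z0 s z ->
    hn n z * (z - z1) = (N n).[z] / (B n).[z] - (N n).[z1] / (B n).[z1].
  move=> zD; rewrite /hn mulrAC -QE mulrBl mulfK// B0//.
have e_le (n m : nat) : (n <= m)%N -> (m.+1%:R^-1 : R) <= n.+1%:R^-1.
  by move=> nm; rewrite lef_pV2 ?posrE ?ltr0n// ler_nat.
have hcauchy n m z : (n <= m)%N -> cdisk z0 s z ->
    cmod (hn n z - hn m z) <= (4 / del) / n.+1%:R.
  move=> nm zD.
  have hE w : cdisk z0 s w ->
      hn n w - hn m w = (Q n * B m - Q m * B n).[w] / (B n * B m).[w].
    move=> wD; rewrite /hn !hornerE; have := B0 n w wD; have := B0 m w wD.
    by move=> bm bn; field; rewrite bm bn.
  have BB0 w : cmod (w - z0) <= s -> (B n * B m).[w] != 0.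
    by move=> wD; rewrite hornerM mulf_neq0// B0.
  rewrite hE// cmodM cmodV ler_pdivrMr ?cmod_gt0 ?BB0//.
  apply: (max_modulus s0 BB0) zD => w ws.
  have wD : cdisk z0 s w by rewrite /cdisk /= ws.
  rewrite -ler_pdivrMr ?cmod_gt0 ?BB0// -cmodV -cmodM -hE//.
  rewrite mulrAC ler_pdivlMr//.
  apply: (@le_trans _ _ (cmod ((hn n w - hn m w) * (w - z1)))).
    by rewrite cmodM ler_wpM2l ?cmod_ge0// delP.
  rewrite mulrBl !hnE//.
  set a := _ / _; set b := _ / _; set c := _ / _; set d := _ / _.
  have -> : a - b - (c - d) = (a - g w) - (b - g z1) - ((c - g w) - (d - g z1)) by ring.
  have := cmodB ((a - g w) - (b - g z1)) ((c - g w) - (d - g z1)).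
  have := cmodB (a - g w) (b - g z1); have := cmodB (c - g w) (d - g z1).
  have := NBe n w wD; have := NBe n z1 z1D; have := NBe m w wD; have := NBe m z1 z1D.
  have := e_le n m nm; rewrite -/a -/b -/c -/d.
  move: (n.+1%:R^-1) (m.+1%:R^-1) => x y; lra.
have /choice[h hP] z : exists l, cdisk z0 s z ->
    forall n, cmod (hn n z - l) <= (4 / del) / n.+1%:R.
  have [zD|] := pselect (cdisk z0 s z); last by exists 0.
  have [|l lP] := @cauchy_limit (hn^~ z) (4 / del); last by exists l.
  by move=> n m nm; exact: hcauchy.
exists h => [e e0|z zD].
  have [n ne] : exists n : nat, (4 / del) / n.+1%:R <= e.
    exists (Num.bound (4 / del / e)).
    rewrite ler_pdivrMr ?ltr0n// -ler_pdivrMl// mulrC.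
    rewrite ltW// (lt_trans (archi_boundP _))//; last by rewrite ltr_nat.
    by rewrite divr_ge0 ?divr_ge0 ?ltW.
  exists (Q n), (B n); split=> [z zD|z zD]; first exact: B0.
  exact: le_trans (hP z zD n) ne.
apply/eqP; rewrite -subr_eq0 -cmod_eq0; apply/eqP/le_anti; rewrite cmod_ge0 andbT.
apply/ler_addgt0Pr => e e0; rewrite add0r.
pose C := 4 / del * cmod (z - z1) + 2.
have C0 : 0 < C.
  by rewrite ltr_wpDl// mulr_ge0 ?cmod_ge0// divr_ge0// ltW.
have [n ne] : exists n : nat, C / n.+1%:R <= e.
  exists (Num.bound (C / e)).
  rewrite ler_pdivrMr ?ltr0n// -ler_pdivrMl// mulrC.
  rewrite ltW// (lt_trans (archi_boundP _))//; last by rewrite ltr_nat.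
  by rewrite divr_ge0 ?ltW.
apply: le_trans ne; rewrite /C.
have -> : g z - (g z1 + (z - z1) * h z) =
   (hn n z - h z) * (z - z1) - ((N n).[z] / (B n).[z] - g z) + ((N n).[z1] / (B n).[z1] - g z1).
  by rewrite (mulrBl (z - z1) (hn n z)) hnE//; ring.
have := cmodD ((hn n z - h z) * (z - z1) - ((N n).[z] / (B n).[z] - g z)) ((N n).[z1] / (B n).[z1] - g z1).
have := cmodB ((hn n z - h z) * (z - z1)) ((N n).[z] / (B n).[z] - g z).
have := NBe n z zD; have := NBe n z1 z1D.
have : cmod ((hn n z - h z) * (z - z1)) <= 4 / del / n.+1%:R * cmod (z - z1).
  by rewrite cmodM ler_wpM2r ?cmod_ge0// hP.
have -> : (4 / del * cmod (z - z1) + 2) / n.+1%:R = 4 / del / n.+1%:R * cmod (z - z1) + 2 * n.+1%:R^-1 by ring.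
move: (4 / del / n.+1%:R * cmod (z - z1)) => x; move: (n.+1%:R^-1) => y; lra.
Qed.

Lemma rat_lim_derivable z0 s g z : 0 < s -> rat_lim z0 s g -> cmod (z - z0) < s ->
  derivable g z 1.
Proof.
move=> s0 gL zs; have [h hL hE] := rat_lim_quotient s0 gL zs.
have /continuous_cmodP hc := rat_lim_continuous hL zs.
apply: (cvgP (h z)); apply/cvg_cmodP => e e0.
have [d d0 dH] := hc e e0.
have m0 : 0 < Num.min d (s - cmod (z - z0)) by rewrite lt_min d0 subr_gt0.
apply/nbhs_cmodP; exists (Num.min d (s - cmod (z - z0))) => // t.
rewrite subr0 lt_min => /andP[td ts] t0.
have tz : t *: (1 : R[i]) + z = t + z by rewrite /GRing.scale /= mulr1.
rewrite /= tz.
have tD : cdisk z0 s (t + z).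
  rewrite /cdisk /= -addrA (le_trans (cmodD _ _))// -lerBrDr; exact: ltW.
rewrite hE// addrK [g z + _]addrC addrK.
have -> : t^-1 *: (t * h (t + z)) = h (t + z) by rewrite /GRing.scale /= mulKf.
by apply: dH; rewrite addrK.
Qed.

(** Otherwise g can be divided by any power of z - z0, and the maximum
    principle for the quotients gives |g| <= M (|z - z0| / s)^d for every d. *)
Lemma rat_lim_order z0 s g : 0 < s -> rat_lim z0 s g ->
  (exists2 z, cmod (z - z0) < s & g z != 0) ->
  exists d G, [/\ rat_lim z0 s G, G z0 != 0 &
    forall z, cdisk z0 s z -> g z = (z - z0) ^+ d * G z].
Proof.
move=> s0 gL [z1 z1s gz1]; apply: contrapT => H.
have z0s : cmod (z0 - z0) < s by rewrite subrr cmod0.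
have Hd d : exists2 G, rat_lim z0 s G &
    forall z, cdisk z0 s z -> g z = (z - z0) ^+ d * G z.
  elim: d => [|d [G GL GE]]; first by exists g => // z _; rewrite expr0 mul1r.
  have G0 : G z0 = 0.
    by apply/eqP/negPn/negP => G0; apply: H; exists d, G.
  have [h hL hE] := rat_lim_quotient s0 GL z0s.
  by exists h => // z zD; rewrite GE// hE// G0 add0r exprSr mulrA.
have [M M0 gM] := rat_lim_bounded gL.
(* on the circle of radius s the quotient of g by (z - z0)^d is at most M / s^d *)
have gle d : cmod (g z1) <= M * (cmod (z1 - z0) / s) ^+ d.
  have [G GL GE] := Hd d.
  have z1D : cdisk z0 s z1 by exact: ltW.
  rewrite GE// cmodM cmodX expr_div_n mulrA mulrAC [leRHS]mulrC.
  rewrite ler_wpM2l ?exprn_ge0 ?cmod_ge0//.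
  apply: (rat_lim_max s0 GL) z1D => z zs.
  have zD : cdisk z0 s z by rewrite /cdisk /= zs.
  rewrite ler_pdivlMr ?exprn_gt0// -{1}zs -cmodX -cmodM mulrC -GE//.
  exact: gM.
have q0 : 0 <= cmod (z1 - z0) / s by rewrite divr_ge0 ?cmod_ge0// ltW.
have q1 : `|cmod (z1 - z0) / s| < 1 by rewrite ger0_norm// ltr_pdivrMr// mul1r.
have : (fun d => M * (cmod (z1 - z0) / s) ^+ d) @ \oo --> M * 0.
  by apply: cvgM; [exact: cvg_cst | exact: cvg_expr].
rewrite mulr0 => /cvgrPdist_lt/(_ (cmod (g z1))).
rewrite cmod_gt0 => /(_ gz1) [d _ /(_ d (leqnn d))] /=.
rewrite sub0r normrN ger0_norm ?mulr_ge0 ?exprn_ge0 ?(ltW M0)//.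
by rewrite ltNge gle.
Qed.

End rational_limits.

(** * Normalised derivatives of a sequence of polynomials *)

Section uniform_convergence.
Context {R : realType} {J : Type}.
Implicit Types (z w : R[i]) (s M : R) (f g : R[i] -> R[i]).

Definition ucvg (F : set_system J) (f_ : J -> R[i] -> R[i]) (A : set R[i]) f :=
  forall e, 0 < e -> \forall j \near F, forall z, A z -> cmod (f_ j z - f z) <= e.

Lemma ucvg_sub (F : set_system J) {FF : Filter F} (f_ : J -> R[i] -> R[i]) (A B : set R[i]) f :
  B `<=` A -> ucvg F f_ A f -> ucvg F f_ B f.
Proof.
by move=> BA H e e0; apply: filterS (H e e0) => j jA z /BA; exact: jA.
Qed.

Lemma cdiskS z s s' : s <= s' -> cdisk z s `<=` cdisk z s'.
Proof. by move=> ss w /= ws; exact: le_trans ss. Qed.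

(** P'/(kb) = (P/b)'/k + (P/b) (b'/(kb)), and the Cauchy estimate bounds
    (P/b)' on the smaller disc. *)
Lemma deriv_step (F : set_system J) {FF : Filter F} (P b : J -> {poly R[i]})
    (k : J -> R) z0 s s' f g Mf Mg :
  s < s' -> (\forall j \near F, forall z, cdisk z0 s' z -> (b j).[z] != 0) ->
  (forall M, \forall j \near F, M <= k j) ->
  ucvg F (fun j z => (P j).[z] / (b j).[z]) (cdisk z0 s') f ->
  (forall z, cdisk z0 s' z -> cmod (f z) <= Mf) ->
  ucvg F (fun j z => (b j)^`().[z] / ((k j)%:C%C * (b j).[z])) (cdisk z0 s') g ->
  (forall z, cdisk z0 s' z -> cmod (g z) <= Mg) ->
  ucvg F (fun j z => (P j)^`().[z] / ((k j)%:C%C * (b j).[z])) (cdisk z0 s)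
    (fun z => f z * g z).
Proof.
move=> ss b0 kF Pf fM bg gM e e0.
have [D0|D0] := pselect (cdisk z0 s' !=set0); last first.
  apply: filterE => j z zs; exfalso; apply: D0; exists z.
  by apply: cdiskS zs; exact: ltW.
have Mf0 : 0 <= Mf by case: D0 => z /fM; exact: le_trans (cmod_ge0 _).
have Mg0 : 0 <= Mg by case: D0 => z /gM; exact: le_trans (cmod_ge0 _).
pose d := s' - s; have d0 : 0 < d by rewrite subr_gt0.
pose e1 := Num.min 1 (e / 2 / (Mf + Mg + 1)).
have MM : 0 < Mf + Mg + 1 by rewrite ltr_wpDl// addr_ge0.
have e10 : 0 < e1 by rewrite lt_min ltr01 !divr_gt0.
have e11 : e1 <= 1 by rewrite ge_min lexx.
have e1e : e1 * (Mf + Mg + 1) <= e / 2 by rewrite -ler_pdivlMr// ge_min lexx orbT.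
near=> j => z zs.
have kj : Num.max 1 (2 * (Mf + 1) / d / (e / 2)) <= k j by near: j; exact: kF.
have k1 : 1 <= k j by apply: le_trans kj; rewrite le_max lexx.
have k0 : 0 < k j by exact: lt_le_trans k1.
have kC : ((k j)%:C)%C != 0 :> R[i] by rewrite -cmod_gt0 cmod_real gtr0_norm.
have kM : 2 * (Mf + 1) / d / k j <= e / 2.
  rewrite ler_pdivrMr// [leRHS]mulrC -ler_pdivrMr ?divr_gt0//.
  by apply: le_trans kj; rewrite le_max lexx orbT.
have bj z' : cdisk z0 s' z' -> (b j).[z'] != 0 by move: z'; near: j.
have Pj z' : cdisk z0 s' z' -> cmod ((P j).[z'] / (b j).[z'] - f z') <= e1.
  by move: z'; near: j; exact: Pf.
have Bj z' : cdisk z0 s' z' ->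
    cmod ((b j)^`().[z'] / ((k j)%:C%C * (b j).[z']) - g z') <= e1.
  by move: z'; near: j; exact: bg.
have dz w : cmod (w - z) <= d -> cdisk z0 s' w.
  move=> wz; rewrite /cdisk /= (le_trans (cmod_tri _ z _))//.
  by rewrite -(subrK s s') lerD.
have zs' : cdisk z0 s' z by apply: dz; rewrite subrr cmod0 ltW.
have Pb w : cdisk z0 s' w -> cmod ((P j).[w] / (b j).[w]) <= Mf + 1.
  move=> wD; rewrite -(subrK (f w) (_ / _)) (le_trans (cmodD _ _))// addrC.
  by rewrite lerD ?fM// (le_trans (Pj w wD)).
have CE : cmod ((P j)^`().[z] * (b j).[z] - (P j).[z] * (b j)^`().[z])
    <= 2 * (Mf + 1) / d * cmod (b j).[z] ^+ 2.
  apply: cauchy_estimate => // w wd; first by apply: bj; apply: dz.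
  have wD : cdisk z0 s' w by apply: dz; rewrite wd.
  by rewrite -ler_pdivrMr ?cmod_gt0 ?bj// -cmodV -cmodM Pb.
pose A := (P j).[z] / (b j).[z]; pose C := (b j)^`().[z] / ((k j)%:C%C * (b j).[z]).
pose E := ((P j)^`().[z] * (b j).[z] - (P j).[z] * (b j)^`().[z]) / (b j).[z] ^+ 2 / (k j)%:C%C.
have -> : (P j)^`().[z] / ((k j)%:C%C * (b j).[z]) - f z * g z =
    E + (A - f z) * C + f z * (C - g z).
  by rewrite /E /A /C; have := bj z zs'; move: kC => ? ?; field; apply/andP; split.
have hE : cmod E <= e / 2.
  apply: le_trans kM; rewrite /E !cmodM !cmodV cmod_real gtr0_norm//.
  rewrite ler_wpM2r ?invr_ge0 ?(ltW k0)// cmodX ler_pdivrMr//.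
  by rewrite exprn_gt0// cmod_gt0 bj.
have hC : cmod C <= Mg + 1.
  rewrite -(subrK (g z) C) (le_trans (cmodD _ _))// addrC lerD ?gM//.
  exact: le_trans (Bj z zs') e11.
have h1 : cmod ((A - f z) * C) <= e1 * (Mg + 1).
  by rewrite cmodM ler_pM ?cmod_ge0// Pj.
have h2 : cmod (f z * (C - g z)) <= Mf * e1.
  by rewrite cmodM ler_pM ?cmod_ge0// ?fM// Bj.
have := cmodD (E + (A - f z) * C) (f z * (C - g z)); have := cmodD E ((A - f z) * C).
move: e1e h1 h2 hE; rewrite !mulrDr !mulr1 [Mf * _]mulrC; lra.
Unshelve. all: by end_near. Qed.

(** The factor g^m of the limit is what makes the zeros of g appear m times. *)
Lemma derivn_cvg (F : set_system J) {FF : Filter F} (P b : J -> {poly R[i]})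
    (k : J -> R) z0 s' f g Mf Mg :
  (\forall j \near F, forall z, cdisk z0 s' z -> (b j).[z] != 0) ->
  (forall M, \forall j \near F, M <= k j) ->
  ucvg F (fun j z => (P j).[z] / (b j).[z]) (cdisk z0 s') f ->
  (forall z, cdisk z0 s' z -> cmod (f z) <= Mf) ->
  ucvg F (fun j z => (b j)^`().[z] / ((k j)%:C%C * (b j).[z])) (cdisk z0 s') g ->
  (forall z, cdisk z0 s' z -> cmod (g z) <= Mg) ->
  forall m s, s < s' ->
  ucvg F (fun j z => ((k j)%:C%C ^- m *: (P j)^`(m)).[z] / (b j).[z]) (cdisk z0 s)
    (fun z => f z * g z ^+ m).
Proof.
move=> b0 kF Pf fM bg gM; elim=> [|m IH] s ss.
  move=> e e0; near=> j => z zs; rewrite expr0 invr1 scale1r expr0 mulr1.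
  move: z zs; near: j; apply: filterS (Pf e e0) => j H z zs; apply: H.
  by apply: cdiskS zs; exact: ltW.
pose s1 := (s + s') / 2.
have ss1 : s < s1 by rewrite midf_lt.
have ss2 : s1 < s' by rewrite midf_lt.
have sub1 : cdisk z0 s1 `<=` cdisk z0 s' by apply: cdiskS; exact: ltW.
have b01 : \forall j \near F, forall z, cdisk z0 s1 z -> (b j).[z] != 0.
  by apply: filterS b0 => j H z /sub1; exact: H.
have fgM z : cdisk z0 s1 z -> cmod (f z * g z ^+ m) <= Mf * Mg ^+ m.
  move=> /sub1 zs; rewrite cmodM cmodX ler_pM ?exprn_ge0 ?cmod_ge0 ?fM//.
  by apply: lerXn2r; rewrite ?nnegrE ?cmod_ge0// ?gM// (le_trans (cmod_ge0 _) (gM z zs)).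
have := deriv_step ss1 b01 kF (IH s1 ss2) fgM (ucvg_sub sub1 bg) (fun z zs => gM z (sub1 z zs)).
move=> H e e0; near=> j => z zs.
have -> : f z * g z ^+ m.+1 = f z * g z ^+ m * g z by rewrite exprSr mulrA.
have -> : ((k j)%:C%C ^- m.+1 *: (P j)^`(m.+1)).[z] / (b j).[z] =
    ((k j)%:C%C ^- m *: (P j)^`(m))^`().[z] / ((k j)%:C%C * (b j).[z]).
  by rewrite derivZ !hornerZ -derivnS exprSr !invfM; ring.
by move: z zs; near: j; exact: H.
Unshelve. all: by end_near. Qed.

Lemma prod_dist_bounds (rs : seq R[i]) (P : pred R[i]) z (a c : R) :
  0 <= a -> (forall w, w \in rs -> P w -> a <= cmod (z - w) <= c) ->
  a ^+ count P rs <= cmod (\prod_(w <- rs | P w) ('X - w%:P)).[z] <= c ^+ count P rs.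
Proof.
move=> a0; elim: rs => [|w rs IH] H; first by rewrite big_nil /= hornerC cmod1 !expr0 lexx.
rewrite big_cons /=; have {}IH := IH (fun v vr => H v (mem_behead (s := w :: rs) vr)).
case: ifPn => Pw //=; rewrite add1n !exprS hornerM cmodM hornerXsubC.
have /andP[aw wc] := H w (mem_head _ _) Pw; have /andP[ai ic] := IH.
apply/andP; split; apply: ler_pM => //; rewrite ?exprn_ge0 ?cmod_ge0//.
Qed.

(** L is so large that the first inequality excludes n > e and the second
    excludes n < e. *)
Lemma exponent_rigidity (e n : nat) (L t : R) : L = 8 * 4 ^+ e.+1 -> 0 < t ->
  t ^+ e * (L * t - t / 2) ^+ n <= 8 * (L * t) ^+ e * (t + t / 2) ^+ n ->
  (t - t / 2) ^+ n * (L * t) ^+ e <= 8 * t ^+ e * (L * t + t / 2) ^+ n ->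
  n = e.
Proof.
move=> LE t0.
have q1 m : 1 <= (4 : R) ^+ m by rewrite exprn_ege1// ler1n.
have L8 : 8 <= L by rewrite LE ler_pMr.
have L0 : 0 < L by apply: lt_le_trans L8.
have -> : L * t - t / 2 = t * (L - 1 / 2) by field.
have -> : L * t + t / 2 = t * (L + 1 / 2) by field.
have -> : t + t / 2 = t * (3 / 2) by field.
have -> : t - t / 2 = t * (1 / 2) by field.
rewrite !(exprMn n t) !(exprMn e L t).
have T0 : 0 < t ^+ e * t ^+ n by rewrite mulr_gt0// exprn_gt0.
have -> : t ^+ e * (t ^+ n * (L - 1 / 2) ^+ n) = t ^+ e * t ^+ n * (L - 1 / 2) ^+ n by ring.
have -> : 8 * (L ^+ e * t ^+ e) * (t ^+ n * (3 / 2) ^+ n) =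
  t ^+ e * t ^+ n * (8 * L ^+ e * (3 / 2) ^+ n) by ring.
have -> : t ^+ n * (1 / 2) ^+ n * (L ^+ e * t ^+ e) = t ^+ e * t ^+ n * ((1 / 2) ^+ n * L ^+ e) by ring.
have -> : 8 * t ^+ e * (t ^+ n * (L + 1 / 2) ^+ n) = t ^+ e * t ^+ n * (8 * (L + 1 / 2) ^+ n) by ring.
rewrite !ler_pM2l// => I1 I2.
have p2 : 0 < (2 : R) ^+ n by rewrite exprn_gt0.
have {}I1 : L ^+ n <= 8 * L ^+ e * 3 ^+ n.
  have : (L / 2) ^+ n <= 8 * L ^+ e * (3 / 2) ^+ n.
    apply: le_trans I1; apply: lerXn2r; rewrite ?nnegrE; lra.
  by rewrite !expr_div_n mulrA ler_pM2r ?invr_gt0.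
have {}I2 : L ^+ e <= 8 * 4 ^+ n * L ^+ n.
  have : (1 / 2) ^+ n * L ^+ e <= 8 * (2 * L) ^+ n.
    apply: le_trans I2 _; rewrite ler_pM2l// lerXn2r ?nnegrE; lra.
  rewrite expr_div_n expr1n mulrAC ler_pdivrMr// mul1r exprMn.
  have -> : 8 * (2 ^+ n * L ^+ n) * 2 ^+ n = 8 * (2 * 2) ^+ n * L ^+ n by rewrite exprMn; ring.
  by have -> : 2 * 2 = 4 :> R by ring.
apply/eqP; rewrite eqn_leq; apply/andP; split; rewrite leqNgt; apply/negP => ne.
  have nE : n = (e + (n - e.+1).+1)%N by rewrite addnS -addSn subnKC.
  move: I1; set k := (n - e.+1)%N in nE *; rewrite nE exprD.
  have Le : 0 < L ^+ e by rewrite exprn_gt0.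
  have -> : 8 * L ^+ e * 3 ^+ (e + k.+1) = L ^+ e * (8 * 3 ^+ (e + k.+1)) by ring.
  rewrite ler_pM2l// leNgt => /negP; apply.
  rewrite exprS addnS -addSn exprD mulrA.
  apply: (@lt_le_trans _ _ (L * 3 ^+ k)).
    rewrite ltr_pM2r ?exprn_gt0// LE ltr_pM2l//.
    by rewrite ltr_pXn2r// ?nnegrE ?ltr_nat ?ler0n.
  by rewrite ler_pM2l//; apply: lerXn2r; rewrite ?nnegrE//; lra.
have nE : e = (n + (e - n.+1).+1)%N by rewrite addnS -addSn subnKC.
move: I2; set k := (e - n.+1)%N in nE *; rewrite {1}nE exprD mulrC.
rewrite ler_pM2r ?exprn_gt0// leNgt => /negP; apply.
apply: (@lt_le_trans _ _ L).
  rewrite LE ltr_pM2l// ltr_eXn2l//; first by rewrite ltnW.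
  by rewrite ltr1n.
by rewrite -{1}(expr1 L) ler_weXn2l//; lra.
Qed.

End uniform_convergence.

(** * Hurwitz's theorem *)

Section hurwitz.
Context {R : realType} {J : Type}.
Implicit Types (z w : R[i]).

(** Close to z0 the limit f vanishes at z0 only, so the roots of N j in a small
    disc lie in a much smaller one.  If A is the product of the n corresponding
    linear factors, the maximum principle for N/(AB) and for its inverse compares
    the growth of |z - z0|^e with that of |z - z0|^n between two circles. *)
Lemma hurwitz (F : set_system J) {FF : Filter F} (N B : J -> {poly R[i]})
    (rs : J -> seq R[i]) (c : J -> R[i]) z0 (s : R) (f G : R[i] -> R[i]) (e : nat) :
  0 < s ->
  (\forall j \near F, forall z, cdisk z0 s z -> (B j).[z] != 0) ->
  (\forall j \near F, c j != 0 /\ N j = c j *: \prod_(w <- rs j) ('X - w%:P)) ->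
  ucvg F (fun j z => (N j).[z] / (B j).[z]) (cdisk z0 s) f ->
  (forall z, cdisk z0 s z -> f z = (z - z0) ^+ e * G z) ->
  {for z0, continuous G} -> G z0 != 0 ->
  exists2 rho : R, 0 < rho & forall r : R, 0 < r -> r <= rho ->
    \forall j \near F, count (fun w => cmod (w - z0) <= r) (rs j) = e.
Proof.
move=> s0 B0 NE Nf fE /continuous_cmodP cG G0.
pose gam := cmod (G z0); have gam0 : 0 < gam by rewrite cmod_gt0.
have g2 : 0 < gam / 2 by rewrite divr_gt0.
have [d d0 dH] := cG _ g2.
exists (Num.min s (d / 2)); first by rewrite lt_min s0 divr_gt0.
move=> r r0; rewrite le_min => /andP[rs' rd].
have d2 : d / 2 < d by rewrite ltr_pdivrMr// ltr_pMr// ltr1n.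
have Gb z : cmod (z - z0) <= r -> gam / 2 <= cmod (G z) <= 3 / 2 * gam.
  move=> zr; have := dH z (le_lt_trans zr (le_lt_trans rd d2)).
  move=> /(le_lt_trans (cmod_dist _ _)); rewrite -/gam ltr_norml => /andP[? ?].
  by apply/andP; split; lra.
(* the roots are confined to radius t / 2; the circles have radii t and r = L t *)
pose L : R := 8 * 4 ^+ e.+1.
have q1 m : 1 <= (4 : R) ^+ m by rewrite exprn_ege1// ler1n.
have L8 : 8 <= L by rewrite /L ler_pMr.
have L0 : 0 < L by apply: lt_le_trans L8.
pose t := r / L; have t0 : 0 < t by rewrite divr_gt0.
have rE : r = L * t by rewrite /t mulrC divfK// gt_eqF.
have tr : t < r by rewrite rE; rewrite ltr_pMl//; lra.
have t2 : t / 2 < t by rewrite ltr_pdivrMr// ltr_pMr// ltr1n.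
pose eps := (t / 2) ^+ e * gam / 4.
have eps0 : 0 < eps by rewrite !mulr_gt0// ?invr_gt0// exprn_gt0// divr_gt0.
near=> j.
have Bj z : cmod (z - z0) <= r -> (B j).[z] != 0.
  move=> zr; have : cdisk z0 s z by apply: le_trans rs'.
  by move: z {zr}; near: j.
have [cj Nj] : c j != 0 /\ N j = c j *: \prod_(w <- rs j) ('X - w%:P) by near: j.
have Nfj z : cmod (z - z0) <= r -> cmod ((N j).[z] / (B j).[z] - f z) <= eps.
  move=> zr; have : cdisk z0 s z by apply: le_trans rs'.
  by move: z {zr}; near: j; exact: Nf.
have ring_bound z : t / 2 <= cmod (z - z0) <= r ->
    cmod (z - z0) ^+ e * gam / 4 <= cmod ((N j).[z] / (B j).[z])
      <= 2 * cmod (z - z0) ^+ e * gam.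
  move=> /andP[tz zr]; have /andP[Gl Gu] := Gb z zr.
  have zs : cdisk z0 s z by apply: le_trans rs'.
  have zt : (t / 2) ^+ e <= cmod (z - z0) ^+ e.
    by apply: lerXn2r; rewrite ?nnegrE ?cmod_ge0// divr_ge0// ltW.
  have epsz : eps <= cmod (z - z0) ^+ e * gam / 4.
    by rewrite /eps ler_pM2r ?invr_gt0// ler_pM2r.
  have fz : cmod (f z) = cmod (z - z0) ^+ e * cmod (G z).
    by rewrite fE// cmodM cmodX.
  have x0 : 0 <= cmod (z - z0) ^+ e by rewrite exprn_ge0 ?cmod_ge0.
  have fl : cmod (z - z0) ^+ e * gam / 2 <= cmod (f z).
    by rewrite fz -mulrA ler_wpM2l.
  have fu : cmod (f z) <= 3 / 2 * (cmod (z - z0) ^+ e * gam).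
    by rewrite fz mulrCA ler_wpM2l.
  have := cmod_dist ((N j).[z] / (B j).[z]) (f z).
  move=> /le_trans/(_ (Nfj z zr))/le_trans/(_ epsz).
  rewrite ler_norml => /andP[]; set X := cmod (_ / _).
  move: fl fu; set Y := cmod (z - z0) ^+ e * gam.
  have -> : 2 * cmod (z - z0) ^+ e * gam = 2 * Y by rewrite mulrA.
  have : 0 <= Y by rewrite mulr_ge0// ltW.
  by move=> *; apply/andP; split; lra.
have no_root w : w \in rs j -> cmod (w - z0) <= r -> cmod (w - z0) < t / 2.
  move=> wrs wr; rewrite ltNge; apply/negP => wt.
  have /ring_bound/andP[+ _] : t / 2 <= cmod (w - z0) <= r by rewrite wt.
  have -> : (N j).[w] = 0.
    apply/eqP; rewrite Nj hornerZ mulf_eq0; apply/orP; right.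
    by rewrite -/(root _ _) root_prod_XsubC.
  rewrite mul0r cmod0 leNgt => /negP; apply.
  rewrite !mulr_gt0// ?invr_gt0// exprn_gt0// (lt_le_trans _ wt)// divr_gt0//.
pose P w := cmod (w - z0) <= r.
pose A := \prod_(w <- rs j | P w) ('X - w%:P).
pose D := c j *: \prod_(w <- rs j | ~~ P w) ('X - w%:P).
have NAD z : (N j).[z] = A.[z] * D.[z].
  by rewrite Nj (bigID P) /= -/A /D hornerZ hornerM hornerZ; ring.
have Dj z : cmod (z - z0) <= r -> D.[z] != 0.
  move=> zr; rewrite /D hornerZ mulf_neq0//.
  rewrite -/(root _ z) -big_filter root_prod_XsubC mem_filter.
  by rewrite negb_and negbK /P zr.
set n := count _ _; rewrite -/n.
have Abound z (a b : R) : 0 <= a -> a + t / 2 <= cmod (z - z0) <= b - t / 2 ->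
    a ^+ n <= cmod A.[z] <= b ^+ n.
  move=> a0 /andP[az zb]; apply: prod_dist_bounds => // w wrs /(no_root w wrs) wt.
  have := cmod_tri z w z0; have := cmod_tri z z0 w; rewrite (cmodBC z0 w).
  by move=> h1 h2; apply/andP; split; lra.
have zb : cmod (z0 + t%:C%C - z0) = t by rewrite circle_point// ltW.
set z1 := z0 + _ in zb.
have z1r : cmod (z1 - z0) <= r by rewrite zb ltW.
have N1 : t ^+ e * gam / 4 <= cmod A.[z1] * cmod (D.[z1] / (B j).[z1]) <= 2 * t ^+ e * gam.
  have := ring_bound z1; rewrite -cmodM mulrA -NAD zb; apply.
  by apply/andP; split; apply: ltW.
have A1 : (t - t / 2) ^+ n <= cmod A.[z1] <= (t + t / 2) ^+ n.
  by apply: Abound; rewrite ?zb; lra.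
have Ar z : cmod (z - z0) = r -> (r - t / 2) ^+ n <= cmod A.[z] <= (r + t / 2) ^+ n.
  by move=> zr; apply: Abound; rewrite ?zr; lra.
have Nr z : cmod (z - z0) = r ->
    r ^+ e * gam / 4 <= cmod A.[z] * cmod (D.[z] / (B j).[z]) <= 2 * r ^+ e * gam.
  move=> zr; have := ring_bound z; rewrite -cmodM mulrA -NAD zr; apply.
  by apply/andP; split; lra.
have ap : 0 < (r - t / 2) ^+ n by rewrite exprn_gt0//; lra.
have bp : 0 < (t - t / 2) ^+ n by rewrite exprn_gt0//; lra.
have cp : 0 <= (t + t / 2) ^+ n by rewrite exprn_ge0//; lra.
have dp : 0 <= (r + t / 2) ^+ n by rewrite exprn_ge0//; lra.
have rp : 0 < r ^+ e * gam by rewrite mulr_gt0// exprn_gt0.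
have tp : 0 < t ^+ e * gam by rewrite mulr_gt0// exprn_gt0.
apply: (@exponent_rigidity R e n L t) => //; rewrite -rE.
  have : cmod D.[z1] <= 2 * r ^+ e * gam / (r - t / 2) ^+ n * cmod (B j).[z1].
    apply: (max_modulus r0 Bj) z1r => z zr.
    have zr' : cmod (z - z0) <= r by rewrite zr.
    rewrite -ler_pdivrMr ?cmod_gt0 ?Bj// -cmodV -cmodM ler_pdivlMr//.
    have /andP[al _] := Ar z zr; have /andP[_] := Nr z zr.
    by apply: le_trans; rewrite mulrC ler_wpM2r ?cmod_ge0.
  rewrite -ler_pdivrMr ?cmod_gt0 ?Bj// -cmodV -cmodM => H1.
  have /andP[H2 _] := N1; have /andP[_ H3] := A1.
  have H4 : t ^+ e * gam / 4 <= (t + t / 2) ^+ n * (2 * r ^+ e * gam / (r - t / 2) ^+ n).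
    by apply: le_trans H2 _; rewrite ler_pM ?cmod_ge0.
  move: H4; rewrite mulrA ler_pdivlMr// => H4.
  rewrite -(ler_pM2r gam0); move: H4.
  have -> : t ^+ e * gam / 4 * (r - t / 2) ^+ n = t ^+ e * (r - t / 2) ^+ n * gam / 4 by ring.
  rewrite ler_pdivrMr//.
  have -> : (t + t / 2) ^+ n * (2 * r ^+ e * gam) * 4 = 8 * r ^+ e * (t + t / 2) ^+ n * gam by ring.
  by [].
have : cmod (B j).[z1] <= 4 * (r + t / 2) ^+ n / (r ^+ e * gam) * cmod D.[z1].
  apply: (max_modulus r0 Dj) z1r => z zr.
  have zr' : cmod (z - z0) <= r by rewrite zr.
  rewrite -ler_pdivrMr ?cmod_gt0 ?Dj// -cmodV -cmodM ler_pdivlMr//.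
  have /andP[_ au] := Ar z zr; have /andP[+ _] := Nr z zr.
  have D0 := Dj z zr'; have BB0 := Bj z zr'.
  have X0 : 0 < cmod (D.[z] / (B j).[z]) by rewrite cmod_gt0 mulf_neq0// invr_eq0.
  have -> : cmod ((B j).[z] / D.[z]) = (cmod (D.[z] / (B j).[z]))^-1.
    by rewrite -cmodV invfM invrK mulrC.
  move=> HX; rewrite mulrC ler_pdivrMr//.
  have HY : cmod A.[z] * cmod (D.[z] / (B j).[z]) <=
      (r + t / 2) ^+ n * cmod (D.[z] / (B j).[z]) by rewrite ler_pM2r.
  by rewrite -mulrA; move: HX HY; lra.
have D0 := Dj z1 z1r; have BB0 := Bj z1 z1r.
rewrite -ler_pdivrMr ?cmod_gt0// -cmodV -cmodM.
have X0 : 0 < cmod (D.[z1] / (B j).[z1]) by rewrite cmod_gt0 mulf_neq0// invr_eq0.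
have -> : cmod ((B j).[z1] / D.[z1]) = (cmod (D.[z1] / (B j).[z1]))^-1.
  by rewrite -cmodV invfM invrK mulrC.
set X := cmod (D.[z1] / _) in X0 N1 *.
rewrite ler_pdivlMr// => H1.
have /andP[_ H2] := N1; have /andP[H3 _] := A1.
have H4 : (t - t / 2) ^+ n * X <= 2 * t ^+ e * gam.
  by apply: le_trans H2; rewrite ler_pM2r.
have H5 : (t - t / 2) ^+ n * (r ^+ e * gam) <= (t - t / 2) ^+ n * X * (4 * (r + t / 2) ^+ n).
  rewrite -mulrA ler_pM2l//.
  by move: H1; rewrite ler_pdivrMl.
rewrite -(ler_pM2r gam0) -[leLHS]mulrA (le_trans H5)//.
have -> : 8 * t ^+ e * (r + t / 2) ^+ n * gam = 2 * t ^+ e * gam * (4 * (r + t / 2) ^+ n) by ring.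
by rewrite ler_wpM2r// mulr_ge0.
Unshelve. all: by end_near. Qed.

End hurwitz.

(** * Pushing poles, and the hull of the support *)

Section runge.
Context {R : realType}.
Implicit Types (x y z w : R[i]) (K : set R[i]).

(** This makes approximations composable in [pole_push_trans]. *)
Lemma poly_lipschitz (p : {poly R[i]}) (M : R) : 0 <= M ->
  exists2 L, 0 < L & forall a b, cmod a <= M -> cmod b <= M ->
    cmod (p.[a] - p.[b]) <= L * cmod (a - b).
Proof.
move=> M0; elim/poly_ind: p => [|p c [L L0 LP]].
  by exists 1 => // a b _ _; rewrite !horner0 subrr cmod0 mulr_ge0// cmod_ge0.
exists (L * M + cmod p.[0] + L * M + 1).
  by rewrite ltr_wpDl// !addr_ge0 ?mulr_ge0 ?cmod_ge0// ltW.
move=> a b aM bM; rewrite !hornerMXaddC.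
have -> : p.[a] * a + c - (p.[b] * b + c) = (p.[a] - p.[b]) * a + p.[b] * (a - b) by ring.
have h1 : cmod ((p.[a] - p.[b]) * a) <= L * cmod (a - b) * M.
  by rewrite cmodM ler_pM ?cmod_ge0 ?LP.
have h2 : cmod p.[b] <= cmod p.[0] + L * M.
  rewrite -(subrK p.[0] p.[b]) (le_trans (cmodD _ _))// addrC lerD2l.
  rewrite (le_trans (LP _ _ _ _)) ?cmod0//; by rewrite subr0 ler_pM2l.
have h3 : cmod (p.[b] * (a - b)) <= (cmod p.[0] + L * M) * cmod (a - b).
  by rewrite cmodM ler_wpM2r// cmod_ge0.
rewrite (le_trans (cmodD _ _))// (le_trans (lerD h1 h3))//.
have -> : (L * M + cmod p.[0] + L * M + 1) * cmod (a - b) =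
  L * cmod (a - b) * M + (cmod p.[0] + L * M) * cmod (a - b) + cmod (a - b) by ring.
by rewrite lerDl cmod_ge0.
Qed.

Lemma closed_dist K x : closed K -> ~ K x ->
  exists2 r : R, 0 < r & forall z, K z -> r <= cmod (z - x).
Proof.
move=> cK Kx; have [r r0 rP] := closed_cmodP cK Kx.
by exists r => // z Kz; rewrite leNgt; apply/negP => /rP.
Qed.

(** A pole at y is traded for one at x.  The condition Q.[0] = 0 lets the value
    at infinity be prescribed in [hull_separation]. *)
Definition pole_push K x y := forall e : R, 0 < e ->
  exists Q : {poly R[i]}, Q.[0] = 0 /\
    forall z, K z -> cmod ((z - y)^-1 - Q.[(z - x)^-1]) <= e.

Lemma pole_push_refl K x : pole_push K x x.
Proof.
move=> e e0; exists 'X; split=> [|z _]; first by rewrite hornerX.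
by rewrite hornerX subrr cmod0 ltW.
Qed.

Lemma pole_push_trans K x y w : closed K -> ~ K y ->
  pole_push K x y -> pole_push K y w -> pole_push K x w.
Proof.
move=> cK Ky xy yw e e0; have [r r0 rP] := closed_dist cK Ky.
have e2 : 0 < e / 2 by rewrite divr_gt0.
have [Q [Q0 QP]] := yw _ e2.
have M0 : 0 <= r^-1 + 1 by rewrite addr_ge0// invr_ge0 ltW.
have [L L0 LP] := poly_lipschitz Q M0.
have d0 : 0 < Num.min 1 (e / 2 / L) by rewrite lt_min ltr01 divr_gt0.
have [S [S0 SP]] := xy _ d0.
exists (Q \Po S); split=> [|z Kz]; first by rewrite horner_comp S0.
rewrite horner_comp.
have u1 : cmod (z - y)^-1 <= r^-1.
  by rewrite cmodV lef_pV2 ?posrE ?rP// (lt_le_trans r0)// rP.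
have := SP z Kz; rewrite le_min => /andP[s1 s2].
have v1 : cmod S.[(z - x)^-1] <= r^-1 + 1.
  set u := (z - y)^-1 in u1 s1 *; set v := S.[_] in s1 *.
  have -> : v = u - (u - v) by ring.
  by rewrite (le_trans (cmodB _ _))// lerD.
rewrite (le_trans (cmod_tri _ Q.[(z - y)^-1] _))// [e]splitr lerD ?QP//.
rewrite (le_trans (LP _ _ _ _))//; first by rewrite (le_trans u1)// lerDl.
by rewrite mulrC -ler_pdivlMr.
Qed.

(** Expand 1/(z - y) in powers of (y - x)/(z - x). *)
Lemma pole_push_near K x y (r : R) : 0 < r -> (forall z, K z -> r <= cmod (z - x)) ->
  cmod (y - x) < r -> pole_push K x y.
Proof.
move=> r0 rP yr e e0; pose q := cmod (y - x) / r.
have q0 : 0 <= q by rewrite divr_ge0 ?cmod_ge0// ltW.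
have q1 : q < 1 by rewrite ltr_pdivrMr// mul1r.
have [n nP] : exists n : nat, r^-1 * q ^+ n / (1 - q) <= e.
  have : (fun n : nat => r^-1 / (1 - q) * q ^+ n) @ \oo --> r^-1 / (1 - q) * 0.
    by apply: cvgM; [exact: cvg_cst | apply: cvg_expr; rewrite ger0_norm].
  rewrite mulr0 => /cvgrPdist_lt/(_ e e0)[n _ /(_ n (leqnn n))] /=.
  rewrite sub0r normrN => /ltW/(le_trans (ler_norm _)) H.
  by exists n; rewrite mulrAC.
exists ('X * \sum_(i < n) ((y - x) *: 'X) ^+ i); split=> [|z Kz].
  by rewrite hornerM hornerX mul0r.
set u := (z - x)^-1; pose v := (y - x) * u.
have zx0 : z - x != 0 by rewrite -cmod_gt0 (lt_le_trans r0)// rP.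
have ur : cmod u <= r^-1.
  by rewrite cmodV lef_pV2 ?posrE ?rP// cmod_gt0.
have vq : cmod v <= q by rewrite cmodM ler_wpM2l ?cmod_ge0.
have v1 : 1 - q <= cmod (1 - v).
  have := cmod_dist 1 v; rewrite cmod1; move/(le_trans (ler_norm _)).
  by apply: le_trans; rewrite lerB.
have v10 : 1 - v != 0 by rewrite -cmod_gt0 (lt_le_trans _ v1)// subr_gt0.
have -> : (z - y)^-1 = u / (1 - v).
  have -> : z - y = (1 - v) * (z - x) by rewrite /v mulrBl mul1r divfK//; ring.
  by rewrite invfM mulrC.
rewrite hornerM hornerX horner_sum.
under eq_bigr do rewrite horner_exp hornerZ hornerX -/v.
have -> : u / (1 - v) - u * (\sum_(i < n) v ^+ i) = u * v ^+ n / (1 - v).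
  have := subrX1 v n; set S := (\sum_(i < n) _) => H.
  have -> : v ^+ n = 1 + (v - 1) * S by rewrite -H addrC subrK.
  by field.
apply: le_trans nP; rewrite !cmodM cmodV cmodX.
apply: ler_pM; rewrite ?mulr_ge0 ?invr_ge0 ?exprn_ge0 ?cmod_ge0//.
  apply: ler_pM; rewrite ?exprn_ge0 ?cmod_ge0//.
  by apply: lerXn2r; rewrite ?nnegrE ?cmod_ge0.
by rewrite lef_pV2 ?posrE ?subr_gt0// cmod_gt0.
Qed.

(** Between close points poles can be pushed in both directions; hence the set
    of points y that can be reached is open and closed in the component. *)
Lemma pole_push_component K x y : closed K ->
  connected_component (~` K) x y -> pole_push K x y.
Proof.
move=> cK xy.
have Kx : ~ K x.
  move=> Kx; move: xy; rewrite connected_component_out//; exact.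
pose C := connected_component (~` K) x.
have CK : C `<=` ~` K by exact: connected_component_sub.
pose W := [set w | ~ K w /\ pole_push K x w].
pose W' := [set w | ~ K w /\ ~ pole_push K x w].
have oW : open W.
  rewrite openE => w [Kw xw]; have [r r0 rP] := closed_dist cK Kw.
  apply/nbhs_cmodP; exists r => // v vr; split.
    by move=> /rP; rewrite leNgt vr.
  apply: pole_push_trans xw _ => //; exact: pole_push_near vr.
have oW' : open W'.
  rewrite openE => w [Kw xw]; have [r r0 rP] := closed_dist cK Kw.
  have r2 : 0 < r / 2 by rewrite divr_gt0.
  have rr : r / 2 < r by rewrite ltr_pdivrMr// ltr_pMr// ltr1n.
  apply/nbhs_cmodP; exists (r / 2) => // v vr.
  have Kv : ~ K v by move=> /rP; rewrite leNgt (lt_trans vr).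
  split=> // xv; apply: xw; apply: pole_push_trans xv _ => //.
  apply: pole_push_near r2 _ _; last by rewrite cmodBC.
  move=> z Kz; have := rP z Kz; have := cmod_tri z v w; move: vr; lra.
suff : C `&` W = C by move=> /seteqP[_ /(_ y xy)] [_ []].
apply: (@component_connected _ (~` K) x) => //.
- exists x; split; first exact: connected_component_refl.
  by split => //; exact: pole_push_refl.
- by exists W.
- exists (~` W'); first exact: open_closedC.
  apply/seteqP; split=> w [Cw].
    by move=> [_ xw]; split=> // -[].
  move=> w'; split=> //; split; first exact: CK.
  by apply: contrapT => xw; apply: w'; split=> //; exact: CK.
Qed.

Lemma unbounded_point K x (M : R) : unbounded_component K x ->
  exists2 y, connected_component (~` K) x y & M < cmod y.
Proof.
move=> [_ nb]; apply: contrapT => H; apply: nb.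
exists (`|M|%:C%C); split; first by rewrite complex_real.
move=> e; rewrite ltcE /= => /andP[/eqP eI eR] y Cy /=.
rewrite cmodE lecE /= eI eqxx /= (le_trans _ (ltW eR))//.
rewrite (le_trans _ (ler_norm _))// leNgt; apply/negP => My.
by apply: H; exists y.
Qed.

(** For y far away 1 + y/(z - y) = z/(z - y) is small on K, and the pole can
    be pushed from y to x. *)
Lemma hull_separation K x : compact K -> unbounded_component K x ->
  exists Q : {poly R[i]}, Q.[0] = 1 /\
    forall z, K z -> cmod Q.[(z - x)^-1] <= 1 / 2.
Proof.
move=> cK xU; have [M M0 MP] := compact_cmod_bounded cK.
have [y xy yM] := unbounded_point (5 * M) xU.
have clK : closed K by apply: compact_closed => //; exact: hausdorffC.
have y0 : 0 < cmod y by rewrite (lt_trans _ yM)// mulr_gt0.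
have e0 : 0 < (4 * cmod y)^-1 by rewrite invr_gt0 mulr_gt0.
have [Q [Q0 QP]] := pole_push_component clK xy e0.
exists (1 + y *: Q); split=> [|z Kz]; first by rewrite !hornerE Q0 mulr0 addr0.
rewrite !hornerE.
have yz : 4 * M < cmod (z - y).
  have := cmod_tri y z 0; rewrite !subr0 cmodBC; have := MP z Kz; lra.
have zy0 : z - y != 0 by rewrite -cmod_gt0 (lt_trans _ yz)// mulr_gt0.
have -> : 1 + y * Q.[(z - x)^-1] = z / (z - y) - y * ((z - y)^-1 - Q.[(z - x)^-1]).
  by field.
rewrite (le_trans (cmodB _ _))//.
have h1 : cmod (z / (z - y)) <= 1 / 4.
  rewrite cmodM cmodV ler_pdivrMr ?cmod_gt0//; have := MP z Kz; lra.
have h2 : cmod (y * ((z - y)^-1 - Q.[(z - x)^-1])) <= 1 / 4.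
  rewrite cmodM; apply: le_trans (ler_wpM2l (cmod_ge0 _) (QP z Kz)) _.
  by rewrite invfM mulrCA divff ?gt_eqF// mulr1 mul1r.
lra.
Qed.

Lemma bernoulli_le (q : R) m : 0 <= q <= 1 -> 1 - m%:R * q <= (1 - q) ^+ m.
Proof.
move=> /andP[q0 q1]; elim: m => [|m IH]; first by rewrite mul0r subr0 expr0.
rewrite exprS; apply: le_trans (_ : (1 - q) * (1 - m%:R * q) <= _).
  rewrite -natr1; have : 0 <= m%:R * q * q by rewrite !mulr_ge0.
  move: (m%:R) => a; nra.
by rewrite ler_wpM2l// subr_ge0.
Qed.

(** With Q given by [hull_separation], (z - x)^m Q(1/(z - x)) is monic of
    degree m and at most half as large as (z - x)^m on K; moving the m zeros of the
    latter slightly costs a factor close to 1. *)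
Lemma smaller_factor K x : compact K -> unbounded_component K x ->
  exists2 d : R, 0 < d & exists m : nat, forall xs : seq R[i], size xs = m ->
    (forall w, w \in xs -> cmod (w - x) <= d) ->
    exists2 P : {poly R[i]}, P \is monic /\ size P = m.+1 &
      forall z, K z -> cmod P.[z] <= 3 / 4 * cmod (\prod_(w <- xs) ('X - w%:P)).[z].
Proof.
move=> cK xU; have [Q [Q0 QP]] := hull_separation cK xU.
have clK : closed K by apply: compact_closed => //; exact: hausdorffC.
have Kx : ~ K x by have [] := xU.
have [r r0 rP] := closed_dist clK Kx.
have Q00 : Q`_0 = 1 by rewrite -horner_coef0.
have Qn0 : Q != 0 by apply/eqP => QE; move/eqP: Q00; rewrite QE coef0 eq_sym oner_eq0.
have m0 : (0 < size Q)%N by rewrite size_poly_gt0.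
set m := size Q in m0; have mR : 0 < m%:R :> R by rewrite ltr0n.
(* (1 - q)^m >= 2/3, and 1/2 <= 3/4 * 2/3 *)
pose q : R := (3 * m%:R)^-1; have q0 : 0 < q by rewrite invr_gt0 mulr_gt0.
have mq : m%:R * q = 3^-1 by rewrite /q invfM mulrCA divff ?mulr1 ?gt_eqF.
have q1 : q <= 1.
  by rewrite invf_le1 ?mulr_gt0//; have : (1 : R) <= m%:R by [rewrite ler1n]; lra.
exists (q * r); first by rewrite mulr_gt0.
exists m => xs xsm xsd.
pose P := \sum_(i < m) Q`_i *: ('X - x%:P) ^+ (m - i).
have Pz z : z != x -> P.[z] = (z - x) ^+ m * Q.[(z - x)^-1].
  rewrite -subr_eq0 => zx0.
  rewrite /P horner_sum horner_coef mulr_sumr; apply: eq_bigr => i _.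
  rewrite hornerZ horner_exp hornerXsubC mulrCA; congr (_ * _).
  by rewrite exprVn -expfB_cond ?(negPf zx0) ?add0n// ltnW.
have sX n : size (('X - x%:P) ^+ n) = n.+1 by rewrite size_exp_XsubC.
have [T slow PE] : exists2 T : {poly R[i]}, (size T < m.+1)%N & P = ('X - x%:P) ^+ m + T.
  exists (\sum_(1 <= i < m) Q`_i *: ('X - x%:P) ^+ (m - i)).
    rewrite ltnS big_nat; apply: (@big_ind {poly R[i]} (fun p => (size p <= m)%N)).
    - by rewrite size_poly0.
    - by move=> p1 p2 h1 h2; rewrite (leq_trans (size_polyD _ _))// geq_max h1.
    - move=> i /andP[i1 im]; rewrite (leq_trans (size_scale_leq _ _))// sX.
      by rewrite ltn_subrL i1 m0.
  rewrite /P -(big_mkord xpredT (fun i : nat => Q`_i *: ('X - x%:P) ^+ (m - i))).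
  by rewrite (big_ltn m0) Q00 scale1r subn0.
move: P PE Pz => P PE Pz.
exists P.
  split; last by rewrite PE size_polyDl sX.
  rewrite monicE PE lead_coefDl ?sX// -monicE; exact: monic_exp (monicXsubC x).
move=> z Kz.
have zx : 0 < cmod (z - x) by rewrite (lt_le_trans r0)// rP.
have zx0 : z - x != 0 by rewrite -cmod_gt0.
have zx1 : z != x by rewrite -subr_eq0.
rewrite (Pz z zx1) cmodM cmodX.
have h1 : cmod (z - x) ^+ m * cmod Q.[(z - x)^-1] <= cmod (z - x) ^+ m * (1 / 2).
  by rewrite ler_wpM2l ?exprn_ge0 ?cmod_ge0// QP.
apply: (le_trans h1).
have a0 : 0 <= (1 - q) * cmod (z - x) by rewrite mulr_ge0 ?subr_ge0// ltW.
have := @prod_dist_bounds R xs xpredT z ((1 - q) * cmod (z - x))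
  ((1 + q) * cmod (z - x)) a0.
rewrite count_predT xsm => H.
have /H/andP[+ _] w : w \in xs -> true ->
    (1 - q) * cmod (z - x) <= cmod (z - w) <= (1 + q) * cmod (z - x).
  move=> wxs _; have wd := xsd w wxs.
  have qz : q * r <= q * cmod (z - x) by rewrite ler_pM2l// rP.
  have := cmod_tri z w x; have := cmod_tri z x w; rewrite (cmodBC x w).
  by move=> *; apply/andP; split; lra.
set Y := cmod _.[z] => YP.
have qq : 0 <= q <= 1 by rewrite q1 ltW.
have h2 : 2 / 3 * cmod (z - x) ^+ m <= Y.
  apply: le_trans YP; rewrite exprMn ler_wpM2r ?exprn_ge0 ?cmod_ge0//.
  by apply: le_trans (bernoulli_le m qq); rewrite mq; lra.
lra.
Qed.

End runge.

(** * Borel functions and the support of a measure *)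

Section borel_functions.
Context {R : realType}.

Lemma open_borel (T : ptopologicalType) (U : set T) : open U ->
  measurable (U : set (borel T)).
Proof. by move=> oU; apply: sub_sigma_algebra. Qed.

Lemma continuous_borel (T : ptopologicalType) (f : T -> R) : continuous f ->
  measurable_fun setT (f : borel T -> R).
Proof.
move=> /continuousP cf; apply: (measurability _ (RGenOpens.measurableE R)).
move=> _ [_ [a [b ->] <-]]; rewrite setTI; apply: open_borel.
exact/cf/interval_open.
Qed.

Lemma closed_borel (T : ptopologicalType) (U : set T) : closed U ->
  measurable (U : set (borel T)).
Proof.
by move=> cU; have := measurableC (open_borel (closed_openC cU)); rewrite setCK.
Qed.

End borel_functions.

Section support.
Context {R : realType}.
Variable mu : probability (borel R[i]) R.
Implicit Types (A K : set R[i]).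
Let K := msupport mu.
Hypothesis cK : compact K.

(** Every point of A has a null neighbourhood, and null sets are stable under
    finite unions. *)
Lemma compact_null A : compact A -> A `&` K = set0 -> mu A = 0%E.
Proof.
move=> cA AK.
(* the properties of null sets that hold for all large ones *)
pose F : set_system (set (borel R[i])) := [set P | exists2 N0 : set (borel R[i]),
  measurable N0 /\ mu N0 = 0%E &
  forall N : set (borel R[i]), measurable N -> mu N = 0%E -> N0 `<=` N -> P N].
have FF : Filter F.
  split.
  - by exists set0.
  - move=> P Q [N [mN N0] PN] [M [mM M0] QM].
    exists (N `|` M).
      by split; [exact: measurableU | by rewrite measureU0].
    by move=> S mS S0 SNM; split; [apply: PN|apply: QM] => //; apply: subset_trans SNM.
  - by move=> P Q PQ [N ? PN]; exists N => // S mS S0 NS; apply/PQ/PN.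
have /compact_near_coveringP/(_ _ F (fun N x => N x) FF) := cA.
case=> [x Ax|N [mN N0] AN].
  have : ~ K x by move=> Kx; have : (A `&` K) x by []; rewrite AK.
  move=> /existsNP[U /not_implyP[[oU Ux] /negP]]; rewrite -leNgt => U0.
  exists (U, [set N | U `<=` N]).
    split=> /=; first exact: open_nbhs_nbhs.
    exists U => //; split; first exact: open_borel.
    by apply/le_anti; rewrite U0 measure_ge0.
  by move=> [y N] /= [Uy UN]; exact: UN.
have AN' := AN N mN N0 (@subset_refl _ N).
apply/le_anti; rewrite measure_ge0 andbT -N0 le_measure ?inE//.
by apply: closed_borel; apply: compact_closed cA; exact: hausdorffC.
Qed.

(** The complement of K is exhausted by the compact sets of the points of
    modulus at most n at distance at least 1/(n + 1) from K. *)
Lemma support_full : mu (~` K) = 0%E.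
Proof.
have clK : closed K by apply: compact_closed => //; exact: hausdorffC.
pose A (n : nat) : set R[i] := cdisk 0 n%:R `&` \bigcap_(w in K) [set z | n.+1%:R^-1 <= cmod (z - w)].
have cA n : compact (A n).
  apply: subclosed_compact (@cdisk_compact R 0 n%:R) _; last by move=> z [].
  apply: closedI; first exact: cdisk_closed.
  apply: closed_bigI => w Kw.
  have -> : [set z | n.+1%:R^-1 <= cmod (z - w)] = (fun z => cmod (z - w)) @^-1` [set x | n.+1%:R^-1 <= x] by [].
  by apply: preimage_closed; [move=> z _; exact: cmodB_continuous | exact: closed_ge].
have A0 n : mu (A n) = 0%E.
  apply: compact_null => //; apply/seteqP; split=> // z [[_ Az] Kz].
  have := Az z Kz; rewrite /= subrr cmod0 leNgt invr_gt0 ltr0n//.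
have sub : ~` K `<=` \bigcup_n A n.
  move=> z Kz; have [r r0 rP] := closed_cmodP clK Kz.
  have [n nP] : exists n : nat, cmod z <= n%:R /\ r^-1 <= n.+1%:R.
    exists (maxn (Num.bound (cmod z)) (Num.bound r^-1)); split.
      apply: le_trans (ltW (archi_boundP (cmod_ge0 z))) _; by rewrite ler_nat leq_maxl.
    have ri : 0 <= r^-1 by rewrite invr_ge0 ltW.
    apply: le_trans (ltW (archi_boundP ri)) _; rewrite ler_nat.
    by apply: leq_trans (leqnSn _); exact: leq_maxr.
  exists n => //; split; first by rewrite /cdisk /= subr0; case: nP.
  move=> w Kw /=; rewrite leNgt; apply/negP => zw.
  apply: (rP w) => //; rewrite cmodBC (lt_le_trans zw)//.
  by case: nP => _ rn; rewrite -(invrK r) lef_pV2 ?posrE ?invr_gt0// ltr0n.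
have mA n : measurable (A n : set (borel R[i])).
  by apply: closed_borel; apply: compact_closed (cA n); exact: hausdorffC.
apply/le_anti; rewrite measure_ge0 andbT.
have mU : measurable (\bigcup_n A n : set (borel R[i])) by exact: bigcupT_measurable.
apply: (@le_trans _ _ (mu (\bigcup_n A n))).
  rewrite le_measure ?inE//; by apply: measurableC; exact: closed_borel.
have := measure_sigma_subadditive mu mA mU (@subset_refl _ _).
by move=> /le_trans; apply; rewrite eseries0// => n _ _; exact: A0.
Qed.

End support.

(** * Extremality of orthogonal polynomials *)

Section extremality.
Context {R : realType}.
Variable mu : probability (borel R[i]) R.
Let K := msupport mu.
Hypothesis cK : compact K.
Hypothesis iK : infinite_set K.
Local Notation I f := (Rintegral mu setT (f : borel R[i] -> R)).

Let clK : closed K.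
Proof. by apply: compact_closed => //; exact: hausdorffC. Qed.

Let mK : measurable (K : set (borel R[i])).
Proof. exact: closed_borel. Qed.

Lemma continuous_integrable (f : R[i] -> R) : continuous f ->
  mu.-integrable setT (EFin \o (f : borel R[i] -> R)).
Proof.
move=> cf; have mf := continuous_borel cf.
apply/(negligible_integrable (measurableC mK)) => //.
- exact/measurable_EFinP.
- exact: support_full.
rewrite setTD setCK; apply: measurable_bounded_integrable => //.
- by apply: le_lt_trans (probability_le1 mu mK) _; exact: ltry.
- exact: measurable_funTS.
have cKf : compact (f @` K).
  by apply: continuous_compact => //; exact: continuous_subspaceT.
have [M [Mr MP]] := compact_bounded cKf.
exists M; split => // x Mx z Kz /=; apply: (MP x Mx); by exists z.
Qed.

Lemma integral_on_support (f : R[i] -> R) : continuous f ->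
  I f = Rintegral mu K (f : borel R[i] -> R).
Proof.
move=> cf; rewrite /Rintegral (@negligible_integral _ _ _ _ _ (~` K : set (borel R[i]))) ?setTD ?setCK//.
- exact: measurableC.
- exact: continuous_integrable.
- exact: support_full.
Qed.

Lemma integral_support_le (f g : R[i] -> R) : continuous f -> continuous g ->
  (forall z, K z -> f z <= g z) -> I f <= I g.
Proof.
move=> cf cg fg; rewrite !integral_on_support//; apply: le_Rintegral => //.
- by apply: (@integrableS _ _ _ _ setT) => //; exact: continuous_integrable.
- by apply: (@integrableS _ _ _ _ setT) => //; exact: continuous_integrable.
Qed.

Lemma continuousDr (f g : R[i] -> R) : continuous f -> continuous g -> continuous (fun z => f z + g z).
Proof. by move=> cf cg z; apply: (@cvgD _ _ _ (nbhs z)); [exact: cf|exact: cg]. Qed.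

Lemma continuousMr (f g : R[i] -> R) : continuous f -> continuous g -> continuous (fun z => f z * g z).
Proof. by move=> cf cg z; apply: (@cvgM _ _ (nbhs z)); [exact: cf|exact: cg]. Qed.

Lemma integral_linear (a b : R) (f g : R[i] -> R) : continuous f -> continuous g ->
  I (fun z => a * f z + b * g z) = a * I f + b * I g.
Proof.
move=> cf cg; rewrite RintegralD//; last 2 first.
- by apply: (@continuous_integrable (fun z => a * f z)); apply: continuousMr => //; exact: cst_continuous.
- by apply: (@continuous_integrable (fun z => b * g z)); apply: continuousMr => //; exact: cst_continuous.
by rewrite !RintegralZl//; exact: continuous_integrable.
Qed.

Lemma conj_continuous : continuous (fun z : R[i] => (z^*)%R).
Proof.
move=> z; apply/continuous_cmodP => e e0; exists e => // w wz.
by rewrite -rmorphB /= cmodJ.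
Qed.

Lemma cmod2_continuous (p : {poly R[i]}) : continuous (fun z => cmod p.[z] ^+ 2).
Proof.
have c : continuous (fun z => cmod p.[z]).
  move=> z; apply: (@continuous_comp _ _ _ (horner p) cmod).
    exact: horner_continuous.
  exact: cmod_continuous.
exact: (continuousMr c c).
Qed.

Lemma inner_continuous (p h : {poly R[i]}) : continuous (fun z => p.[z] * (h.[z])^*).
Proof.
move=> z; apply: (@cvgM _ _ (nbhs z)); first exact: horner_continuous.
apply: (@continuous_comp _ _ _ (horner h) (fun z : R[i] => (z^*)%R)).
  exact: horner_continuous.
exact: conj_continuous.
Qed.

Lemma Re_comp_continuous (f : R[i] -> R[i]) : continuous f -> continuous (fun z => complex.Re (f z)).
Proof.
by move=> cf z; apply: (@continuous_comp _ _ _ f (@complex.Re R)); [exact: cf|exact: Re_continuous].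
Qed.

Lemma Im_comp_continuous (f : R[i] -> R[i]) : continuous f -> continuous (fun z => complex.Im (f z)).
Proof.
by move=> cf z; apply: (@continuous_comp _ _ _ f (@complex.Im R)); [exact: cf|exact: Im_continuous].
Qed.

Lemma orthogonal_low (k : nat) (q h : {poly R[i]}) : monic_orthogonal mu k q ->
  (size h <= k)%N -> I (fun z => complex.Re (q.[z] * (h.[z])^*)) = 0.
Proof.
move=> [_ _ qo] hk.
have orth (l : nat) (c : R[i]) : (l < k)%N ->
    I (fun z => complex.Re (q.[z] * ((c *: 'X^l).[z])^*)) = 0.
  move=> lk; have /eqP := qo l lk; rewrite /cintegral eq_complex => /andP[/eqP re /eqP im].
  rewrite /= in re im.
  pose X z := q.[z] * (z ^+ l)^*.
  have cX : continuous X.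
    have -> : X = (fun z => q.[z] * (('X^l).[z])^*).
      by apply/funext => z; rewrite /X hornerXn.
    exact: inner_continuous.
  have -> : (fun z => complex.Re (q.[z] * ((c *: 'X^l).[z])^*)) =
     (fun z => complex.Re c * complex.Re (X z) + complex.Im c * complex.Im (X z)).
    apply/funext => z; rewrite /X hornerZ hornerXn rmorphM /= mulrCA.
    case: (c) => a b; case: (q.[z] * _) => x y /=; ring.
  rewrite integral_linear; [|exact: Re_comp_continuous|exact: Im_comp_continuous].
  by rewrite re im !mulr0 addr0.
rewrite -(coefK h) poly_def.
elim: (size h) hk => [|n IH] hk.
  rewrite big_ord0; under eq_Rintegral do rewrite horner0 rmorph0 mulr0.
  by rewrite Rintegral_cst// mul0r.
have {}IH := IH (ltnW hk).
pose S := \sum_(i < n) h`_i *: 'X^i.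
have -> : (fun z => complex.Re (q.[z] * ((\sum_(i < n.+1) h`_i *: 'X^i).[z])^*)) =
   (fun z => 1 * complex.Re (q.[z] * (S.[z])^*) + 1 * complex.Re (q.[z] * ((h`_n *: 'X^n).[z])^*)).
  apply/funext => z; rewrite big_ord_recr /= hornerD rmorphD mulrDr !mul1r.
  by case: (q.[z] * _) => ? ?; case: (q.[z] * _) => ? ?.
rewrite integral_linear; try by apply: Re_comp_continuous; exact: inner_continuous.
by rewrite IH orth// !mulr0 addr0.
Qed.

(** Pythagoras: p - q has degree less than k, hence is orthogonal to q. *)
Lemma orthogonal_minimal (k : nat) (q p : {poly R[i]}) : monic_orthogonal mu k q ->
  p \is monic -> size p = k.+1 ->
  I (fun z => cmod q.[z] ^+ 2) <= I (fun z => cmod p.[z] ^+ 2).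
Proof.
move=> qo pm ps; pose h := p - q; have [qm qs _] := qo.
have hk : (size h <= k)%N.
  rewrite -ltnS -ps ltn_neqAle (leq_trans (size_polyD _ _)) ?size_polyN ?qs ?ps ?maxnn//.
  rewrite andbT; apply/eqP => hs.
  have : lead_coef h = 0.
    rewrite /lead_coef hs /= coefB; have /eqP := monicP pm; have /eqP := monicP qm.
    by rewrite /lead_coef ps qs /= => /eqP -> /eqP ->; rewrite subrr.
  by move=> /eqP; rewrite lead_coef_eq0 => /eqP h0; move: hs; rewrite h0 size_poly0.
have -> : (fun z => cmod p.[z] ^+ 2) =
  (fun z => 1 * (cmod q.[z] ^+ 2 + cmod h.[z] ^+ 2) + 2 * complex.Re (q.[z] * (h.[z])^*)).
  apply/funext => z; have -> : p = q + h by rewrite addrC subrK.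
  rewrite hornerD !cmod_sqr; case: q.[z] => a b; case: h.[z] => c d /=; ring.
have cqh : continuous (fun z => cmod q.[z] ^+ 2 + cmod h.[z] ^+ 2).
  by apply: continuousDr; exact: cmod2_continuous.
rewrite integral_linear//; last by apply: Re_comp_continuous; exact: inner_continuous.
rewrite (orthogonal_low qo hk) mulr0 addr0 mul1r.
apply: integral_support_le => //; first exact: cmod2_continuous.
by move=> z _; rewrite lerDl exprn_ge0// cmod_ge0.
Qed.

(** The support is infinite, so q is nonzero at some point of it. *)
Lemma norm_positive (q : {poly R[i]}) : q != 0 -> 0 < I (fun z => cmod q.[z] ^+ 2).
Proof.
move=> q0.
have [z Kz qz] : exists2 z, K z & q.[z] != 0.
  apply: contrapT => H; apply: iK.
  apply: (@sub_finite_set _ _ [set` root_seq q]); last exact: finite_seq.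
  move=> z Kz /=.
  have rq : root q z by apply/negPn/negP => qz; apply: H; exists z.
  move: rq; rewrite /root_seq; case: closed_field_poly_normal => rs /= ->.
  by rewrite rootZ ?lead_coef_eq0// root_prod_XsubC.
pose c := cmod q.[z] ^+ 2 / 2.
have c0 : 0 < c by rewrite divr_gt0// exprn_gt0// cmod_gt0.
pose U := [set w | c < cmod q.[w] ^+ 2].
have oU : open U.
  have -> : U = (fun w => cmod q.[w] ^+ 2) @^-1` [set x | c < x] by [].
  by apply: open_comp; [move=> w _; exact: cmod2_continuous | exact: open_gt].
have Uz : U z.
  by rewrite /U /= /c ltr_pdivrMr// ltr_pMr ?ltr1n// exprn_gt0// cmod_gt0.
have muU : (0 < mu U)%E by exact: Kz.
have mU : measurable (U : set (borel R[i])) by exact: open_borel.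
have cf := @cmod2_continuous q.
have mf : measurable_fun setT (EFin \o (fun z : borel R[i] => cmod q.[z] ^+ 2)).
  by apply/measurable_EFinP; exact: continuous_borel.
have f0 (x : borel R[i]) : (0 <= (cmod q.[x] ^+ 2)%:E)%E.
  by rewrite lee_fin exprn_ge0// cmod_ge0.
have fin : (\int[mu]_x (cmod q.[x] ^+ 2)%:E)%E \is a fin_num.
  exact: integrable_fin_num (continuous_integrable cf).
rewrite /Rintegral fine_gt0//; apply/andP; split; last by rewrite ltey_eq fin.
apply: (@lt_le_trans _ _ (c%:E * mu U)%E); first by rewrite mule_gt0.
rewrite -integral_cst//.
apply: (@le_trans _ _ (\int[mu]_(x in U) (cmod q.[x] ^+ 2)%:E)%E).
  apply: ge0_le_integral => //.
  - by move=> x _; rewrite lee_fin ltW.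
  - exact: measurable_funTS.
  - by move=> x Ux; rewrite lee_fin ltW.
exact: ge0_subset_integral.
Qed.

Lemma no_better (k : nat) (q p : {poly R[i]}) (a : R) : monic_orthogonal mu k q ->
  p \is monic -> size p = k.+1 -> 0 <= a < 1 ->
  ~ (forall z, K z -> cmod p.[z] <= a * cmod q.[z]).
Proof.
move=> qo pm ps /andP[a0 a1] H; have [qm _ _] := qo.
have := orthogonal_minimal qo pm ps; have := norm_positive (monic_neq0 qm).
have cq := @cmod2_continuous q.
have : I (fun z => cmod p.[z] ^+ 2) <= I (fun z => a ^+ 2 * cmod q.[z] ^+ 2 + 0 * cmod q.[z] ^+ 2).
  apply: integral_support_le; first exact: cmod2_continuous.
    by apply: continuousDr; apply: continuousMr => //; exact: cst_continuous.
  move=> z Kz; rewrite mul0r addr0 -exprMn; apply: lerXn2r; rewrite ?nnegrE ?cmod_ge0//.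
    by rewrite mulr_ge0// cmod_ge0.
  exact: H.
rewrite integral_linear// mul0r addr0 => h1 h2 h3.
have : I (fun z => cmod q.[z] ^+ 2) <= a ^+ 2 * I (fun z => cmod q.[z] ^+ 2) by exact: le_trans h1.
rewrite leNgt gtr_pMl// => /negP; apply.
by rewrite expr_lt1.
Qed.

End extremality.

(** * Zeros of orthogonal polynomials *)

Section zeros.
Context {R : realType}.

Lemma root_seqE (p : {poly R[i]}) :
  p = lead_coef p *: \prod_(w <- root_seq p) ('X - w%:P).
Proof. by rewrite /root_seq; case: closed_field_poly_normal. Qed.

Lemma monic_root_seqE (p : {poly R[i]}) : p \is monic ->
  p = \prod_(w <- root_seq p) ('X - w%:P).
Proof. by move=> pm; rewrite {1}(root_seqE p) (monicP pm) scale1r. Qed.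

Lemma size_root_seq (p : {poly R[i]}) : p != 0 -> size p = (size (root_seq p)).+1.
Proof.
move=> p0; rewrite {1}(root_seqE p) size_scale ?lead_coef_eq0//.
exact: size_prod_XsubC.
Qed.

Variable mu : probability (borel R[i]) R.
Hypothesis cK : compact (msupport mu).
Hypothesis iK : infinite_set (msupport mu).

(** Exchanging the factor of q with zeros xs for P would lower the norm. *)
Lemma no_smaller_factor (k : nat) (q P : {poly R[i]}) (xs ys : seq R[i]) (a : R) :
  monic_orthogonal mu k q -> perm_eq (root_seq q) (xs ++ ys) ->
  P \is monic -> size P = (size xs).+1 -> 0 <= a < 1 ->
  ~ (forall z, msupport mu z ->
     cmod P.[z] <= a * cmod (\prod_(w <- xs) ('X - w%:P)).[z]).
Proof.
move=> qo pq Pm Ps a01 H; have [qm qs _] := qo.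
have q0 := monic_neq0 qm.
have qE : q = \prod_(w <- xs) ('X - w%:P) * \prod_(w <- ys) ('X - w%:P).
  by rewrite {1}(monic_root_seqE qm) (perm_big _ pq) big_cat.
have sk : size (root_seq q) = k by have := size_root_seq q0; rewrite qs => -[].
pose D := \prod_(w <- ys) ('X - w%:P).
have Dm : D \is monic by apply: monic_prod_XsubC.
apply: (@no_better R mu cK iK k q (P * D) a qo) => //.
- by rewrite monicMr.
- rewrite size_monicM ?monic_neq0// Ps size_prod_XsubC addnS /= addSn.
  by rewrite -size_cat -(perm_size pq) sk.
- move=> z Kz; rewrite qE !hornerM !cmodM mulrA; apply: ler_wpM2r; first exact: cmod_ge0.
  exact: H.
Qed.

(** A zero far from the support could be replaced by a zero at 0. *)
Lemma zeros_in_disk : exists2 r : R, 0 < r &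
  forall k q, monic_orthogonal mu k q -> forall w, w \in root_seq q -> cmod w <= r.
Proof.
have [M M0 MP] := compact_cmod_bounded cK.
exists (3 * M); first by rewrite mulr_gt0.
move=> k q qo w wq; rewrite leNgt; apply/negP => wM.
have pq : perm_eq (root_seq q) ([:: w] ++ rem w (root_seq q)) by exact: perm_to_rem.
apply: (no_smaller_factor (a := 1 / 2) qo pq (monicX _)); rewrite ?size_polyX//.
  by apply/andP; split; lra.
move=> z Kz; rewrite big_seq1 !hornerE.
have := cmod_tri w z 0; rewrite !subr0 cmodBC; have := MP z Kz; lra.
Qed.

Lemma zeros_locally_bounded x : unbounded_component (msupport mu) x ->
  exists2 d : R, 0 < d & exists m, forall k q, monic_orthogonal mu k q ->
    (count (fun w : R[i] => cmod (w - x) <= d)%R (root_seq q) < m)%N.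
Proof.
move=> xU; have [d d0 [m mP]] := smaller_factor cK xU.
exists d => //; exists m => k q qo; rewrite ltnNge; apply/negP => mc.
pose P (w : R[i]) := cmod (w - x) <= d; pose fs := seq.filter P (root_seq q).
have fsz : (m <= size fs)%N by rewrite size_filter.
have xsz : size (take m fs) = m by rewrite size_takel.
have [|Q [Qm Qs] QP] := mP (take m fs) xsz.
  by move=> w /mem_take; rewrite mem_filter => /andP[].
have pq : perm_eq (root_seq q)
    (take m fs ++ (drop m fs ++ seq.filter (predC P) (root_seq q))).
  by rewrite catA cat_take_drop perm_sym (permEl (perm_filterC P _)).
apply: (no_smaller_factor (a := 3 / 4) qo pq Qm); rewrite ?xsz//.
by apply/andP; split; lra.
Qed.

End zeros.

(** * Weak-star limits of root distributions *)

Section sphere_tests.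
Context {R : realType}.

Definition sphere_ext (F : R[i] -> R) (c : R) (x : sphere R) : R :=
  if x is Some w then F w else c.

Lemma sphere_ext_continuous (F : R[i] -> R) (c r : R) : continuous F ->
  (forall w, r <= cmod w -> F w = c) -> continuous (sphere_ext F c).
Proof.
move=> cF Fc [z|] A.
  by move=> fA; exact: (cF z A fA).
move=> /nbhs_singleton /= Ac.
exists (cdisk 0 r); first by split; [exact: cdisk_compact | exact: cdisk_closed].
move=> [w|] /=; last by [].
move=> [[v vr [vw]]|//]; rewrite /= Fc//; move: vr; rewrite vw /cdisk /= subr0.
by move=> /negP; rewrite -ltNge => /ltW.
Qed.

Lemma Rintegral_root_distribution (p : {poly R[i]}) (f : sphere R -> R) :
  continuous f ->
  Rintegral (root_distribution p) setT f =
  (size (root_seq p))%:R^-1 * \sum_(w <- root_seq p) f (Some w).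
Proof.
move=> cf; set s := root_seq p.
have mf : measurable_fun setT (EFin \o (f : borel (sphere R) -> R)).
  by apply/measurable_EFinP; exact: continuous_borel.
have ge0 (g : borel (sphere R) -> \bar R) : measurable_fun setT g ->
    (forall x, 0 <= g x)%E ->
    (\int[root_distribution p]_x g x = (size s)%:R^-1%:E * \sum_(i < size s) g (Some s`_i))%E.
  move=> mg g0; rewrite /root_distribution ge0_integral_mscale//= -/s.
  rewrite ge0_integral_measure_sum//; congr (_ * _)%E.
  apply: eq_bigr => i _; rewrite integral_dirac// diracT mul1e//.
rewrite /Rintegral integralE ge0//; last exact: measurable_funepos.
rewrite ge0//; last exact: measurable_funeneg.
rewrite (big_nth 0) big_mkord.
have E (g : sphere R -> R) : (\sum_(i < size s) (g (Some s`_i))%:E = (\sum_(i < size s) g (Some s`_i))%:E)%E.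
  by rewrite sumEFin.
under eq_bigr do rewrite funeposE -EFin_max.
under [X in (_ - _ * X)%E]eq_bigr do rewrite funenegE -EFinN -EFin_max.
rewrite !sumEFin -!EFinM -EFinB /= -mulrBr -sumrB; congr (_ * _).
apply: eq_bigr => i _; rewrite /Num.max.
by case: ifPn; case: ifPn; rewrite ?oppr_lt0 ?ltNge; lra.
Qed.

Lemma integral0_null (nu : probability (borel (sphere R)) R) (f : sphere R -> R) :
  continuous f -> (forall x, 0 <= f x) -> Rintegral nu setT f = 0 ->
  nu.-integrable setT (EFin \o (f : borel (sphere R) -> R)) ->
  nu.-negligible ([set x | f x != 0] : set (borel (sphere R))).
Proof.
move=> cf f0 If intf.
have mf : measurable_fun setT (EFin \o (f : borel (sphere R) -> R)).
  by apply/measurable_EFinP; exact: continuous_borel.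
have : (\int[nu]_x `|(EFin \o (f : borel (sphere R) -> R)) x| = 0)%E.
  under eq_integral do rewrite /= ger0_norm//.
  by rewrite -[LHS]fineK ?[fine _]If//; exact: integrable_fin_num intf.
move=> /(ae_eq_integral_abs _ measurableT mf) [N [mN N0 NP]].
exists N; split => // x /= fx; apply: NP => /= H; have := H I => -[].
by move=> fx0; rewrite fx0 eqxx in fx.
Qed.

Lemma sphere_integrable (nu : probability (borel (sphere R)) R) (f : sphere R -> R) :
  continuous f -> nu.-integrable setT (EFin \o (f : borel (sphere R) -> R)).
Proof.
move=> cf; apply: measurable_bounded_integrable => //.
- by apply: le_lt_trans (probability_le1 nu measurableT) _; exact: ltry.
- exact: continuous_borel.
have cK : compact (f @` setT).
  apply: continuous_compact; first exact: continuous_subspaceT.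
  exact: one_point_compactification_compact.
have [M [Mr MP]] := compact_bounded cK.
by exists M; split => // x Mx z Kz /=; apply: (MP x Mx); exists z.
Qed.

End sphere_tests.

Section weak_limit.
Context {R : realType}.
Variables (nu : probability (borel (sphere R)) R) (Q : nat -> {poly R[i]}) (r : R).
Hypothesis Qnu : weak_star_cvg (fun j => root_distribution (Q j)) nu.
Hypothesis Qr : forall j w, w \in root_seq (Q j) -> cmod w <= r.
Let n j : R := (size (root_seq (Q j)))%:R.
Hypothesis noo : n @ \oo --> +oo.

Let mean (F : R[i] -> R) j := (n j)^-1 * \sum_(w <- root_seq (Q j)) F w.

Lemma mean_cvg (F : R[i] -> R) (c r' : R) : continuous F ->
  (forall w, r' <= cmod w -> F w = c) ->
  mean F @ \oo --> Rintegral nu setT (sphere_ext F c).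
Proof.
move=> cF Fc; have cf := sphere_ext_continuous cF Fc.
have -> : mean F = (fun j => Rintegral (root_distribution (Q j)) setT (sphere_ext F c)).
  by apply/funext => j; rewrite Rintegral_root_distribution.
exact: Qnu.
Qed.

Lemma null_of_mean (F : R[i] -> R) (c r' : R) : continuous F ->
  (forall w, r' <= cmod w -> F w = c) -> (forall w, 0 <= F w) -> 0 <= c ->
  mean F @ \oo --> 0 ->
  nu.-negligible ([set x | sphere_ext F c x != 0] : set (borel (sphere R))).
Proof.
move=> cF Fc F0 c0 m0; have cf := sphere_ext_continuous cF Fc.
apply: integral0_null => //; last exact: sphere_integrable.
  by case.
exact: (cvg_unique (@Rhausdorff R) (mean_cvg cF Fc) m0).
Qed.

(** The test function is positive exactly outside the disc, and its mean over
    the roots is 0. *)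
Lemma null_outside :
  nu.-negligible (None |` [set Some w | w in [set w | r < cmod w]] : set (borel (sphere R))).
Proof.
pose F w : R := Num.min 1 (Num.max 0 (cmod w - r)).
have cF : continuous F.
  move=> z; apply: (@continuous_comp _ _ _ cmod (fun y => Num.min 1 (Num.max 0 (y - r)))).
    exact: cmod_continuous.
  apply: (@continuous_min _ R^o (cst 1) (fun y : R => Num.max 0 (y - r))); first exact: cst_continuous.
  apply: (@continuous_max _ R^o (cst 0) (fun y : R => y - r)); first exact: cst_continuous.
  by apply: (@cvgB _ _ _ (nbhs (cmod z))); [exact: cvg_id | exact: cvg_cst].
have Fc w : r + 1 <= cmod w -> F w = 1.
  by move=> rw; rewrite /F min_l// le_max; apply/orP; right; lra.
have F0 w : 0 <= F w by rewrite /F le_min ler01 le_max lexx.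
have m0 : mean F @ \oo --> 0.
  have -> : mean F = cst 0; last exact: cvg_cst.
  apply/funext => j; rewrite /mean big_seq big1 ?mulr0// => w /Qr wr.
  by rewrite /F max_l ?subr_le0// min_r.
have := null_of_mean cF Fc F0 ler01 m0.
apply: negligibleS => x [->|[w rw <-]] /=; first by rewrite oner_eq0.
by rewrite gt_eqF// /F lt_min ltr01 lt_max subr_gt0 rw orbT.
Qed.

Variables (x : R[i]) (d : R) (m : nat).
Hypothesis d0 : 0 < d.
Hypothesis Qm : forall j, (count (fun w : R[i] => cmod (w - x) <= d)%R (root_seq (Q j)) <= m)%N.

Lemma sum_inside_le (F : R[i] -> R) (C : R) j :
  (forall w, cmod (w - x) <= d -> `|F w| <= C) ->
  `|\sum_(w <- root_seq (Q j) | cmod (w - x) <= d) F w| <= m%:R * C.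
Proof.
move=> FC; apply: le_trans (ler_norm_sum _ _ _) _.
have C0 : 0 <= C.
  by apply: le_trans (FC x _) => //; rewrite subrr cmod0 ltW.
apply: (@le_trans _ _ (\sum_(w <- root_seq (Q j) | cmod (w - x) <= d) C)).
  by apply: ler_sum => w; exact: FC.
rewrite big_const_seq iter_addr_0 -[C *+ _]mulr_natl.
by rewrite ler_wpM2r// ler_nat.
Qed.

Lemma inv_n_cvg0 (C : R) : (fun j => (n j)^-1 * C) @ \oo --> 0.
Proof.
rewrite -[X in _ --> X](mul0r C); apply: cvgM; last exact: cvg_cst.
by apply/gtr0_cvgV0 => //; have /cvgryPgt/(_ 0) := noo.
Qed.

(** The proportion of roots in the disc tends to 0. *)
Lemma null_disk :
  nu.-negligible ([set Some w | w in [set w | cmod (w - x) < d]] : set (borel (sphere R))).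
Proof.
pose F w : R := Num.max 0 (d - cmod (w - x)).
have cF : continuous F.
  move=> z; apply: (@continuous_comp _ _ _ (fun w => cmod (w - x)) (fun y => Num.max 0 (d - y))).
    exact: cmodB_continuous.
  apply: (@continuous_max _ R^o (cst 0) (fun y : R => d - y)); first exact: cst_continuous.
  by apply: (@cvgB _ _ _ (nbhs (cmod (z - x)))); [exact: cvg_cst | exact: cvg_id].
have Fc w : d + cmod x <= cmod w -> F w = 0.
  move=> rw; rewrite /F max_l//; have := cmod_tri w x 0; rewrite !subr0; lra.
have F0 w : 0 <= F w by rewrite /F le_max lexx.
have Fd w : `|F w| <= d.
  by rewrite ger0_norm// /F ge_max ltW//= gerBl cmod_ge0.
have m0 : mean F @ \oo --> 0.
  apply: (@squeeze_cvgr _ _ _ _ (cst 0) (fun j => (n j)^-1 * (m%:R * d))); last 2 first.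
  - exact: cvg_cst.
  - exact: inv_n_cvg0.
  apply: nearW => j; apply/andP; split.
    by rewrite mulr_ge0 ?invr_ge0 ?ler0n// sumr_ge0.
  rewrite ler_wpM2l ?invr_ge0 ?ler0n//.
  rewrite (bigID (fun w => cmod (w - x) <= d)) /= [X in _ + X]big1 ?addr0.
    by apply: le_trans (ler_norm _) _; apply: sum_inside_le.
  move=> w; rewrite -ltNge => dw; rewrite /F max_l//; lra.
have := null_of_mean cF Fc F0 (lexx 0) m0.
apply: negligibleS => y [w rw <-] /=.
by rewrite gt_eqF// /F lt_max subr_gt0 rw orbT.
Qed.

End weak_limit.

(** * The potential of the limit as an integral of a test function *)

Section potential.
Context {R : realType}.
Variables (nu : probability (borel (sphere R)) R) (r : R) (x : R[i]) (d : R).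
Hypothesis nu_out :
  nu.-negligible (None |` [set Some w | w in [set w | r < cmod w]] : set (borel (sphere R))).
Hypothesis nu_disk :
  nu.-negligible ([set Some w | w in [set w | cmod (w - x) < d]] : set (borel (sphere R))).
Hypothesis r0 : 0 < r.
Hypothesis d0 : 0 < d.

Let M : R := r + cmod x + d + 1.
Let M0 : 0 < M.
Proof. by rewrite /M; have := cmod_ge0 x; move: r0 d0; lra. Qed.

(** log|z - w| truncated from below, near z, and from above, near infinity: the
    result is a test function on the sphere, changed only where the limit measure
    has no mass. *)
Definition log_dist (a : R) (z w : R[i]) : R := ln (Num.min (Num.max (cmod (z - w)) (a / 2)) (r + cmod x + a + 1)).

Lemma log_dist_continuous z : continuous (log_dist d z).
Proof.
move=> w; pose h (y : R) := Num.min (Num.max y (d / 2)) M.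
have h0 y : 0 < h y.
  by rewrite /h lt_min M0 lt_max divr_gt0// orbT.
apply: (@continuous_comp _ _ _ (fun w => h (cmod (z - w))) (@ln R)); last exact: continuous_ln.
apply: (@continuous_comp _ _ _ (fun w => cmod (z - w)) h).
  have -> : (fun w => cmod (z - w)) = (fun w => cmod (w - z)).
    by apply/funext => v; rewrite cmodBC.
  exact: cmodB_continuous.
apply: (@continuous_min _ R^o (fun y : R => Num.max y (d / 2)) (cst M)); last exact: cst_continuous.
by apply: (@continuous_max _ R^o id (cst (d / 2))); [exact: cvg_id | exact: cst_continuous].
Qed.

Lemma log_dist_far z w : M + cmod z <= cmod w -> log_dist d z w = ln M.
Proof.
move=> Mw; rewrite /log_dist -/M min_r// le_max; apply/orP; left.
have := cmod_tri w z 0; rewrite !subr0 cmodBC; lra.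
Qed.

Lemma log_dist_near z w : cmod (z - x) <= d / 2 -> d <= cmod (w - x) -> cmod w <= r ->
  log_dist d z w = ln (cmod (z - w)).
Proof.
move=> zx wx wr; rewrite /log_dist -/M.
have h1 : d / 2 <= cmod (z - w).
  have := cmod_tri w z x; rewrite (cmodBC w z); lra.
rewrite max_l// min_l//.
have := cmodB z w; have := cmod_tri z x 0; rewrite !subr0 /M; move: d0; lra.
Qed.

Lemma Some_measurable : measurable_fun setT (Some : borel R[i] -> borel (sphere R)).
Proof.
apply: (@measurability _ _ (borel R[i]) (borel (sphere R)) setT _ (@open (sphere R)) (erefl _)) => _ [B oB <-]; rewrite setTI; apply: open_borel.
by apply: open_comp => // w _; exact: one_point_compactification_some_continuous.
Qed.

Lemma plane_part_null (A : set R[i]) : open A ->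
  nu.-negligible ([set Some w | w in A] : set (borel (sphere R))) ->
  plane_part nu A = 0%E.
Proof.
move=> oA nA; rewrite /plane_part; apply/negligibleP => //.
by apply: measurable_plane; exact: open_borel.
Qed.

(** This holds because nu has no mass at infinity. *)
Lemma nu_pushforward (B : set (borel (sphere R))) : measurable B ->
  nu B = plane_part nu (Some @^-1` B).
Proof.
move=> mB; rewrite /plane_part; set B' := Some @` _.
have mB' : measurable (B' : set (borel (sphere R))).
  by apply: measurable_plane; rewrite -[X in measurable X]setTI; exact: Some_measurable.
have BB : B' `<=` B by move=> _ [w Bw <-].
rewrite -(setDUK BB) measureU0//; first exact: measurableD.
apply/negligibleP; first exact: measurableD.
apply: negligibleS nu_out => -[w [Bw nB]|_]; last by left.
by exfalso; apply: nB; exists w.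
Qed.

Lemma lne_cmod_measurable z :
  measurable_fun setT (fun w : borel R[i] => lne (cmod (z - w))%:E).
Proof.
have -> : (fun w : borel R[i] => lne (cmod (z - w))%:E) =
    (fun w : borel R[i] => if (w == z :> R[i]) then -oo%E else (ln (cmod (z - w)))%:E).
  apply/funext => w; case: eqVneq => [->|wz].
    by rewrite subrr cmod0 le0_lneNy.
  by rewrite lne_EFin// cmodBC cmod_gt0 subr_eq0.
apply: measurable_fun_ifT.
- apply: (measurable_fun_bool true); rewrite setTI.
  rewrite (_ : _ @^-1` _ = [set z]).
    by apply: closed_borel; apply: compact_closed; [exact: hausdorffC|exact: compact_set1].
  by apply/seteqP; split => w /= /eqP.
- exact: measurable_cst.
- apply/measurable_EFinP; apply: (measurableT_comp (@measurable_ln R)).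
  apply: (@continuous_borel R R[i]).
  have -> : (fun w => cmod (z - w)) = (fun w => cmod (w - z)).
    by apply/funext => v; rewrite cmodBC.
  exact: cmodB_continuous.
Qed.

Lemma potentialE z : cmod (z - x) <= d / 2 ->
  potential (plane_part nu) z =
    (Rintegral nu setT (sphere_ext (log_dist d z) (ln M)))%:E.
Proof.
move=> zx; pose f := sphere_ext (log_dist d z) (ln M).
have cl := log_dist_continuous (z := z).
have cf : continuous f.
  by apply: (@sphere_ext_continuous _ _ _ (M + cmod z)) => // w; exact: log_dist_far.
have intf := sphere_integrable nu cf.
have mf : measurable_fun setT (EFin \o (f : borel (sphere R) -> R)).
  by apply/measurable_EFinP; exact: continuous_borel.
rewrite /Rintegral fineK; last exact: integrable_fin_num intf.
pose N : set (borel R[i]) := [set w | r < cmod w] `|` [set w | cmod (w - x) < d].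
have o1 : open [set w : R[i] | r < cmod w].
  have -> : [set w : R[i] | r < cmod w] = cmod @^-1` [set y | r < y] by [].
  by apply: open_comp; [move=> w _; exact: cmod_continuous | exact: open_gt].
have o2 : open [set w : R[i] | cmod (w - x) < d].
  have -> : [set w : R[i] | cmod (w - x) < d] = (fun w => cmod (w - x)) @^-1` [set y | y < d] by [].
  by apply: open_comp; [move=> w _; exact: cmodB_continuous | exact: open_lt].
have nN : (plane_part nu).-negligible N.
  apply: negligibleU; apply/negligibleP; try exact: open_borel.
    apply: plane_part_null => //; apply: negligibleS nu_out => y [w rw <-].
    by right; exists w.
  exact: plane_part_null.
have -> : potential (plane_part nu) z =
    (\int[plane_part nu]_w ((EFin \o (f : borel (sphere R) -> R)) \o Some) w)%E.
  apply: ae_eq_integral => //.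
  - exact: lne_cmod_measurable.
  - by apply: (measurableT_comp mf); exact: Some_measurable.
  case: nN => S [mS S0 NS]; exists S; split => // w H; apply: NS.
  apply: contrapT => /not_orP[/negP wr /negP wx]; apply: H => _.
  rewrite -leNgt in wr; rewrite -leNgt in wx.
  change (lne (cmod (z - w))%:E = (log_dist d z w)%:E).
  rewrite log_dist_near// lne_EFin//.
  have := cmod_tri w z x; rewrite (cmodBC w z); move: d0 zx wx; lra.
have push (g : borel (sphere R) -> \bar R) (pm : {measure set (borel (sphere R)) -> \bar R}) :
    (forall A, pm A = plane_part nu (Some @^-1` A)) ->
    (\int[pm]_y g y = \int[nu]_y g y)%E.
  by move=> pmE; apply: eq_measure_integral => A mA _; rewrite [RHS]nu_pushforward.
rewrite -(@integral_pushforward _ _ _ _ R _ Some_measurable (plane_part nu) setT) //.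
  by apply: push => //; exact: Some_measurable.
apply/integrableP; split; first by apply: (measurableT_comp mf); exact: Some_measurable.
move/integrableP : intf => [_]; apply: le_lt_trans.
have := @ge0_integral_pushforward _ _ _ _ R _ Some_measurable (plane_part nu) setT
  (abse \o (EFin \o (f : borel (sphere R) -> R))).
move=> <-//; last 2 first.
- by apply: (measurableT_comp _ mf); exact: abse_measurable.
- by move=> y _ /=; rewrite lee_fin.
rewrite le_eqVlt; apply/orP; left; apply/eqP.
by apply: push => //; exact: Some_measurable.
Qed.

End potential.

(** * First order expansion of the logarithmic potential *)

Section taylor.
Context {R : realType}.

(** 2 ln|1 + u| = ln(1 + y) with y = 2 Re u + |u|^2, and
    y/(1 + y) <= ln(1 + y) <= y. *)
Lemma ln_cmod_approx (u : R[i]) : cmod u <= 1 / 2 ->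
  `|ln (cmod (1 + u)) - complex.Re u| <= 13 * cmod u ^+ 2.
Proof.
move=> u2; pose a := cmod u; have a0 : 0 <= a := cmod_ge0 u.
pose y := 2 * complex.Re u + a ^+ 2.
have uR := Re_le_cmod u.
have yE : cmod (1 + u) ^+ 2 = 1 + y.
  by rewrite /y /a !cmod_sqr; case: (u) => b c /=; ring.
have c2 : 1 / 2 <= cmod (1 + u).
  have := cmod_dist 1 (- u); rewrite cmod1 cmodN opprK => /(le_trans (ler_norm _)).
  by move: u2; lra.
have Y4 : 1 / 4 <= 1 + y.
  by rewrite -yE; have := @lerXn2r _ 2 (1 / 2) (cmod (1 + u)); rewrite !nnegrE; move=> /(_ _ _ c2); rewrite !expr2; lra.
have lnE : ln (1 + y) = 2 * ln (cmod (1 + u)).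
  rewrite -yE lnXn ?mulr_natl//; by apply: lt_le_trans c2.
have up : ln (1 + y) <= y by apply: le_ln1Dx; lra.
have Y0 : 0 < 1 + y by lra.
have lo : y - 4 * y ^+ 2 <= ln (1 + y).
  have h : ln (1 + ((1 + y)^-1 - 1)) <= (1 + y)^-1 - 1.
    by apply: le_ln1Dx; rewrite ltrBrDr addrC subrr invr_gt0.
  rewrite addrC subrK lnV ?posrE// in h.
  have hy : y - 4 * y ^+ 2 <= 1 - (1 + y)^-1.
    have -> : 1 - (1 + y)^-1 = y - y ^+ 2 * (1 + y)^-1 by field; rewrite gt_eqF.
    rewrite lerB// mulrC ler_wpM2r ?sqr_ge0//.
    by rewrite -[4]invrK lef_pV2 ?posrE//; move: Y4; lra.
  move: h hy; lra.
have ya : `|y| <= 5 / 2 * a.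
  rewrite /y; apply: le_trans (ler_normD _ _) _.
  have a2 : a ^+ 2 <= 1 / 2 * a by rewrite expr2 ler_wpM2r.
  rewrite normrM (@ger0_norm _ 2)// (@ger0_norm _ (a ^+ 2)) ?exprn_ge0//; move: uR; rewrite -/a; lra.
have y2 : y ^+ 2 <= 25 / 4 * a ^+ 2.
  rewrite -real_normK ?num_real//.
  have := @lerXn2r _ 2 `|y| (5 / 2 * a); rewrite !nnegrE normr_ge0 => /(_ erefl).
  move=> /(_ _ ya); rewrite exprMn => h; apply: le_trans (h _) _; first by rewrite mulr_ge0.
  by rewrite expr2; lra.
move: up lo y2; rewrite lnE -/a; move: (y ^+ 2) => B; rewrite /y.
have : 0 <= a ^+ 2 by rewrite sqr_ge0.
move: (a ^+ 2) (ln _) (complex.Re u) => A L C *.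
rewrite ler_norml; apply/andP; split; lra.
Qed.

Lemma Re_realM (t : R) (g : R[i]) : complex.Re (t%:C%C * g) = t * complex.Re g.
Proof. by case: g => a b /=; rewrite mul0r subr0. Qed.

Lemma Re_imagM (t : R) (g : R[i]) : complex.Re (Complex 0 t * g) = - (t * complex.Im g).
Proof. by case: g => a b /=; rewrite mul0r add0r. Qed.

Lemma cmod_imag (t : R) : cmod (Complex 0 t) = `|t|.
Proof. by rewrite /cmod /= expr0n /= add0r sqrtr_sqr. Qed.

Lemma derive1_of_quadratic (f : R -> R) (l C del : R) : 0 < del -> 0 <= C ->
  (forall t, `|t| <= del -> `|f t - f 0 - t * l| <= C * t ^+ 2) ->
  derive1 f 0 = l.
Proof.
move=> del0 C0 H; rewrite /derive1; apply: cvg_lim => //.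
apply/cvgrPdist_le => e e0.
have m0 : 0 < Num.min del (e / (C + 1)).
  by rewrite lt_min del0 divr_gt0// ltr_wpDl.
near=> t.
have t0 : t != 0 by near: t; exact: nbhs_dnbhs_neq.
have tm : `|t| < Num.min del (e / (C + 1)).
  near: t; apply: dnbhs0_lt => //.
have td : `|t| <= del by apply: ltW; apply: lt_le_trans tm _; rewrite ge_min lexx.
have te : `|t| * (C + 1) <= e.
  rewrite -ler_pdivlMr ?ltr_wpDl//; apply: ltW; apply: lt_le_trans tm _.
  by rewrite ge_min lexx orbT.
have := H t td; rewrite addr0 => Ht.
have -> : l - t^-1 *: (f t - f 0) = - (t^-1 * (f t - f 0 - t * l)).
  by rewrite /GRing.scale /=; field.
rewrite normrN normrM normfV ler_pdivrMl ?normr_gt0//.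
apply: le_trans Ht _; rewrite -(real_normK (num_real t)) expr2 mulrCA.
rewrite ler_wpM2l// mulrC; apply: le_trans te.
by rewrite ler_wpM2l// lerDl.
Unshelve. all: by end_near. Qed.

Lemma harmonic_derivE (h : R[i] -> R) z g (C del : R) : 0 < del -> 0 <= C ->
  (forall t, cmod t <= del -> `|h (z + t) - h z - complex.Re (t * g)| <= C * cmod t ^+ 2) ->
  harmonic_deriv h z = g.
Proof.
move=> del0 C0 H; rewrite /harmonic_deriv.
rewrite (@derive1_of_quadratic _ (complex.Re g) C del)//; last first.
  move=> t td; have := H t%:C%C; rewrite cmod_real real_normK ?num_real// Re_realM.
  have -> : z + Complex 0 0 = z by case: (z) => a b; rewrite /GRing.add /= !addr0.
  by apply.
rewrite (@derive1_of_quadratic _ (- complex.Im g) C del)//; last first.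
  move=> t td; have := H (Complex 0 t); rewrite cmod_imag real_normK ?num_real// Re_imagM.
  have -> : z + Complex 0 0 = z by case: (z) => a b; rewrite /GRing.add /= !addr0.
  by rewrite mulrN; apply.
by case: (g) => a b /=; rewrite opprK.
Qed.

Lemma log_derivative (s : seq R[i]) (P : pred R[i]) z :
  (forall w, w \in s -> P w -> z != w) ->
  let b := \prod_(w <- s | P w) ('X - w%:P) in
  b.[z] != 0 /\ b^`().[z] / b.[z] = \sum_(w <- s | P w) (z - w)^-1.
Proof.
elim: s => [|w s IH] H /=.
  by rewrite !big_nil derivC !hornerC oner_neq0 mul0r.
have [|b0 bE] := IH; first by move=> v vs; apply: H; rewrite inE vs orbT.
rewrite !big_cons; case: ifPn => Pw //; rewrite -bE.
have zw : z - w != 0 by rewrite subr_eq0 H ?mem_head.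
rewrite derivM !hornerE derivXsubC hornerC mul1r; split; first by rewrite mulf_neq0.
by move: b0; rewrite /=; set B := _.[z]; set B' := _^`().[z] => b0; field; apply/andP.
Qed.

End taylor.

(** * Convergence of logarithmic derivatives *)

Section log_derivative_cvg.
Context {R : realType}.
Variables (nu : probability (borel (sphere R)) R) (Q : nat -> {poly R[i]}) (r : R).
Hypothesis Qnu : weak_star_cvg (fun j => root_distribution (Q j)) nu.
Hypothesis Qr : forall j w, w \in root_seq (Q j) -> cmod w <= r.
Let n j : R := (size (root_seq (Q j)))%:R.
Hypothesis noo : n @ \oo --> +oo.
Hypothesis n0 : forall j, 0 < n j.
Hypothesis r0 : 0 < r.
Variables (x : R[i]) (d : R) (m : nat).
Hypothesis d0 : 0 < d.
Hypothesis Qm : forall j, (count (fun w : R[i] => cmod (w - x) <= d)%R (root_seq (Q j)) <= m)%N.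

(** The factor of Q j whose zeros are away from x. *)
Definition outer_part j := \prod_(w <- root_seq (Q j) | ~~ (cmod (w - x) <= d)) ('X - w%:P).

Let P z := fine (potential (plane_part nu) z).
Let p j z := (n j)^-1 * \sum_(w <- root_seq (Q j) | ~~ (cmod (w - x) <= d)) ln (cmod (z - w)).
Let g j z := (n j)%:C%C ^-1 * \sum_(w <- root_seq (Q j) | ~~ (cmod (w - x) <= d)) (z - w)^-1.

Let outer_dist z w : cmod (z - x) <= d / 2 -> ~~ (cmod (w - x) <= d) -> d / 2 <= cmod (z - w).
Proof.
move=> zx; rewrite -ltNge => wx; have := cmod_tri w z x; rewrite (cmodBC w z); lra.
Qed.

Let outer_neq z w : cmod (z - x) <= d / 2 -> ~~ (cmod (w - x) <= d) -> z - w != 0.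
Proof.
by move=> zx wx; rewrite -cmod_gt0 (lt_le_trans _ (outer_dist zx wx))// divr_gt0.
Qed.

Let gE j z : cmod (z - x) <= d / 2 ->
  (outer_part j)^`().[z] / ((n j)%:C%C * (outer_part j).[z]) = g j z /\ (outer_part j).[z] != 0.
Proof.
move=> zx; have [|b0 bE] := @log_derivative R (root_seq (Q j)) (fun w => ~~ (cmod (w - x) <= d)) z.
  by move=> w _ wx; rewrite -subr_eq0 outer_neq.
by rewrite /g -bE; split => //; rewrite invfM mulrCA.
Qed.

Let count_le_n j (F : R[i] -> R) (C : R) : 0 <= C ->
  (forall w, w \in root_seq (Q j) -> ~~ (cmod (w - x) <= d) -> F w <= C) ->
  (n j)^-1 * \sum_(w <- root_seq (Q j) | ~~ (cmod (w - x) <= d)) F w <= C.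
Proof.
move=> C0 FC; rewrite ler_pdivrMl//.
apply: (@le_trans _ _ (\sum_(w <- root_seq (Q j) | ~~ (cmod (w - x) <= d)) C)).
  by rewrite big_seq_cond [leRHS]big_seq_cond; apply: ler_sum => w /andP[]; exact: FC.
rewrite big_const_seq iter_addr_0 -mulr_natl ler_wpM2r// ler_nat.
exact: count_size.
Qed.

Let p_cvg z : cmod (z - x) <= d / 2 -> p^~ z @ \oo --> P z.
Proof.
move=> zx.
pose M := r + cmod x + d + 1.
have nout := null_outside Qnu Qr.
have ndisk := null_disk Qnu noo d0 Qm.
have := potentialE nout ndisk r0 d0 zx.
have cl := @log_dist_continuous R r x d r0 d0 z.
have far w : M + cmod z <= cmod w -> log_dist r x d z w = ln M by exact: log_dist_far.
have mc := mean_cvg Qnu cl far.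
rewrite /P => -> /=.
pose C := `|ln (d / 2)| + `|ln M|.
have dM : d / 2 <= M by rewrite /M; have := cmod_ge0 x; move: r0 d0; lra.
have lb w : `|log_dist r x d z w| <= C.
  rewrite /log_dist -/M; set y := Num.min _ _.
  have y1 : d / 2 <= y by rewrite le_min dM le_max lexx orbT.
  have y2 : y <= M by rewrite ge_min lexx orbT.
  have d20 : 0 < d / 2 by rewrite divr_gt0.
  have y0 := lt_le_trans d20 y1; have M0 := lt_le_trans y0 y2.
  have l1 : ln (d / 2) <= ln y by rewrite ler_ln ?posrE.
  have l2 : ln y <= ln M by rewrite ler_ln ?posrE.
  rewrite /C; have := ler_norm (ln M); have := ler_norm (- ln (d / 2)); rewrite normrN.
  have := normr_ge0 (ln M); have := normr_ge0 (ln (d / 2)) => *.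
  rewrite ler_norml; apply/andP; split; lra.
have pE : p^~ z = (fun j => (n j)^-1 * \sum_(w <- root_seq (Q j)) log_dist r x d z w -
   (n j)^-1 * \sum_(w <- root_seq (Q j) | cmod (w - x) <= d) log_dist r x d z w).
  apply/funext => j; rewrite /p [X in _ = _ * X - _](bigID (fun w => cmod (w - x) <= d)) /= mulrDr addrAC subrr add0r.
  congr (_ * _); rewrite big_seq_cond [RHS]big_seq_cond; apply: eq_bigr => w /andP[ws wx].
  rewrite log_dist_near ?Qr//; last exact: Qr ws.
  by apply: ltW; rewrite ltNge.
rewrite pE -[X in _ --> X]subr0; apply: cvgB; first exact: mc.
apply/norm_cvg0P.
apply: (@squeeze_cvgr _ _ _ _ (cst 0) (fun j => (n j)^-1 * (m%:R * C))); last 2 first.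
- exact: cvg_cst.
- exact: inv_n_cvg0 noo _.
apply: nearW => j; apply/andP; split; first exact: normr_ge0.
rewrite normrM ger0_norm ?invr_ge0 ?(ltW (n0 j))// ler_wpM2l ?invr_ge0 ?(ltW (n0 j))//.
exact: (sum_inside_le d0 Qm).
Qed.

Let C0 := 52 / d ^+ 2.

(** The constant depends on d only, so that the estimate survives in the limit. *)
Let p_taylor j z t : cmod (z - x) <= d / 4 -> cmod t <= d / 8 ->
  `|p j (z + t) - p j z - complex.Re (t * g j z)| <= C0 * cmod t ^+ 2.
Proof.
move=> zx td.
have z2 : cmod (z - x) <= d / 2 by move: d0; lra.
have nC : (n j)%:C%C ^-1 = ((n j)^-1)%:C%C :> R[i] by rewrite fmorphV.
have -> : complex.Re (t * g j z) = (n j)^-1 *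
    \sum_(w <- root_seq (Q j) | ~~ (cmod (w - x) <= d)) complex.Re (t / (z - w)).
  rewrite /g nC mulrCA Re_realM mulr_sumr; congr (_ * _).
  by apply: (big_morph (@complex.Re R)) => // -[? ?] [? ?].
rewrite /p -!mulrBr -!sumrB normrM ger0_norm ?invr_ge0 ?(ltW (n0 j))//.
apply: le_trans (ler_wpM2l _ (ler_norm_sum _ _ _)) _.
  by rewrite invr_ge0 ltW.
apply: count_le_n; first by rewrite mulr_ge0 ?sqr_ge0// divr_ge0// sqr_ge0.
move=> w _ wx; have zw := outer_dist z2 wx; have zw0 := outer_neq z2 wx.
have u4 : cmod (t / (z - w)) <= 2 / d * cmod t.
  rewrite cmodM cmodV mulrC ler_wpM2r ?cmod_ge0//.
  by rewrite -[2 / d]invrK invf_div lef_pV2 ?posrE ?divr_gt0// (lt_le_trans _ zw)// divr_gt0.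
have u2 : cmod (t / (z - w)) <= 1 / 2.
  apply: le_trans u4 _; rewrite mulrAC ler_pdivrMr//; move: td d0; lra.
have := ln_cmod_approx u2.
have -> : ln (cmod (z + t - w)) - ln (cmod (z - w)) = ln (cmod (1 + t / (z - w))).
  have -> : 1 + t / (z - w) = (z + t - w) / (z - w) by field.
  rewrite cmodM cmodV ln_div ?posrE//; last by rewrite cmod_gt0.
  have := cmod_tri (z - w) (- t) 0; rewrite !subr0 opprK cmodN.
  have -> : z - w + t = z + t - w by ring.
  by move: zw td d0; lra.
move=> /le_trans; apply; rewrite /C0.
have -> : 52 / d ^+ 2 * cmod t ^+ 2 = 13 * (2 / d * cmod t) ^+ 2.
  by field; rewrite gt_eqF.
by rewrite ler_pM2l//; apply: lerXn2r; rewrite ?nnegrE ?cmod_ge0// (le_trans (cmod_ge0 _) u4).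
Qed.

Let g_bound j z : cmod (z - x) <= d / 2 -> cmod (g j z) <= 2 / d.
Proof.
move=> zx; rewrite /g cmodM cmodV cmod_real gtr0_norm//.
apply: (@le_trans _ _ ((n j)^-1 * \sum_(w <- root_seq (Q j) | ~~ (cmod (w - x) <= d)) cmod (z - w)^-1)).
  by rewrite ler_wpM2l ?invr_ge0 ?(ltW (n0 j))// cmod_sum.
apply: count_le_n; first by rewrite divr_ge0// ltW.
move=> w _ wx; have zw := outer_dist zx wx.
by rewrite cmodV -[2 / d]invrK invf_div lef_pV2 ?posrE ?divr_gt0// (lt_le_trans _ zw)// divr_gt0.
Qed.

(** Passing to the limit in [p_taylor] along j gives a first order expansion of
    the potential at z with derivative c. *)
Let cluster_deriv z c : cmod (z - x) <= d / 4 -> cluster (g^~ z @ \oo) c ->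
  harmonic_deriv P z = c.
Proof.
move=> zx cl; have d8 : 0 < d / 8 by rewrite divr_gt0.
apply: (@harmonic_derivE _ _ _ _ C0 (d / 8)) => //.
  by rewrite divr_ge0 ?sqr_ge0.
move=> t td; apply/ler_addgt0Pr => e e0.
have e4 : 0 < e / 4 by rewrite divr_gt0.
have z2 : cmod (z - x) <= d / 2 by move: d0; lra.
have zt2 : cmod (z + t - x) <= d / 2.
  rewrite addrAC (le_trans (cmodD _ _))//; move: d0; lra.
have /cvgrPdist_le/(_ _ e4) n1 := p_cvg z2.
have /cvgrPdist_le/(_ _ e4) n2 := p_cvg zt2.
have t1 : 0 < cmod t + 1 by rewrite ltr_wpDl// cmod_ge0.
have nb : nbhs c [set w | cmod (w - c) < e / 4 / (cmod t + 1)].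
  by apply/nbhs_cmodP; exists (e / 4 / (cmod t + 1)) => //; rewrite divr_gt0.
have nF : (g^~ z @ \oo) [set w | exists2 j, g j z = w & `|P z - p j z| <= e / 4 /\ `|P (z + t) - p j (z + t)| <= e / 4].
  have : \forall j \near \oo, `|P z - p j z| <= e / 4 /\ `|P (z + t) - p j (z + t)| <= e / 4.
    by near=> j; split; near: j.
  by apply: filterS => j H; exists j.
have [_ [[j <- [h1 h2]] h3]] := cl _ _ nF nb.
have h4 := p_taylor j zx td.
have h5 : `|complex.Re (t * g j z) - complex.Re (t * c)| <= e / 4.
  have -> : complex.Re (t * g j z) - complex.Re (t * c) = complex.Re (t * (g j z - c)).
    by rewrite mulrBr; case: (t * g j z) => ? ?; case: (t * c).
  apply: le_trans (Re_le_cmod _) _; rewrite cmodM.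
  apply: (@le_trans _ _ ((cmod t + 1) * cmod (g j z - c))).
    by rewrite ler_wpM2r ?cmod_ge0// lerDl.
  by rewrite mulrC -ler_pdivlMr// ltW.
have -> : P (z + t) - P z - complex.Re (t * c) =
  (P (z + t) - p j (z + t)) - (P z - p j z) + (complex.Re (t * g j z) - complex.Re (t * c)) +
  (p j (z + t) - p j z - complex.Re (t * g j z)) by ring.
have := ler_normD ((P (z + t) - p j (z + t)) - (P z - p j z) + (complex.Re (t * g j z) - complex.Re (t * c)))
  (p j (z + t) - p j z - complex.Re (t * g j z)).
have := ler_normD ((P (z + t) - p j (z + t)) - (P z - p j z)) (complex.Re (t * g j z) - complex.Re (t * c)).
have := ler_normB (P (z + t) - p j (z + t)) (P z - p j z).
move: h1 h2 h4 h5; lra.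
Unshelve. all: by end_near. Qed.

Let g_cvg z : cmod (z - x) <= d / 4 ->
  g^~ z @ \oo --> potential_deriv (plane_part nu) z.
Proof.
move=> zx; have z2 : cmod (z - x) <= d / 2 by move: d0; lra.
have inV j : cdisk 0 (2 / d) (g j z) by rewrite /cdisk /= subr0 g_bound.
have FV s : 2 / d <= s -> (g^~ z @ \oo) (cdisk 0 s).
  by move=> sd; apply: (@nearW _ \oo) => j; apply: cdiskS (inV j).
have [c [cV cl]] := @cdisk_compact R 0 (2 / d) (g^~ z @ \oo) _ (FV _ (lexx _)).
have -> : potential_deriv (plane_part nu) z = c := cluster_deriv zx cl.
apply: (@compact_cluster_set1 _ _ _ (cdisk 0 (2 / d + 1)) (@hausdorffC R)).
- exact: cdisk_compact.
- apply/nbhs_cmodP; exists 1 => // w wc; rewrite /cdisk /= subr0.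
  move: cV; rewrite /cdisk /= subr0 => cV.
  have := cmod_tri w c 0; rewrite !subr0; lra.
- by apply: FV; rewrite lerDl.
- apply/seteqP; split => [c' cl'|_ -> //].
  by rewrite /= -(cluster_deriv zx cl) (cluster_deriv zx cl').
Qed.

Let g_lip j z z' : cmod (z - x) <= d / 2 -> cmod (z' - x) <= d / 2 ->
  cmod (g j z - g j z') <= 4 / d ^+ 2 * cmod (z - z').
Proof.
move=> zx zx'; rewrite /g -mulrBr -sumrB cmodM cmodV cmod_real gtr0_norm//.
apply: le_trans (ler_wpM2l _ (cmod_sum _ _ _)) _; first by rewrite invr_ge0 ltW.
apply: count_le_n; first by rewrite mulr_ge0 ?cmod_ge0// divr_ge0// sqr_ge0.
move=> w _ wx.
have zw := outer_dist zx wx; have zw' := outer_dist zx' wx.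
have zw0 := outer_neq zx wx; have zw0' := outer_neq zx' wx.
have -> : (z - w)^-1 - (z' - w)^-1 = (z' - z) / ((z - w) * (z' - w)).
  by field; apply/andP.
rewrite cmodM cmodBC mulrC ler_wpM2r ?cmod_ge0// cmodV cmodM.
have -> : 4 / d ^+ 2 = (d / 2 * (d / 2))^-1 by field; rewrite gt_eqF.
have h : 0 < d / 2 by rewrite divr_gt0.
rewrite lef_pV2 ?posrE ?mulr_gt0 ?(lt_le_trans h zw) ?(lt_le_trans h zw')//.
by apply: ler_pM => //; exact: ltW.
Qed.

(** By [cluster_deriv] the bounded sequence g j z has a single cluster point, so
    it converges; the convergence is uniform because all g j have the same
    Lipschitz constant. *)
Lemma log_derivative_cvg :
  ucvg \oo (fun j z => (outer_part j)^`().[z] / ((n j)%:C%C * (outer_part j).[z]))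
    (cdisk x (d / 4)) (potential_deriv (plane_part nu)).
Proof.
have d42 z : cmod (z - x) <= d / 4 -> cmod (z - x) <= d / 2 by move: d0; lra.
(* from here on only these properties of g and D matter, and both are abstracted *)
have [L L0 lip] : exists2 L, 0 < L & forall j z z', cmod (z - x) <= d / 2 ->
    cmod (z' - x) <= d / 2 -> cmod (g j z - g j z') <= L * cmod (z - z').
  by exists (4 / d ^+ 2); [rewrite divr_gt0// exprn_gt0 | exact: g_lip].
move: (g) (potential_deriv _) lip g_cvg gE => h D lip hcvg hE.
have near_h z e : cmod (z - x) <= d / 4 -> 0 < e -> \forall j \near \oo, cmod (h j z - D z) < e.
  by move=> zx e0; exact: (cvg_cmodP (F := \oo) _ _).1 (hcvg z zx) e e0.
have Dlip z z' : cmod (z - x) <= d / 4 -> cmod (z' - x) <= d / 4 ->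
    cmod (D z - D z') <= L * cmod (z - z').
  move=> zx zx'; apply/ler_addgt0Pr => e e0; have e2 : 0 < e / 2 by rewrite divr_gt0.
  have [j [h1 h2]] := @filter_ex nat \oo _ _
    (@filterI nat \oo _ _ _ (near_h z _ zx e2) (near_h z' _ zx' e2)).
  have := cmod_tri (D z) (h j z) (D z'); have := cmod_tri (h j z) (h j z') (D z').
  have := lip j z z' (d42 _ zx) (d42 _ zx'); rewrite (cmodBC (D z) (h j z)).
  move: h1 h2; lra.
move=> e e0; have e3 : 0 < e / 3 by rewrite divr_gt0.
suff : \forall j \near \oo, cdisk x (d / 4) `<=` (fun z => cdisk x (d / 4) z -> cmod (h j z - D z) <= e).
  move=> H; apply: (@filterS _ \oo _ _ _ _ H) => j Hj z zD.
  by have [-> _] := hE j z (d42 z zD); exact: (Hj z zD zD).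
apply: ((compact_near_coveringP (cdisk x (d / 4))).1 (@cdisk_compact R x (d / 4)) nat \oo
  (fun j z => cdisk x (d / 4) z -> cmod (h j z - D z) <= e)) => z zx.
exists (cdisk z (e / 3 / L), [set j | cmod (h j z - D z) < e / 3]).
  by split; [apply: nbhs_disk; rewrite divr_gt0 | exact: near_h].
move=> [z' j] /= [zz' hj] zx'.
have := cmod_tri (h j z') (h j z) (D z'); have := cmod_tri (h j z) (D z) (D z').
have := lip j z' z (d42 _ zx') (d42 _ zx).
have := Dlip z z' zx zx'; rewrite (cmodBC z z').
have : L * cmod (z' - z) <= e / 3 by rewrite mulrC -ler_pdivlMr.
move: hj; lra.
Qed.

Lemma outer_part_neq0 j z : cdisk x (d / 4) z -> (outer_part j).[z] != 0.
Proof. by move=> zx; have [] := @gE j z; first (move: zx d0; rewrite /cdisk /=; lra). Qed.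

End log_derivative_cvg.

(** * Zeros of the derivative of the potential *)

Lemma outer_partE (R : realType) (Q : nat -> {poly R[i]}) (x : R[i]) (d : R) j : Q j \is monic ->
  Q j = \prod_(w <- root_seq (Q j) | cmod (w - x) <= d) ('X - w%:P) * outer_part Q x d j.
Proof.
by move=> Qm; rewrite {1}(monic_root_seqE Qm) (bigID (fun w => cmod (w - x) <= d)).
Qed.

Section limit_function.
Context {R : realType}.
Variables (mu : probability (borel R[i]) R) (q : nat -> {poly R[i]}) (k_ : nat -> nat).
Variable nu : probability (borel (sphere R)) R.
Hypothesis cK : compact (msupport mu).
Hypothesis iK : infinite_set (msupport mu).
Hypothesis qo : forall k : nat, monic_orthogonal mu k (q k).
Hypothesis k0 : forall j : nat, (0 < k_ j)%N.
Hypothesis kinc : {homo k_ : i j / (i < j)%N >-> (i < j)%N}.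
Hypothesis qnu : weak_star_cvg (fun j => root_distribution (q (k_ j))) nu.
Let Q j := q (k_ j).
Let Om := unbounded_component (msupport mu).
Let D := potential_deriv (plane_part nu).

Lemma index_ge j : (j <= k_ j)%N.
Proof. by elim: j => // j IH; apply: leq_ltn_trans IH _; exact: kinc. Qed.

Lemma monic_q k : q k \is monic.
Proof. by have [] := qo k. Qed.

Lemma size_root_q k : size (root_seq (q k)) = k.
Proof.
by have [qm qs _] := qo k; have := size_root_seq (monic_neq0 qm); rewrite qs => -[].
Qed.

Lemma index_cvg : (fun j => (size (root_seq (q (k_ j))))%:R : R) @ \oo --> +oo.
Proof.
apply/cvgryPge => A; exists (Num.bound A) => // j /= Aj.
rewrite size_root_q; have [A0|A0] := leP 0 A; last by rewrite (le_trans (ltW A0)).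
apply: le_trans (ltW (archi_boundP A0)) _; rewrite ler_nat.
exact: leq_trans Aj (index_ge j).
Qed.

Lemma root_count_gt0 j : 0 < (size (root_seq (q (k_ j))))%:R :> R.
Proof. by rewrite size_root_q ltr0n. Qed.

Lemma local_log_derivative x (d : R) m : 0 < d ->
  (forall j, (count (fun w : R[i] => cmod (w - x) <= d)%R (root_seq (Q j)) <= m)%N) ->
  ucvg \oo (fun j z => (outer_part Q x d j)^`().[z] /
     (((size (root_seq (Q j)))%:R)%:C%C * (outer_part Q x d j).[z])) (cdisk x (d / 4)) D
  /\ forall j z, cdisk x (d / 4) z -> (outer_part Q x d j).[z] != 0.
Proof.
move=> d0 Qm; have [r r0 rP] := zeros_in_disk cK iK.
split; last by move=> j z; exact: outer_part_neq0.
apply: (@log_derivative_cvg R nu Q r qnu _ index_cvg root_count_gt0 r0 x d m) => // j w.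
exact: rP (qo _) w.
Qed.

Lemma local_rat_lim x (d : R) m : 0 < d ->
  (forall j, (count (fun w : R[i] => cmod (w - x) <= d)%R (root_seq (Q j)) <= m)%N) ->
  rat_lim x (d / 4) D.
Proof.
move=> d0 Qm e e0; have [cv b0] := local_log_derivative d0 Qm.
have [j jP] := @filter_ex nat \oo _ _ (cv e e0).
exists (outer_part Q x d j)^`(), (((size (root_seq (Q j)))%:R)%:C%C *: outer_part Q x d j).
split=> z zx; last by rewrite hornerZ; exact: jP.
rewrite hornerZ mulf_neq0 ?b0//.
by rewrite -cmod_gt0 cmod_real gtr0_norm ?root_count_gt0.
Qed.

Lemma rat_lim_at x : Om x -> exists2 s, 0 < s & rat_lim x s D.
Proof.
move=> xO; have [d d0 [m mP]] := zeros_locally_bounded cK iK xO.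
exists (d / 4); first by rewrite divr_gt0.
by apply: (@local_rat_lim x d m) => // j; apply: ltnW; apply: mP; exact: qo.
Qed.

(** If |x| > 3r, then x times the mean of the 1/(x - w) over the roots w, which
    have modulus at most r, differs from 1 by at most 1/2. *)
Lemma far_neq0 : exists r : R, forall x, r < cmod x -> D x != 0.
Proof.
have [r r0 rP] := zeros_in_disk cK iK.
exists (3 * r) => x xr.
have d0 : 0 < r / 2 by rewrite divr_gt0.
have out j w : w \in root_seq (Q j) -> 2 * r <= cmod (x - w).
  move=> /(rP _ _ (qo _)) wr; have := cmod_tri x w 0; rewrite !subr0; lra.
have c0 j : count (fun w : R[i] => cmod (w - x) <= r / 2)%R (root_seq (Q j)) = 0%N.
  apply/eqP; rewrite -leqn0 leqNgt -has_count; apply/hasPn => w /out.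
  by rewrite -ltNge (cmodBC w x); move: r0; lra.
have [|cv b0] := @local_log_derivative x (r / 2) 0 d0; first by move=> j; rewrite c0.
have x0 : 0 < cmod x by apply: lt_trans xr; rewrite mulr_gt0.
have e0 : 0 < (4 * cmod x)^-1 by rewrite invr_gt0 mulr_gt0.
have [j jP] := @filter_ex nat \oo _ _ (cv _ e0).
have xD : cdisk x (r / 2 / 4) x by rewrite /cdisk /= subrr cmod0 !divr_ge0// ltW.
have outP w : w \in root_seq (Q j) -> ~~ (cmod (w - x) <= r / 2).
  by move=> /out; rewrite -ltNge (cmodBC w x); move: r0; lra.
have xw w : w \in root_seq (Q j) -> x - w != 0.
  by move=> /out wr; rewrite -cmod_gt0 (lt_le_trans _ wr)// mulr_gt0.
have [|B0 LD] := @log_derivative R (root_seq (Q j)) (fun w => ~~ (cmod (w - x) <= r / 2)) x.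
  by move=> w /xw; rewrite subr_eq0.
pose kap : R := (size (root_seq (Q j)))%:R; have kap0 : 0 < kap := root_count_gt0 j.
have kapC : kap%:C%C != 0 :> R[i] by rewrite -cmod_gt0 cmod_real gtr0_norm.
pose S := \sum_(w <- root_seq (Q j)) (x - w)^-1.
have SE : (outer_part Q x (r / 2) j)^`().[x] / (kap%:C%C * (outer_part Q x (r / 2) j).[x]) = S / kap%:C%C.
  rewrite invfM mulrCA LD mulrC; congr (_ / _).
  by rewrite big_seq_cond [RHS]big_seq_cond; apply: eq_bigl => w; case: (boolP (w \in _)) => //= /outP ->.
have := jP x xD; rewrite SE => h1.
have h2 : cmod (x * S - kap%:C%C) <= kap * (1 / 2).
  have -> : x * S - kap%:C%C = \sum_(w <- root_seq (Q j)) (x / (x - w) - 1).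
    rewrite sumrB mulr_sumr; congr (_ - _).
    by rewrite big_const_seq count_predT iter_addr_0 /kap rmorph_nat.
  apply: le_trans (cmod_sum _ _ _) _.
  apply: (@le_trans _ _ (\sum_(w <- root_seq (Q j)) (1 / 2 : R))).
    rewrite big_seq [leRHS]big_seq; apply: ler_sum => w wq.
    have -> : x / (x - w) - 1 = w / (x - w) by field; exact: xw.
    rewrite cmodM cmodV ler_pdivrMr ?cmod_gt0 ?xw//.
    by have := rP _ _ (qo _) w wq; have := out j w wq; lra.
  by rewrite big_const_seq count_predT iter_addr_0 -[leLHS]mulr_natl.
apply/eqP => Dx0; move: h1; rewrite Dx0 subr0 => h1.
have h3 : cmod (x * S) <= kap * (1 / 4).
  rewrite cmodM mulrC -ler_pdivlMr//.
  move: h1; rewrite cmodM cmodV cmod_real gtr0_norm// ler_pdivrMr// => /le_trans; apply.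
  by rewrite invfM le_eqVlt; apply/orP; left; apply/eqP; field; rewrite gt_eqF.
have := cmod_tri (kap%:C%C) (x * S) 0; rewrite !subr0 cmod_real gtr0_norm// cmodBC.
move: kap0 h2 h3; lra.
Qed.

Lemma component_unbounded x y : Om x -> connected_component (~` msupport mu) x y -> Om y.
Proof.
move=> [Kx ub] xy; split; first exact: connected_component_sub xy.
by rewrite -(same_connected_component xy).
Qed.

(** Each point of Omega either has a neighbourhood on which D vanishes or a
    punctured one on which D has no zero.  Both alternatives are open conditions,
    so the first would spread over the component, up to points excluded by
    [far_neq0]. *)
Lemma nearby_neq0 x : Om x -> forall s, 0 < s -> exists2 z, cmod (z - x) < s & D z != 0.
Proof.
move=> xO s s0; apply: contrapT => H.
pose V : set R[i] := [set y | \forall z \near nbhs y, D z = 0].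
pose W : set R[i] := [set y | exists2 rho : R, 0 < rho & forall z, z != y -> cmod (z - y) < rho -> D z != 0].
have oV : open V.
  rewrite openE => y /nbhs_cmodP[rho rho0 rhoP].
  apply/nbhs_cmodP; exists (rho / 2); first by rewrite divr_gt0.
  move=> z zy; apply/nbhs_cmodP; exists (rho / 2); first by rewrite divr_gt0.
  move=> w wz; apply: rhoP; have := cmod_tri w z y; lra.
have oW : open W.
  rewrite openE => y [rho rho0 rhoP].
  apply/nbhs_cmodP; exists rho => // z zy.
  have [->|zy0] := eqVneq z y; first by exists rho.
  have p1 : 0 < cmod (z - y) by rewrite cmod_gt0 subr_eq0.
  exists (Num.min (cmod (z - y)) (rho - cmod (z - y))).
    by rewrite lt_min p1 subr_gt0.
  move=> w _; rewrite lt_min => /andP[w1 w2]; apply: rhoP.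
    by apply: contraTneq w1 => ->; rewrite cmodBC ltxx.
  have := cmod_tri w z y; lra.
have VW y : V y -> W y -> False.
  move=> /nbhs_cmodP[rho rho0 rhoP] [tau tau0 tauP].
  pose t := Num.min rho tau / 2.
  have m0 : 0 < Num.min rho tau by rewrite lt_min rho0.
  have t0 : 0 < t by rewrite divr_gt0.
  have tm : t < Num.min rho tau by rewrite ltr_pdivrMr// ltr_pMr// ltr1n.
  have zE : cmod (y + t%:C%C - y) = t by rewrite circle_point// ltW.
  have Dz : D (y + t%:C%C) = 0.
    by apply: rhoP; rewrite zE (lt_le_trans tm)// ge_min lexx.
  have : D (y + t%:C%C) != 0.
    apply: tauP; first by rewrite -subr_eq0 -cmod_gt0 zE.
    by rewrite zE (lt_le_trans tm)// ge_min lexx orbT.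
  by rewrite Dz eqxx.
have VorW y : Om y -> ~ V y -> W y.
  move=> yO yV; have [s1 s10 yL] := rat_lim_at yO.
  have [|d [G [GL G0 GE]]] := rat_lim_order s10 yL.
    apply: contrapT => H1; apply: yV; apply/nbhs_cmodP; exists s1 => // w wy.
    by apply: contrapT => /eqP Dw; apply: H1; exists w.
  have yy : cmod (y - y) < s1 by rewrite subrr cmod0.
  have G2 : 0 < cmod (G y) by rewrite cmod_gt0.
  have [del del0 delP] := (continuous_cmodP _ _).1 (rat_lim_continuous GL yy) _ G2.
  exists (Num.min s1 del); first by rewrite lt_min s10.
  move=> z zy; rewrite lt_min => /andP[z1 z2].
  rewrite GE; last exact: ltW.
  rewrite mulf_neq0// ?expf_neq0 ?subr_eq0//.
  by apply: contraTneq (delP z z2) => ->; rewrite sub0r cmodN ltxx.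
have xV : V x.
  apply/nbhs_cmodP; exists s => // z zx; apply: contrapT => /eqP Dz.
  by apply: H; exists z.
have [r rP] := far_neq0.
have [y xy yr] := unbounded_point r xO.
pose C := connected_component (~` msupport mu) x.
have CO z : C z -> Om z by exact: component_unbounded.
have Kx : (~` msupport mu) x by case: xO.
(* V and W cover the component and are disjoint *)
have CV : C `&` V = C.
  apply: (@component_connected _ (~` msupport mu) x) => //.
  - by exists x; split => //; exact: connected_component_refl.
  - by exists V.
  - exists (~` W); first exact: open_closedC.
    apply/seteqP; split=> z [Cz].
      by move=> Vz; split=> // Wz; exact: VW Vz Wz.
    move=> Wz; split; first exact: Cz.
    apply: contrapT => Vz; apply: Wz; exact: (VorW z (CO z Cz) Vz).
have [_ Vy] : (C `&` V) y by rewrite CV.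
by have := rP y yr; rewrite (nbhs_singleton Vy) eqxx.
Qed.

Lemma limit_order x : Om x -> exists (s : R) (d : nat) (G : R[i] -> R[i]),
  [/\ 0 < s, rat_lim x s D, rat_lim x s G, forall z, cmod (z - x) <= s -> G z != 0 &
      forall z, cmod (z - x) <= s -> D z = (z - x) ^+ d * G z].
Proof.
move=> xO; have [s1 s10 xL] := rat_lim_at xO.
have [d [G [GL G0 GE]]] := rat_lim_order s10 xL (nearby_neq0 xO s10).
have xx : cmod (x - x) < s1 by rewrite subrr cmod0.
have G2 : 0 < cmod (G x) by rewrite cmod_gt0.
have [del del0 delP] := (continuous_cmodP _ _).1 (rat_lim_continuous GL xx) _ G2.
pose s := Num.min s1 (del / 2).
have ss : s <= s1 by rewrite ge_min lexx.
have sd : s < del.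
  by apply: (@le_lt_trans _ _ (del / 2)); [rewrite ge_min lexx orbT | rewrite ltr_pdivrMr// ltr_pMr// ltr1n].
have sub h : rat_lim x s1 h -> rat_lim x s h.
  move=> hL e e0; have [N [B [B0 NB]]] := hL e e0; exists N, B.
  by split=> z zs; [apply: B0|apply: NB]; exact: cdiskS zs.
exists s, d, G; split; [by rewrite lt_min s10 divr_gt0 | exact: sub | exact: sub | |].
  move=> z zs; apply: contraTneq (delP z (le_lt_trans zs sd)) => ->.
  by rewrite sub0r cmodN ltxx.
by move=> z zs; apply: GE; exact: le_trans ss.
Qed.

End limit_function.

(** * Orders of zeros, and sums over zeros *)

Section zero_orders.
Context {R : realType}.
Implicit Types (f g : R[i] -> R[i]) (z : R[i]).

Lemma derivable_cmod_continuous g z : derivable g z 1 -> {for z, continuous g}.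
Proof. by move=> /derivable1_diffP; exact: differentiable_continuous. Qed.

(** If n1 < n2, then g1 = (w - z)^(n2 - n1) g2 would tend to 0 at z. *)
Lemma has_zero_order_le f z n1 n2 : has_zero_order f z n1 -> has_zero_order f z n2 ->
  (n2 <= n1)%N.
Proof.
move=> [g1 [d1 g10 f1]] [g2 [d2 g20 f2]]; rewrite leqNgt; apply/negP => n12.
have c1 := derivable_cmod_continuous (nbhs_singleton d1).
have c2 := derivable_cmod_continuous (nbhs_singleton d2).
have p1 : 0 < cmod (g1 z) by rewrite cmod_gt0.
have h1 : 0 < cmod (g1 z) / 2 by rewrite divr_gt0.
have [e1 e10 E1] := (continuous_cmodP _ _).1 c1 _ h1.
have [e2 e20 E2] := (continuous_cmodP _ _).1 c2 _ ltr01.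
have /nbhs_cmodP[e3 e30 E3] := f1; have /nbhs_cmodP[e4 e40 E4] := f2.
pose B := cmod (g2 z) + 1; have B0 : 0 < B by rewrite ltr_wpDl// cmod_ge0.
pose c := Num.min (Num.min (Num.min e1 e2) (Num.min e3 e4)) (Num.min 1 (cmod (g1 z) / 2 / B)).
have c0 : 0 < c.
  by rewrite !lt_min e10 e20 e30 e40 ltr01 !divr_gt0.
pose t := c / 2; have t0 : 0 < t by rewrite divr_gt0.
have tc : t < c by rewrite ltr_pdivrMr// ltr_pMr// ltr1n.
have := tc; rewrite /c !lt_min -!andbA => /and5P[t1 t2 t3 t4 /andP[t5 t6]].
pose w := z + t%:C%C; have wz : cmod (w - z) = t by rewrite circle_point// ltW.
have wz0 : w - z != 0 by rewrite -cmod_gt0 wz.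
have := E3 w; have := E4 w; have := E1 w; have := E2 w; rewrite wz.
move=> /(_ t2) a2 /(_ t1) a1 /(_ t4) -> /(_ t3) H.
have gE : g1 w = (w - z) ^+ (n2 - n1) * g2 w.
  apply: (mulfI (expf_neq0 n1 wz0)); rewrite -H mulrA -exprD subnKC//; exact: ltnW.
have g1l : cmod (g1 z) / 2 < cmod (g1 w).
  by have := le_lt_trans (cmod_dist _ _) a1; rewrite ltr_norml => /andP[+ _]; lra.
have g2u : cmod (g2 w) <= B.
  by have := le_lt_trans (cmod_dist _ _) a2; rewrite ltr_norml /B => /andP[_ +]; lra.
have g1u : cmod (g1 w) <= t * B.
  rewrite gE cmodM cmodX wz; apply: ler_pM; rewrite ?exprn_ge0 ?cmod_ge0 ?(ltW t0)//.
  have [k ->] : exists k, (n2 - n1)%N = k.+1 by exists (n2 - n1).-1; rewrite prednK// subn_gt0.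
  by rewrite exprS ler_piMr ?(ltW t0)// exprn_ile1// ltW.
by move: t6; rewrite ltr_pdivlMr// => t6; lra.
Qed.

Lemma zero_orderE f z n : has_zero_order f z n -> zero_order f z = n.
Proof.
move=> fn; apply: xget_unique => // k fk; apply/eqP; rewrite eqn_leq.
by rewrite (has_zero_order_le fn fk) (has_zero_order_le fk fn).
Qed.

Lemma zero_order0 f z : f z != 0 -> zero_order f z = 0%N.
Proof.
move=> fz; rewrite /zero_order; case: xgetP => // n _ [g [_ _ /nbhs_singleton]].
by case: n => // n; rewrite subrr expr0n mul0r => /eqP; rewrite (negPf fz).
Qed.

Lemma horner_derivable (p : {poly R[i]}) z : derivable (horner p) z 1.
Proof.
apply: (@rat_lim_derivable R z 1); rewrite ?subrr ?cmod0// => e e0.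
exists p, 1; split=> w _; first by rewrite hornerC oner_neq0.
by rewrite hornerC divr1 subrr cmod0 ltW.
Qed.

Lemma zero_order_horner (p : {poly R[i]}) z : p != 0 ->
  zero_order (horner p) z = count_mem z (root_seq p).
Proof.
move=> p0; apply: zero_orderE.
pose g := lead_coef p *: \prod_(w <- root_seq p | w != z) ('X - w%:P).
exists (horner g); split; first by apply: (@nearW _ (nbhs z)) => w; exact: horner_derivable.
- rewrite /g hornerZ mulf_neq0 ?lead_coef_eq0//.
  rewrite -/(root _ z) -big_filter root_prod_XsubC mem_filter.
  by rewrite eqxx.
- apply: (@nearW _ (nbhs z)) => w; rewrite {1}(root_seqE p) (bigID (pred1 z)) /=.
  rewrite /g !hornerZ hornerM mulrCA; congr (_ * _).
  rewrite (eq_bigr (fun=> 'X - z%:P)); last by move=> v /eqP ->.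
  by rewrite big_const_seq iter_mulr_1 horner_exp hornerXsubC.
Qed.

Lemma fsbig_uniq_seq (U : set R[i]) (s : seq R[i]) (F : R[i] -> R[i]) : uniq s ->
  (forall z, U z -> z \notin s -> F z = 0) -> (forall z, z \in s -> ~ U z -> F z = 0) ->
  \sum_(z \in U) F z = \sum_(z <- s) F z.
Proof.
move=> us F1 F2; rewrite (@fsbig_seq _ _ _ _ s F us).
transitivity (\sum_(z \in U `|` [set` s]) F z).
  apply: fsbig_widen; first by move=> z Uz; left.
  by move=> z [[//|zs] nU] /=; exact: F2.
apply/esym; apply: fsbig_widen; first by move=> z zs; right.
by move=> z [[Uz|//] /= /negP zs]; exact: F1.
Qed.

Lemma sum_count (s S : seq R[i]) (phi : R[i] -> R[i]) : uniq S -> {subset s <= S} ->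
  \sum_(w <- s) phi w = \sum_(z <- S) (count_mem z s)%:R * phi z.
Proof.
move=> uS; elim: s => [|w s IH] sS.
  by rewrite big_nil big1// => z _; rewrite mul0r.
rewrite big_cons IH; last by move=> v vs; apply: sS; rewrite inE vs orbT.
under [RHS]eq_bigr do rewrite /= natrD mulrDl.
rewrite big_split /=; congr (_ + _).
rewrite (bigD1_seq w) ?sS ?mem_head//= eqxx mul1r big1 ?addr0// => z zw.
by rewrite eq_sym (negPf zw) mul0r.
Qed.

Lemma divisor_action_polys (U : set R[i]) (p q : {poly R[i]}) (phi : R[i] -> R[i]) :
  p != 0 -> q != 0 -> (forall z, phi z != 0 -> U z) ->
  divisor_action U (fun z => zero_divisor (horner p) z - zero_divisor (horner q) z) phi =
  \sum_(w <- root_seq p) phi w - \sum_(w <- root_seq q) phi w.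
Proof.
move=> p0 q0 phiU; pose S := undup (root_seq p ++ root_seq q).
have uS : uniq S by exact: undup_uniq.
have pS : {subset root_seq p <= S} by move=> w wp; rewrite mem_undup mem_cat wp.
have qS : {subset root_seq q <= S} by move=> w wp; rewrite mem_undup mem_cat wp orbT.
rewrite /divisor_action (fsbig_uniq_seq uS); last 2 first.
- move=> z _; rewrite mem_undup mem_cat negb_or => /andP[zp zq].
  by rewrite /zero_divisor !zero_order_horner// (count_memPn zp) (count_memPn zq) subrr mul0r.
- move=> z _ nU; have [->|/phiU //] := eqVneq (phi z) 0; exact: mulr0.
rewrite (sum_count phi uS pS) (sum_count phi uS qS) -sumrB.
apply: eq_bigr => z _; rewrite /zero_divisor !zero_order_horner//.
by rewrite intrD mulrDl rmorphN /= mulNr.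
Qed.

End zero_orders.

(** Used for two discs with the same centre: equal counts confine the points
    of the large disc to the small one. *)
Lemma count_eq_sub (T : eqType) (a b : pred T) (s : seq T) :
  subpred a b -> count a s = count b s -> forall w, w \in s -> b w -> a w.
Proof.
move=> ab E w ws bw; apply: contraT => naw.
have : (count a s < count b s)%N.
  have -> : count b s = (count a s + count (predI b (predC a)) s)%N.
    rewrite -count_predUI [X in (_ + X)%N](eq_count (a2 := pred0)); last first.
      by move=> v /=; case: (a v); rewrite /= ?andbF.
    rewrite count_pred0 addn0; apply: eq_count => v /=.
    by case av : (a v); [rewrite ab | rewrite andbT].
  rewrite -[X in (X < _)%N]addn0 ltn_add2l -has_count.
  by apply/hasP; exists w => //=; rewrite bw.
by rewrite E ltnn.
Qed.

Section filters.
Context {R : realType}.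

(** If the preimage of a neighbourhood of l is not in F, its complement belongs
    to some ultrafilter finer than F. *)
Lemma cvg_ultra (T : Type) (X : topologicalType) (F : set_system T) (FF : Filter F) (f : T -> X) (l : X) :
  (forall U : set_system T, UltraFilter U -> F `<=` U -> f @ U --> l) -> f @ F --> l.
Proof.
move=> H A lA; apply: contrapT => nA.
pose G : set_system T := within (~` (f @^-1` A)) F.
have GF : Filter G by exact: within_filter.
have PG : ProperFilter G.
  apply: Build_ProperFilter => G0; apply: nA.
  by apply: (@filterS _ F FF _ _ _ G0) => t Bt; apply: contrapT => nt; exact: Bt nt.
have [U [UU GU]] := ultraFilterLemma PG.
have FU : F `<=` U by move=> B FB; apply: GU; apply: (@filterS _ F FF _ _ _ FB) => t Bt _.
have UA : U (f @^-1` A) := H U UU FU A lA.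
have UnA : U (~` (f @^-1` A)) by apply: GU; apply: nearW.
have UP := @ultra_proper _ _ UU.
have [t [? ?]] := @filter_ex _ _ UP _ (filterI UA UnA).
by [].
Qed.

Lemma ultra_bounded_nat (U : set_system nat) (c : nat -> nat) M : UltraFilter U ->
  (forall j, (c j <= M)%N) -> exists2 n, (n <= M)%N & U [set j | c j = n].
Proof.
move=> UU; have UP := @ultra_proper _ _ UU.
elim: M => [|M IH] in c * => cM.
  by exists 0%N => //; apply: filterS filterT => j _ /=; apply/eqP; rewrite -leqn0.
have [UM|UM] := in_ultra_setVsetC [set j | c j = M.+1] UU; first by exists M.+1.
have [j|n nM Un] := IH (fun j => minn (c j) M); first exact: geq_minr.
exists n; first exact: leqW.
apply: filterS (filterI UM Un) => j [/= cj <-].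
by apply/esym/minn_idPl; rewrite -ltnS ltn_neqAle cM andbT; apply/eqP.
Qed.

Lemma finite_separation (zs : seq R[i]) z :
  exists2 t : R, 0 < t & forall z', z' \in zs -> z' != z -> t <= cmod (z' - z).
Proof.
elim: zs => [|v vs [t t0 tP]]; first by exists 1.
have [->|vz] := eqVneq v z.
  by exists t => // z'; rewrite inE => /orP[/eqP ->|]; [rewrite eqxx | exact: tP].
exists (Num.min t (cmod (v - z))); first by rewrite lt_min t0 cmod_gt0 subr_eq0.
move=> z'; rewrite inE => /orP[/eqP -> _|z'vs z'z]; first by rewrite ge_min lexx orbT.
by rewrite ge_min tP.
Qed.

(** Along F, exactly cnt z of the points of s j approach z, for each z in zs, and
    phi vanishes at those that approach no point of zs. *)
Lemma sum_limit (F : set_system nat) {FF : Filter F} (s : nat -> seq R[i])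
    (phi : R[i] -> R[i]) (zs : seq R[i]) (rho : R[i] -> R) (cnt : R[i] -> nat) :
  uniq zs -> continuous phi ->
  (forall w, phi w != 0 -> exists2 z, z \in zs & cmod (w - z) <= rho z) ->
  (forall z, z \in zs -> 0 < rho z) ->
  (forall z, z \in zs -> forall r, 0 < r -> r <= rho z ->
     \forall j \near F, count (fun w => cmod (w - z) <= r)%R (s j) = cnt z) ->
  (fun j => \sum_(w <- s j) phi w) @ F --> \sum_(z <- zs) (cnt z)%:R * phi z.
Proof.
move=> uzs cphi cover rho0 H; apply/cvg_cmodP => e e0.
pose N : R := (\sum_(z <- zs) cnt z)%:R + 1.
have N0 : 0 < N by rewrite ltr_wpDl// ler0n.
have eN : 0 < e / N by rewrite divr_gt0.
have [r r0 rP] : exists2 r, 0 < r & forall z, z \in zs -> [/\ r <= rho z,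
    forall w, cmod (w - z) <= r -> cmod (phi w - phi z) < e / N &
    forall z', z' \in zs -> z' != z -> 2 * r < cmod (z' - z)].
  have pt z : exists r : R, z \in zs -> [/\ 0 < r, r <= rho z,
    forall w, cmod (w - z) <= r -> cmod (phi w - phi z) < e / N &
    forall z', z' \in zs -> z' != z -> 2 * r < cmod (z' - z)].
    have [zz|] := boolP (z \in zs); last by exists 0.
    have [d d0 dP] := (continuous_cmodP _ _).1 (cphi z) _ eN.
    have [t t0 tP] := finite_separation zs z.
    exists (Num.min (rho z) (Num.min (d / 2) (t / 3))) => _; split.
    - by rewrite !lt_min rho0// !divr_gt0.
    - by rewrite ge_min lexx.
    - move=> w; rewrite !le_min => /and3P[_ wd _]; apply: dP.
      by apply: le_lt_trans wd _; rewrite ltr_pdivrMr// ltr_pMr// ltr1n.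
    - move=> z' z's z'z; have := tP z' z's z'z.
      have : Num.min (rho z) (Num.min (d / 2) (t / 3)) <= t / 3 by rewrite !ge_min lexx !orbT.
      by move: t0; lra.
  have [rr rrP] := choice pt.
  have [r r0 rmin] : exists2 r, 0 < r & forall z, z \in zs -> r <= rr z.
    have : forall z, z \in zs -> 0 < rr z by move=> z /rrP[].
    elim: (zs) => [|v vs IH] pos; first by exists 1.
    have [|t t0 tP] := IH; first by move=> z zv; apply: pos; rewrite inE zv orbT.
    exists (Num.min t (rr v)); first by rewrite lt_min t0 pos// mem_head.
    by move=> z; rewrite inE => /orP[/eqP ->|/tP tz]; rewrite ge_min ?lexx ?orbT// tz.
  exists r => // z zz; have rz := rmin z zz; have [_ a b c] := rrP z zz.
  split; [exact: le_trans rz a | by move=> w wr; apply: b; exact: le_trans rz |].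
  by move=> z' z's z'z; apply: le_lt_trans (c z' z's z'z); rewrite ler_pM2l.
have nearall : \forall j \near F, forall z, z \in zs ->
    count (fun w => cmod (w - z) <= r)%R (s j) = cnt z /\
    count (fun w => cmod (w - z) <= rho z)%R (s j) = cnt z.
  have : forall z, z \in zs -> \forall j \near F,
    count (fun w => cmod (w - z) <= r)%R (s j) = cnt z /\
    count (fun w => cmod (w - z) <= rho z)%R (s j) = cnt z.
    move=> z zz; have [rz _ _] := rP z zz.
    by apply: filterS2 (H z zz r r0 rz) (H z zz _ (rho0 z zz) (lexx _)) => j.
  elim: (zs) => [_|v vs IH hv]; first by apply: filterE.
  have Hv := hv v (mem_head _ _).
  have Hvs := IH (fun z zv => hv z (mem_behead (s := v :: vs) zv)).
  by apply: filterS2 Hv Hvs => j h1 h2 z; rewrite inE => /orP[/eqP ->|/h2].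
apply: filterS nearall => j jP.
pose I (z w : R[i]) := cmod (w - z) <= r.
pose I' (z w : R[i]) := cmod (w - z) <= rho z.
have close z w : z \in zs -> w \in s j -> I' z w -> I z w.
  move=> zz; have [c1 c2] := jP z zz; have [rz _ _] := rP z zz.
  by apply: count_eq_sub (etrans c1 (esym c2)) _ => v /le_trans; exact.
(* the discs of radius r about the points of zs are disjoint *)
have key w : w \in s j -> phi w = \sum_(z <- zs | I z w) phi w.
  move=> ws; have [->|/cover[z zz wz]] := eqVneq (phi w) 0; first by rewrite big1.
  have wr : I z w by exact: close.
  rewrite big_mkcond (bigD1_seq z)//= wr big_seq_cond big1 ?addr0// => v /andP[vz vnz].
  case: ifPn => // wv; exfalso; have [_ _ sep] := rP z zz; have := sep v vz vnz.
  have := cmod_tri v w z; rewrite (cmodBC v w); move: wv wr; rewrite /I; lra.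
have -> : \sum_(w <- s j) phi w = \sum_(z <- zs) \sum_(w <- s j | I z w) phi w.
  rewrite big_seq (eq_bigr _ key) -big_seq.
  under eq_bigr do rewrite big_mkcond.
  by rewrite exchange_big /=; apply: eq_bigr => z _; rewrite -big_mkcond.
have -> : \sum_(z <- zs) \sum_(w <- s j | I z w) phi w - \sum_(z <- zs) (cnt z)%:R * phi z =
    \sum_(z <- zs) \sum_(w <- s j | I z w) (phi w - phi z).
  rewrite -sumrB big_seq [RHS]big_seq; apply: eq_bigr => z zz; rewrite sumrB; congr (_ - _).
  by have [<- _] := jP z zz; rewrite big_const_seq iter_addr_0 mulr_natl.
apply: le_lt_trans (cmod_sum _ _ _) _.
apply: (@le_lt_trans _ _ (\sum_(z <- zs) (cnt z)%:R * (e / N))).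
  rewrite big_seq [leRHS]big_seq; apply: ler_sum => z zz.
  apply: le_trans (cmod_sum _ _ _) _; have [_ near_phi _] := rP z zz.
  apply: (@le_trans _ _ (\sum_(w <- s j | I z w) (e / N))).
    by apply: ler_sum => w /near_phi/ltW.
  by have [<- _] := jP z zz; rewrite big_const_seq iter_addr_0 mulr_natl.
rewrite -mulr_suml -natr_sum mulrCA gtr_pMr// ltr_pdivrMr// mul1r.
by rewrite /N ltrDl.
Qed.

End filters.

(** * Convergence of the divisors *)

Section assembly.
Context {R : realType}.

Lemma prod_near_power (ws : seq R[i]) (P : pred R[i]) (x z : R[i]) (r s : R) :
  0 <= r -> r <= 1 -> 0 <= s -> (forall w, w \in ws -> P w -> cmod (w - x) <= r) ->
  cmod (z - x) <= s ->
  cmod ((\prod_(w <- ws | P w) ('X - w%:P)).[z] - (z - x) ^+ count P ws) <=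
    (count P ws)%:R * r * (s + 1) ^+ count P ws.
Proof.
move=> r0 r1 s0 + zs; have s10 : 0 <= s + 1 by rewrite addr_ge0.
elim: ws => [_|w ws IH H].
  by rewrite big_nil hornerC expr0 subrr cmod0 !mul0r.
have {}IH := IH (fun v vr => H v (mem_behead (s := w :: ws) vr)).
rewrite big_cons /=; case: ifPn => Pw; last by rewrite add0n.
rewrite add1n hornerM hornerXsubC; set n := count P ws in IH *.
set A := _.[z] in IH *.
have -> : (z - w) * A - (z - x) ^+ n.+1 = (z - w) * (A - (z - x) ^+ n) - (w - x) * (z - x) ^+ n.
  by rewrite exprS; ring.
have wr := H w (mem_head _ _) Pw.
have zw : cmod (z - w) <= s + 1.
  by rewrite (le_trans (cmod_tri _ x _))// lerD// cmodBC (le_trans wr).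
have h1 : cmod ((z - w) * (A - (z - x) ^+ n)) <= (s + 1) * (n%:R * r * (s + 1) ^+ n).
  by rewrite cmodM ler_pM ?cmod_ge0.
have h2 : cmod ((w - x) * (z - x) ^+ n) <= r * (s + 1) ^+ n.+1.
  rewrite cmodM cmodX ler_pM ?exprn_ge0 ?cmod_ge0//.
  apply: (@le_trans _ _ ((s + 1) ^+ n)).
    by apply: lerXn2r; rewrite ?nnegrE ?cmod_ge0// (le_trans zs)// lerDl.
  by rewrite exprS ler_peMl ?exprn_ge0// lerDr.
apply: le_trans (cmodB _ _) _; apply: le_trans (lerD h1 h2) _.
rewrite le_eqVlt; apply/orP; left; apply/eqP; rewrite -natr1 exprS; ring.
Qed.

Lemma derivn_neq0 (p : {poly R[i]}) (k m : nat) : size p = k.+1 -> (m <= k)%N -> p^`(m) != 0.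
Proof.
move=> pk mk; apply/eqP => p0; have := coef_derivn m p (k - m); rewrite p0 coef0 subnKC//.
have := ffact_gt0 k m; rewrite mk lt0n => /negPf k0.
move=> /esym/eqP; rewrite mulrn_eq0 k0 /=.
have -> : p`_k = lead_coef p by rewrite /lead_coef pk.
by rewrite lead_coef_eq0 -size_poly_eq0 pk.
Qed.

Lemma finite_is_divisor (U : set R[i]) (xi : R[i] -> int) (zs : seq R[i]) :
  (forall z, xi z != 0 -> z \in zs) -> is_divisor U xi.
Proof.
move=> xizs z Uz lz; have [t t0 tP] := finite_separation zs z.
have [|w [wz [_ xw] wt]] := lz [set w | cmod (w - z) < t].
  by apply/nbhs_cmodP; exists t.
by have := tP w (xizs w xw) wz; rewrite leNgt wt.
Qed.

(** The count decreases with the radius, so it is constant from the radius at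
    which it is smallest. *)
Lemma ultra_stable_count (U : set_system nat) (s : nat -> seq R[i]) x (d : R) M : UltraFilter U ->
  0 < d -> (forall j, (count (fun w => cmod (w - x) <= d)%R (s j) <= M)%N) ->
  exists2 rho : R, 0 < rho <= d & exists n, forall r, 0 < r -> r <= rho ->
    \forall j \near U, count (fun w => cmod (w - x) <= r)%R (s j) = n.
Proof.
move=> UU d0 sM; have UP := @ultra_proper _ _ UU.
pose c r j := count (fun w => cmod (w - x) <= r)%R (s j).
have cle r r' j : r <= r' -> (c r j <= c r' j)%N.
  by move=> rr; apply: sub_count => w /= /le_trans; exact.
have ex r : 0 < r -> r <= d -> exists n, U [set j | c r j = n].
  move=> _ rd; have [j|n _ Un] := @ultra_bounded_nat U (c r) M UU.
    exact: leq_trans (cle _ _ j rd) (sM j).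
  by exists n.
pose P n := `[< exists2 r, 0 < r <= d & U [set j | c r j = n] >].
have exP : exists n, P n.
  have [n Un] := ex d d0 (lexx _); exists n; apply/asboolP; exists d => //.
  by rewrite d0 lexx.
case: (ex_minnP exP) => n /asboolP[rho /andP[rho0 rhod] Un] nmin.
exists rho; first by rewrite rho0.
exists n => r r0 rr; have rd := le_trans rr rhod.
have [n' Un'] := ex r r0 rd.
have nn' : (n <= n')%N by apply: nmin; apply/asboolP; exists r => //; rewrite r0.
have [j [/= c1 c2]] := @filter_ex _ _ UP _ (filterI Un Un').
have n'n : (n' <= n)%N by rewrite -c1 -c2; exact: cle.
by have <- : n' = n by apply/eqP; rewrite eqn_leq n'n.
Qed.

Variables (mu : probability (borel R[i]) R) (q : nat -> {poly R[i]}) (k_ : nat -> nat).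
Variable nu : probability (borel (sphere R)) R.
Hypothesis cK : compact (msupport mu).
Hypothesis iK : infinite_set (msupport mu).
Hypothesis qo : forall k : nat, monic_orthogonal mu k (q k).
Hypothesis k0 : forall j : nat, (0 < k_ j)%N.
Hypothesis kinc : {homo k_ : i j / (i < j)%N >-> (i < j)%N}.
Hypothesis qnu : weak_star_cvg (fun j => root_distribution (q (k_ j))) nu.
Let Q j := q (k_ j).
Let Om := unbounded_component (msupport mu).
Let D := potential_deriv (plane_part nu).
Let kap j : R := (size (root_seq (q (k_ j))))%:R.

(** The n roots of Q j near x tend to x along U, so Q j / b j tends to
    (z - x)^n, where b j has the other roots.  By [derivn_cvg] the normalised
    derivative of order m tends to (z - x)^n D^m, which has a zero of order
    n + e m at x, and [hurwitz] applies. *)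
Lemma local_counts (U : set_system nat) (m : nat) x : UltraFilter U -> \oo `<=` U -> Om x ->
  exists (rho : R) (n e : nat), [/\ 0 < rho, zero_order D x = e,
    forall w, w != x -> cmod (w - x) <= rho -> D w != 0 &
    forall r, 0 < r -> r <= rho -> \forall j \near U,
      count (fun w => cmod (w - x) <= r)%R (root_seq (Q j)) = n /\
      count (fun w => cmod (w - x) <= r)%R (root_seq ((Q j)^`(m))) = (n + e * m)%N].
Proof.
move=> UU oU xO; have UP := @ultra_proper _ _ UU; have UF := @filter_filter _ _ UP.
have [s1 [e [G [s10 DL GL G0 GE]]]] := limit_order cK iK qo k0 kinc qnu xO.
have xx : cmod (x - x) < s1 by rewrite subrr cmod0.
have xx' := ltW xx.
have ordD : zero_order D x = e.
  apply: zero_orderE; exists G; split.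
  - apply/nbhs_cmodP; exists s1 => // w ws; exact: rat_lim_derivable GL ws.
  - exact: G0.
  - by apply/nbhs_cmodP; exists s1 => // w /ltW; exact: GE.
have Dn0 w : w != x -> cmod (w - x) <= s1 -> D w != 0.
  move=> wx ws; rewrite /D GE// mulf_neq0 ?G0// expf_neq0// subr_eq0//.
have [d d0 [M mP]] := zeros_locally_bounded cK iK xO.
have cM j : (count (fun w => cmod (w - x) <= d)%R (root_seq (Q j)) <= M)%N.
  by apply: ltnW; apply: mP; exact: qo.
have [rho0 /andP[rho00 rho0d] [n nP]] := ultra_stable_count UU d0 cM.
pose rho1 := Num.min rho0 s1.
have rho10 : 0 < rho1 by rewrite lt_min rho00.
have r10 : rho1 <= rho0 by rewrite ge_min lexx.
have r1s : rho1 <= s1 by rewrite ge_min lexx orbT.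
clearbody rho1.
have cM1 j : (count (fun w => cmod (w - x) <= rho1)%R (root_seq (Q j)) <= M)%N.
  apply: leq_trans (cM j); apply: sub_count => w /= /le_trans; apply.
  exact: le_trans rho0d.
have [cv b0] := local_log_derivative cK iK qo k0 kinc qnu rho10 cM1.
pose b j := outer_part Q x rho1 j.
pose s := rho1 / 4; have s0 : 0 < s by rewrite divr_gt0.
have ss1 : s <= s1 by rewrite /s; move: rho10 r1s; lra.
have b0U : \forall j \near U, forall z, cdisk x s z -> (b j).[z] != 0.
  by apply: filterE => j z; exact: b0.
have kapU A : \forall j \near U, A <= kap j.
  by apply: oU; have /cvgryPge := index_cvg qo kinc; apply.
have cvU : ucvg U (fun j z => (b j)^`().[z] / ((kap j)%:C%C * (b j).[z])) (cdisk x s) D.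
  by move=> eps eps0; apply: oU; exact: cv.
have QU : ucvg U (fun j z => (Q j).[z] / (b j).[z]) (cdisk x s) (fun z => (z - x) ^+ n).
  move=> eps eps0; pose Z := n%:R * (s + 1) ^+ n + 1.
  have Z0 : 0 < Z by rewrite ltr_wpDl// mulr_ge0// exprn_ge0// addr_ge0// ltW.
  pose r := Num.min rho1 (Num.min 1 (eps / Z)).
  have r0 : 0 < r by rewrite !lt_min rho10 ltr01 divr_gt0.
  have rr : r <= rho1 by rewrite ge_min lexx.
  apply: filterS2 (nP r r0 (le_trans rr r10)) (nP rho1 rho10 r10) => j c1 c2 z zx.
  rewrite {1}(@outer_partE R Q x rho1 j (monic_q qo (k_ j))) hornerM mulfK ?b0// -{1}c2.
  have sub : subpred (fun w : R[i] => cmod (w - x) <= r) (fun w => cmod (w - x) <= rho1).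
    by move=> w /= /le_trans; exact.
  have cl := count_eq_sub sub (etrans c1 (esym c2)).
  apply: le_trans (prod_near_power (ltW r0) _ (ltW s0) cl zx) _.
    by rewrite !ge_min lexx orbT.
  rewrite c2; apply: (@le_trans _ _ (r * Z)).
    rewrite /Z mulrDr mulr1 mulrAC mulrC lerDl; exact: ltW.
  by rewrite -ler_pdivlMr// !ge_min lexx !orbT.
have fM z : cdisk x s z -> cmod ((z - x) ^+ n) <= s ^+ n.
  by move=> zx; rewrite cmodX; apply: lerXn2r; rewrite ?nnegrE ?cmod_ge0 ?(ltW s0).
have [Mg Mg0 gM] := rat_lim_bounded DL.
have gM' z : cdisk x s z -> cmod (D z) <= Mg by move=> zx; apply: gM; exact: cdiskS zx.
have s2 : s / 2 < s by rewrite ltr_pdivrMr// ltr_pMr// ltr1n.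
have s20 : 0 < s / 2 by rewrite divr_gt0.
have dcv := @derivn_cvg R nat U UF Q b kap x s _ _ _ _ b0U kapU QU fM cvU gM' m _ s2.
have sub2 : cdisk x (s / 2) `<=` cdisk x s by apply: cdiskS; exact: ltW.
have b0U2 : \forall j \near U, forall z, cdisk x (s / 2) z -> (b j).[z] != 0.
  by apply: filterS b0U => j H z /sub2; exact: H.
have kapC j : (kap j)%:C%C != 0 :> R[i].
  by rewrite -cmod_gt0 cmod_real gtr0_norm// (root_count_gt0 qo k0).
have NE : \forall j \near U, (kap j)%:C%C ^- m * lead_coef (Q j)^`(m) != 0 /\
    (kap j)%:C%C ^- m *: (Q j)^`(m) =
    ((kap j)%:C%C ^- m * lead_coef (Q j)^`(m)) *: \prod_(w <- root_seq (Q j)^`(m)) ('X - w%:P).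
  apply: oU; exists m => // j mj; split; last by rewrite -scalerA -root_seqE.
  rewrite mulf_neq0 ?invr_eq0 ?expf_neq0// lead_coef_eq0.
  apply: (@derivn_neq0 (Q j) (k_ j) m); first by have [_ sq _] := qo (k_ j); exact: sq.
  exact: leq_trans mj (index_ge kinc j).
have fE z : cdisk x (s / 2) z -> (z - x) ^+ n * D z ^+ m = (z - x) ^+ (n + e * m) * G z ^+ m.
  move=> /sub2 zx; rewrite /D GE; last exact: le_trans ss1.
  by rewrite exprMn mulrA -exprM exprD.
have cG : {for x, continuous (fun z => G z ^+ m)}.
  have c1 := rat_lim_continuous GL xx.
  elim: (m) => [|i IH].
    have -> : (fun z => G z ^+ 0) = cst 1 by apply/funext => z; rewrite expr0.
    exact: cst_continuous.
  have -> : (fun z => G z ^+ i.+1) = (fun z => G z * G z ^+ i).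
    by apply/funext => z; rewrite exprS.
  by apply: (@cvgM _ _ (nbhs x)).
have [rho2 rho20 hP] :=
  @hurwitz R nat U UF _ b _ _ x _ _ _ _ s20 b0U2 NE dcv fE cG (expf_neq0 m (G0 x xx')).
exists (Num.min rho1 rho2), n, e; split => //.
- by rewrite lt_min rho10.
- by move=> w wx; rewrite le_min => /andP[wr _]; apply: Dn0 => //; exact: le_trans r1s.
move=> r r0; rewrite le_min => /andP[h1 h2].
by apply: filterS2 (nP r r0 (le_trans h1 r10)) (hP r r0 h2).
Qed.

(** Along an ultrafilter the counts of [local_counts] are available, and the
    support of phi is covered by finitely many of the discs that they concern. *)
Lemma divisor_limit (m : nat) : divisor_cvg Om
  (fun j z => zero_divisor (horner ((q (k_ j))^`(m))) z - zero_divisor (horner (q (k_ j))) z)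
  (fun z => m%:Z * zero_divisor D z).
Proof.
have pn0 j : (m <= j)%N -> (q (k_ j))^`(m) != 0.
  move=> mj; apply: (@derivn_neq0 (Q j) (k_ j) m); first by have [_ sq _] := qo (k_ j); exact: sq.
  exact: leq_trans mj (index_ge kinc j).
have qn0 j : q (k_ j) != 0 by exact: (monic_neq0 (monic_q qo (k_ j))).
split.
- exists m => // j mj; apply: (@finite_is_divisor _ _ (root_seq (Q j)^`(m) ++ root_seq (Q j))).
  move=> z; rewrite mem_cat /zero_divisor !zero_order_horner ?pn0 ?qn0//.
  apply: contraNT; rewrite negb_or => /andP[/count_memPn -> /count_memPn ->].
  by rewrite subrr.
- move=> z zO lz; have [s1 [e [G [s10 DL GL G0 GE]]]] := limit_order cK iK qo k0 kinc qnu zO.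
  have [|w [wz [_ xw] ws]] := lz [set w | cmod (w - z) < s1].
    by apply/nbhs_cmodP; exists s1.
  move: xw; rewrite /zero_divisor zero_order0 ?mulr0 ?eqxx//.
  by rewrite /D GE ?(ltW ws)// mulf_neq0 ?G0 ?(ltW ws)// expf_neq0// subr_eq0.
move=> phi [cphi cS SO].
set S := closure _ in cS SO.
have phiS z : phi z != 0 -> S z by move=> pz; exact: subset_closure.
apply: cvg_ultra => U UU oU; have UP := @ultra_proper _ _ UU.
have UF := @filter_filter _ _ UP.
have /choice[rho rhoP] z : exists rho : R, S z -> exists n e : nat, [/\ 0 < rho, zero_order D z = e,
    forall w, w != z -> cmod (w - z) <= rho -> D w != 0 &
    forall r, 0 < r -> r <= rho -> \forall j \near U,
      count (fun w => cmod (w - z) <= r)%R (root_seq (Q j)) = n /\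
      count (fun w => cmod (w - z) <= r)%R (root_seq ((Q j)^`(m))) = (n + e * m)%N].
  have [zS|] := pselect (S z); last by exists 0.
  by have [rho [n [e H]]] := local_counts m UU oU (SO z zS); exists rho => _; exists n, e.
have /choice[n nP] z : exists n : nat, S z -> [/\ 0 < rho z,
    forall w, w != z -> cmod (w - z) <= rho z -> D w != 0 &
    forall r, 0 < r -> r <= rho z -> \forall j \near U,
      count (fun w => cmod (w - z) <= r)%R (root_seq (Q j)) = n /\
      count (fun w => cmod (w - z) <= r)%R (root_seq ((Q j)^`(m))) = (n + zero_order D z * m)%N].
  have [zS|] := pselect (S z); last by exists 0%N.
  by have [n [e [h1 <- h3 h4]]] := rhoP z zS; exists n.
have [zs [uzs zsS cover]] : exists zs : seq R[i], [/\ uniq zs, forall z, z \in zs -> S z &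
    forall w, S w -> exists2 z, z \in zs & cmod (w - z) <= rho z].
  have : cover_compact S by rewrite -compact_cover.
  move=> /(_ _ S (fun z => [set w | cmod (w - z) < rho z])).
  case=> [z zS||Z ZS Zc].
  - have -> : [set w | cmod (w - z) < rho z] = (fun w => cmod (w - z)) @^-1` [set y | y < rho z] by [].
    by apply: open_comp; [move=> w _; exact: cmodB_continuous | exact: open_lt].
  - by move=> w wS; exists w => //=; rewrite subrr cmod0; have [] := nP w wS.
  exists (finmap.enum_fset Z); split; first exact: finmap.fset_uniq.
    by move=> z /ZS; rewrite inE.
  by move=> w /Zc[z zZ /ltW wz]; exists z.
have cover' w : phi w != 0 -> exists2 z, z \in zs & cmod (w - z) <= rho z by move=> /phiS/cover.
have rho0 z : z \in zs -> 0 < rho z by move=> /zsS/nP[].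
have lim1 := @sum_limit R U UF (fun j => root_seq (Q j)) phi zs rho n uzs cphi cover' rho0.
have lim2 := @sum_limit R U UF (fun j => root_seq (Q j)^`(m)) phi zs rho
  (fun z => n z + zero_order D z * m)%N uzs cphi cover' rho0.
have {}lim1 : (fun j => \sum_(w <- root_seq (Q j)) phi w) @ U --> \sum_(z <- zs) (n z)%:R * phi z.
  apply: lim1 => z /zsS/nP[_ _ H] r r0 rr.
  by apply: filterS (H r r0 rr) => j [].
have {}lim2 : (fun j => \sum_(w <- root_seq (Q j)^`(m)) phi w) @ U -->
    \sum_(z <- zs) (n z + zero_order D z * m)%:R * phi z.
  apply: lim2 => z /zsS/nP[_ _ H] r r0 rr.
  by apply: filterS (H r r0 rr) => j [].
have -> : divisor_action Om (fun z => m%:Z * zero_divisor D z) phi =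
    \sum_(z <- zs) (n z + zero_order D z * m)%:R * phi z - \sum_(z <- zs) (n z)%:R * phi z.
  rewrite /divisor_action (fsbig_uniq_seq uzs).
  - rewrite -sumrB; apply: eq_bigr => z _; rewrite -mulrBl natrD addrC addKr.
    by rewrite /zero_divisor -PoszM -pmulrn mulnC.
  - move=> z zO zzs; have [->|/cover'[v vzs vz]] := eqVneq (phi z) 0; first exact: mulr0.
    rewrite /zero_divisor zero_order0 ?mulr0 ?mul0r//.
    have [_ H _] := nP v (zsS v vzs); apply: H vz.
    by apply: contraNneq zzs => ->.
  - by move=> z /zsS/SO.
apply: ((@cvg_cmodP R nat U UF _ _).2) => eps eps0.
have limB := ((@cvg_cmodP R nat U UF _ _).1 (cvgB lim2 lim1)) eps eps0.
have {}limB := limB UF.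
have Um : U [set j | (m <= j)%N] by apply: oU; exists m.
refine (@filterS2 _ U UF _ _ _ _ Um limB) => j mj.
by rewrite divisor_action_polys ?pn0 ?qn0// => z /phiS; exact: SO.
Qed.

End assembly.

Unset Implicit Arguments. Set Strict Implicit. Set Printing Implicit Defensive.

Theorem proposition2 (R : realType) (mu : probability (borel R[i]) R)
    (q : nat -> {poly R[i]}) (k_ : nat -> nat)
    (nu : probability (borel (sphere R)) R) :
  compact (msupport mu) ->
  infinite_set (msupport mu) ->
  (forall k : nat, monic_orthogonal mu k (q k)) ->
  (forall j : nat, (0 < k_ j)%N) ->
  {homo k_ : i j / (i < j)%N >-> (i < j)%N} ->
  weak_star_cvg (fun j => root_distribution (q (k_ j))) nu ->
  forall m : nat,
    divisor_cvg (unbounded_component (msupport mu))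
      (fun j z => zero_divisor (horner ((q (k_ j))^`(m))) z
                  - zero_divisor (horner (q (k_ j))) z)
      (fun z => m%:Z * zero_divisor (potential_deriv (plane_part nu)) z).
Proof. by move=> cK iK qo k0 kinc qnu m; exact: divisor_limit. Qed.
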